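(* Let $T>0$, $p>1$, $\alpha\in(1/p,1]$, let $f\in C([0,T]\times\mathbb{R},\mathbb{R})$, and put $F(t,x)=\int_0^x f(t,s)\,ds$. Suppose that: (i) there exist a constant $1<r_1<p$ and a function $a\in L^1([0,T],\mathbb{R}^+)$ such that $|f(t,x)|\le r_1 a(t)|x|^{r_1-1}$ for all $(t,x)\in[0,T]\times\mathbb{R}$; (ii) there exist a (nonempty) open interval $\mathbb{I}\subset[0,T]$ and constants $\eta,\delta>0$ and $1<r_2<p$ such that $F(t,x)\ge \eta|x|^{r_2}$ for all $(t,x)\in\mathbb{I}\times[-\delta,\delta]$. Then the boundary value problem $$ {}_tD_T^\alpha\,\phi_p({}_0D_t^\alpha u(t))=f(t,u(t)),\quad t\in(0,T),\qquad u(0)=u(T)=0, $$ possesses at least one nontrivial (i.e. not identically zero) weak solution.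
   Context: Here $\phi_p:\mathbb{R}\to\mathbb{R}$ is $\phi_p(s)=|s|^{p-2}s$ for $s\ne0$, $\phi_p(0)=0$. $\mathbb{R}^+$ denotes the nonnegative reals. Fractional calculus: for $\gamma>0$ the left and right Riemann-Liouville integrals are ${}_0I_t^\gamma u(t)=\frac1{\Gamma(\gamma)}\int_0^t(t-s)^{\gamma-1}u(s)\,ds$ and ${}_tI_T^\gamma u(t)=\frac1{\Gamma(\gamma)}\int_t^T(s-t)^{\gamma-1}u(s)\,ds$. For $0<\alpha<1$ the left and right Riemann-Liouville derivatives are ${}_0D_t^\alpha u(t)=\frac{d}{dt}\,{}_0I_t^{1-\alpha}u(t)$ and ${}_tD_T^\alpha u(t)=-\frac{d}{dt}\,{}_tI_T^{1-\alpha}u(t)$; for $\alpha=1$, ${}_0D_t^1u=u'$ and ${}_tD_T^1u=-u'$. Function space: $E_0^{\alpha,p}$ is the closure of $C_0^\infty([0,T],\mathbb{R})$ (smooth functions on $[0,T]$ vanishing at $0$ and $T$) with respect to the norm $(\|u\|_{L^p}^p+\|{}_0D_t^\alpha u\|_{L^p}^p)^{1/p}$, where $\|u\|_{L^p}=(\int_0^T|u(t)|^p\,dt)^{1/p}$. This norm is equivalent on $E_0^{\alpha,p}$ to $\|u\|_{E^{\alpha,p}}:=\|{}_0D_t^\alpha u\|_{L^p}$, which is the norm used. Elements of $E_0^{\alpha,p}$ satisfy $u,{}_0D_t^\alpha u\in L^p([0,T],\mathbb{R})$ and $u(0)=u(T)=0$. Weak solution: the energy functional is $I:E_0^{\alpha,p}\to\mathbb{R}$,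 $I(u)=\int_0^T\left(\frac1p|{}_0D_t^\alpha u(t)|^p-F(t,u(t))\right)dt$. It is $C^1$ (continuously Fréchet differentiable), with $\langle I'(u),v\rangle=\int_0^T\phi_p({}_0D_t^\alpha u(t))\,{}_0D_t^\alpha v(t)\,dt-\int_0^Tf(t,u(t))v(t)\,dt$ for $u,v\in E_0^{\alpha,p}$. A weak solution of the boundary value problem is a critical point of $I$, i.e. $u\in E_0^{\alpha,p}$ with $I'(u)=0$. *)

(* Defs.v *)
From HB Require Import structures.
From mathcomp Require Import all_boot all_order all_algebra.
From mathcomp Require Import all_classical all_reals all_analysis.
Set Implicit Arguments.
Unset Strict Implicit.
Unset Printing Implicit Defensive.
Import Order.TTheory GRing.Theory Num.Theory.
Import numFieldNormedType.Exports.
Local Open Scope classical_set_scope.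
Local Open Scope ring_scope.

Section FractionalBVP.
Context {R : realType}.
Notation mu := (@lebesgue_measure R).
Implicit Types (T p alpha gamma : R) (u v w : R -> R) (f : R -> R -> R).

(* The second factor makes the value at 0 equal to 0 for every p. *)
Definition phi_p p (s : R) : R := `|s| `^ (p - 2) * s.

(* lebesgue_measure is defined on Borel sets; a function is Lebesgue
   measurable iff it is a.e. equal to a Borel function.  A function on [0, T]
   is represented by u : R -> R, whose values outside [0, T] are irrelevant. *)
Definition inLp T p u : Prop :=
  exists2 w, w \in Lfun mu p%:E &
    {ae mu, forall t, t \in `[0, T] -> u t = w t}.

Definition LpnormE T p u : \bar R :=
  'N[mu]_(p%:E)[EFin \o (u \_ `[0, T])].

Definition Gamma gamma : R :=
  \int[mu]_(s in `]0, +oo[) (s `^ (gamma - 1) * expR (- s)).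

Definition RLint gamma u (t : R) : R :=
  (Gamma gamma)^-1 * \int[mu]_(s in `[0, t]) ((t - s) `^ (gamma - 1) * u s).

(* The order-0 integral is the identity, so that order alpha = 1 gives u'. *)
Definition RLprim alpha u : R -> R :=
  if alpha == 1 then u else RLint (1 - alpha) u.

Definition fracD alpha u : R -> R := derive1 (RLprim alpha u).

(* derive1 is total: existence of the derivative has to be stated apart. *)
Definition fracD_exists T alpha u : Prop :=
  {ae mu, forall t, t \in `]0, T[ -> derivable (RLprim alpha u) t 1}.

(* A smooth function on [0, T] is the restriction of a smooth function on R;
   no compact support in ]0, T[ is required. *)
Definition C0inf T (phi : R -> R) : Prop :=
  [/\ forall n t, derivable (derive1n n phi) t 1, phi 0 = 0 & phi T = 0].

(* graph_norm u (fracD alpha u) is the norm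
   (||u||_p^p + ||D^alpha u||_p^p)^(1/p). *)
Definition graph_norm T p u w : \bar R :=
  ((LpnormE T p u `^ p + LpnormE T p w `^ p) `^ (p^-1)%R)%E.

(* The predicate is invariant under the choice of an a.e.-equal u when
   alpha < 1; when alpha = 1, a.e. derivability selects representatives, and
   every class has one.  The norm of u - phi_k is written with
   D u - D phi_k rather than D (u - phi_k), so that the default values of the
   total operators \int and derive1 play no role. *)
Definition E0 T p alpha : set (R -> R) :=
  [set u | [/\ inLp T p u, fracD_exists T alpha u, inLp T p (fracD alpha u) &
    exists2 phi : (R -> R)^nat, (forall k, C0inf T (phi k)) &
      graph_norm T p (u \- phi k) (fracD alpha u \- fracD alpha (phi k))
        @[k --> \oo] --> 0%E]].

Definition Enorm T p alpha u : R := fine (LpnormE T p (fracD alpha u)).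

Definition primitive f (t x : R) : R :=
  if 0 <= x then \int[mu]_(s in `[0, x]) f t s
  else - \int[mu]_(s in `[x, 0]) f t s.

Definition energy T p alpha f u : R :=
  \int[mu]_(t in `[0, T])
    (p^-1 * `|fracD alpha u t| `^ p - primitive f t (u t)).

Definition denergy T p alpha f u v : R :=
  \int[mu]_(t in `[0, T]) (phi_p p (fracD alpha u t) * fracD alpha v t) -
  \int[mu]_(t in `[0, T]) (f t (u t) * v t).

(* L is the Frechet derivative at u of J : E -> R, where E is a linear space
   of functions with norm N. *)
Definition is_frechet_derivative (E : set (R -> R)) (N J : (R -> R) -> R) u
    (L : (R -> R) -> R) : Prop :=
  [/\ forall (k : R) v w, E v -> E w ->
        L (fun t => k * v t + w t) = k * L v + L w,
      exists M : R, forall v, E v -> `|L v| <= M * N v &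
      forall eps : R, 0 < eps -> exists2 delta : R, 0 < delta &
        forall v, E v -> N v < delta ->
          `|J (u \+ v) - J u - L v| <= eps * N v].

(* u is a critical point of the energy: its Frechet derivative at u exists,
   is given by the usual formula, and is 0. *)
Definition weak_solution T p alpha f u : Prop :=
  [/\ E0 T p alpha u,
      is_frechet_derivative (E0 T p alpha) (Enorm T p alpha)
        (energy T p alpha f) u (denergy T p alpha f u) &
      forall v, E0 T p alpha v -> denergy T p alpha f u v = 0].

End FractionalBVP.

(* Main.v *)
Require Import Defs.
From HB Require Import structures.
From mathcomp Require Import all_boot all_order all_algebra.
From mathcomp Require Import all_classical all_reals all_analysis.
From mathcomp Require Import measurable_realfun ring lra.
Set Implicit Arguments.
Unset Strict Implicit.
Unset Printing Implicit Defensive.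
Import Order.TTheory GRing.Theory Num.Theory.
Import numFieldNormedType.Exports.
Local Open Scope classical_set_scope.
Local Open Scope ring_scope.

(** The argument is the direct method of the calculus of variations, carried
    out on fractional derivatives instead of functions.

    A function u of the energy space is determined by its derivative w:
    Abel's inversion formula (RLprim_fracI) gives u = fracI w, and the
    derivatives form a closed subspace of L^p, derivative_space (E0_intro,
    E0_rep).  As alpha > 1 / p, Hoelder's inequality for the kernel makes
    fracI w a Hoelder function of exponent alpha - 1 / p whose constant is
    controlled by the L^p norm of w (conv_hoelder).  The energy of u becomes
    the action of w, the difference of |w|_p^p / p and of the potential, that
    is, of the integral of F(t, fracI w(t)).

    The action has a minimizer (action_minimizer).  By the growth condition
    r1 < p it is coercive, so a minimizing sequence (w_n) is bounded in L^p and
    the functions fracI w_n are bounded and equi-Hoelder; a subsequence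
    converges uniformly (hoelder_subsequence), and the potentials converge.
    Weak limits are avoided: the action at the midpoint of w_i and w_j is at
    least the infimum, so the convexity gap of the p-th power is
    asymptotically 0, and a quantitative form of uniform convexity
    (powR_uniform_convex) shows that (w_n) is a Cauchy sequence in L^p.

    The minimum is negative (action_negative): on a small multiple s phi of a
    bump function supported in the given interval, the potential is at least
    of order s^r2, which exceeds the order s^p of the other term.  As the
    zero function has action 0, the minimizer is nontrivial.

    Finally the action is Frechet differentiable (action_frechet): for the
    mass this is an integrated pointwise estimate (powR_derivative_estimate),
    and for the potential it follows from the uniform continuity of f on
    [0, T] x [-M, M], as fracI maps L^p to bounded functions.  The derivative
    vanishes at a minimizer (minimizer_critical).  For alpha = 1 the same
    argument applies, fracI being the ordinary primitive. *)

(** * Inequalities between powers *)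

Section PowerInequalities.
Context {R : realType}.
Implicit Types (p q a b x y eps : R).

Lemma powR_normD p a b : 0 <= p ->
  `|a + b| `^ p <= 2 `^ p * (`|a| `^ p + `|b| `^ p).
Proof.
move=> p0; wlog ab : a b / `|b| <= `|a|.
  move=> H; have [/H//|/ltW/H] := leP `|b| `|a|.
  by rewrite addrC (addrC (`|b| `^ p)).
apply: (@le_trans _ _ ((2 * `|a|) `^ p)).
  apply: ge0_ler_powR; rewrite ?nnegrE ?mulr_ge0//.
  by rewrite (le_trans (ler_normD _ _))// mulrDl mul1r lerD2l.
by rewrite powRM// ler_wpM2l ?powR_ge0// lerDl powR_ge0.
Qed.

Lemma powR_inv p x : 0 <= x -> x^-1 `^ p = (x `^ p)^-1.
Proof.
by move=> x0; rewrite -[x^-1]powR_inv1// -powRrM mulN1r powRN.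
Qed.

(** Bernoulli's inequality for real exponents: with x = exp u it follows from
    1 + v < exp v at v = (p - 1) u and from 1 - u <= exp (- u). *)
Lemma powR_ge1Dx_lt p x : 1 < p -> 0 <= x -> x != 1 ->
  1 + p * (x - 1) < x `^ p.
Proof.
move=> p1; rewrite le_eqVlt => /predU1P[<- _|x0 x1].
  by rewrite powR0 ?gt_eqF//; lra.
have [u xE] := expR_total x0; rewrite -xE -expRM.
have u0 : u != 0 by apply: contra x1 => /eqP; rewrite -xE => ->; rewrite expR0.
have -> : u * p = u + (p - 1) * u by ring.
rewrite expRD.
have h1 : 1 + (p - 1) * u < expR ((p - 1) * u).
  by apply: expR_gt1Dx; rewrite mulf_neq0// subr_eq0 gt_eqF.
have h2 : 1 - u <= expR (- u) by have := expR_ge1Dx (- u).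
have e0 := expR_gt0 u.
have h3 : (1 - u) * expR u <= 1.
  have := @expRxMexpNx_1 _ u; nra.
have : expR u * (1 + (p - 1) * u) < expR u * expR ((p - 1) * u) by rewrite ltr_pM2l.
apply: le_lt_trans; nra.
Qed.

Lemma powR_ge1Dx p x : 1 < p -> 0 <= x -> 1 + p * (x - 1) <= x `^ p.
Proof.
move=> p1 x0; have [->|x1] := eqVneq x 1; first by rewrite powR1 subrr mulr0 addr0.
by rewrite ltW// powR_ge1Dx_lt.
Qed.

(** Bernoulli's inequality at 1 / m and b / m, where m is the midpoint: the
    mean of these two numbers is 1, so the linear terms cancel. *)
Lemma powR_midpoint_lt p b : 1 < p -> 0 <= b < 1 ->
  ((1 + b) / 2) `^ p < (1 + b `^ p) / 2.
Proof.
move=> p1 /andP[b0 b1]; set m := (1 + b) / 2.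
have m0 : 0 < m by rewrite /m; lra.
have mp0 : 0 < m `^ p by rewrite powR_gt0.
have h1 : 1 + p * (m^-1 - 1) < (m^-1) `^ p.
  apply: powR_ge1Dx_lt; rewrite ?invr_ge0 ?ltW//.
  by rewrite invr_eq1 lt_eqF// /m; lra.
have h2 : 1 + p * (b / m - 1) <= (b / m) `^ p.
  by apply: powR_ge1Dx => //; rewrite divr_ge0 // ltW.
move: h1 h2; rewrite powRM ?invr_ge0 ?(ltW m0)// !powR_inv ?(ltW m0)// => h1 h2.
have : 2 < (1 + b `^ p) / m `^ p.
  have e : m^-1 + b / m = 2 by rewrite /m; field; apply/eqP; lra.
  have := ltr_leD h1 h2; rewrite mulrDl mul1r; apply: le_lt_trans.
  have -> : 1 + p * (m^-1 - 1) + (1 + p * (b / m - 1)) = 2 + p * ((m^-1 + b / m) - 2) by ring.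
  by rewrite e subrr mulr0 addr0.
by rewrite ltr_pdivlMr// => h; rewrite ltr_pdivlMr// mulrC.
Qed.

Lemma powR_midpoint_norm_lt p b : 1 < p -> -1 <= b < 1 ->
  `|(1 + b) / 2| `^ p < (1 + `|b| `^ p) / 2.
Proof.
move=> p1 /andP[b0 b1].
have p0 : 0 < p by lra.
have [/eqP bE|bN1] := eqVneq b (-1).
  have -> : b = -1 by apply/eqP.
  by rewrite addrN mul0r normr0 powR0 ?gt_eqF// normrN1 powR1.
have bl1 : `|b| < 1 by rewrite ltr_norml b1 andbT lt_neqAle eq_sym bN1.
apply: (@le_lt_trans _ _ (((1 + `|b|) / 2) `^ p)).
  apply: ge0_ler_powR; rewrite ?nnegrE ?divr_ge0 ?addr_ge0// ?(ltW p0)//.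
  rewrite normrM (@ger0_norm _ 2^-1)// ler_pM2r//.
  by rewrite (le_trans (ler_normD _ _))// normr1.
by apply: powR_midpoint_lt => //; rewrite normr_ge0.
Qed.

(** On [0, x] the function z^q lies below its chord through 0 and x; add the
    bounds at x - y and at y. *)
Lemma powR_superadd q x y : 1 <= q -> 0 <= y <= x ->
  (x - y) `^ q <= x `^ q - y `^ q.
Proof.
move=> q1 /andP[y0]; have q0 : q != 0 by rewrite gt_eqF// (lt_le_trans ltr01).
rewrite le_eqVlt => /predU1P[<-|yx]; first by rewrite !subrr powR0.
have x0 : 0 < x by lra.
have key z : 0 <= z <= x -> z `^ q <= x `^ q * (z / x).
  move=> /andP[]; rewrite le_eqVlt => /predU1P[<- _|z0 zx].
    by rewrite powR0// mul0r mulr0.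
  have -> : z `^ q = x `^ q * (z / x) `^ q.
    by rewrite -powRM ?divr_ge0 ?ltW// mulrCA divff ?mulr1// gt_eqF.
  rewrite ler_wpM2l ?powR_ge0//; apply: ge1r_powR => //.
  by rewrite divr_gt0//= ler_pdivrMr// mul1r.
have /key h1 : 0 <= x - y <= x by apply/andP; split; lra.
have /key h2 : 0 <= y <= x by apply/andP; split; lra.
rewrite lerBrDr (le_trans (lerD h1 h2))//.
by rewrite -mulrDr -mulrDl subrK divff ?gt_eqF// mulr1.
Qed.

End PowerInequalities.

Section UniformConvexity.
Context {R : realType}.
Implicit Types (p q a b x y eps : R).

Lemma continuous_norm_powR p : 0 < p -> continuous (fun x : R => `|x| `^ p).
Proof.
move=> p0 x; have [->|x0] := eqVneq x 0.
  apply/cvgrPdist_lt => e e0; rewrite normr0 powR0 ?gt_eqF//.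
  near=> y; rewrite sub0r normrN ger0_norm ?powR_ge0//.
  have -> : e = (e `^ p^-1) `^ p by rewrite -powRrM mulVf ?gt_eqF// powRr1// ltW.
  apply: gt0_ltr_powR; rewrite ?nnegrE ?powR_ge0//.
  rewrite -[y]subr0 distrC; near: y.
  by apply: (@cvgr_dist_lt _ _ _ _ _ id (0:R)) => //; rewrite powR_gt0.
have xp : 0 < `|x| by rewrite normr_gt0.
apply: (@continuous_comp R R R (fun x : R => `|x|) (fun x : R => x `^ p) x).
  exact: norm_continuous.
apply: differentiable_continuous; apply/derivable1_diffP.
by apply: derivable_powR; rewrite in_itv/= xp.
Unshelve. all: by end_near. Qed.

Lemma powR_ge1 r x : 0 <= r -> 1 <= x -> 1 <= x `^ r.
Proof. by move=> r0 x1; rewrite -[leLHS](powRr0 x) ler_powR. Qed.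

(** Away from b = 1 the convexity gap is positive and continuous, hence
    bounded below on a compact interval; near b = 1 the left-hand side is
    below eps. *)
Lemma powR_uniform_convex1 p eps : 1 < p -> 0 < eps -> exists2 C, 0 < C &
  forall b, -1 <= b <= 1 -> `|1 - b| `^ p <= eps +
    C * ((1 + `|b| `^ p) / 2 - `|(1 + b) / 2| `^ p).
Proof.
move=> p1 eps0; have p0 : 0 < p by lra.
pose g b := (1 + `|b| `^ p) / 2 - `|(1 + b) / 2| `^ p.
have gc : continuous g.
  move=> x; apply: cvgB; last first.
    apply: (@continuous_comp R R R (fun x : R => (1 + x) / 2) (fun x : R => `|x| `^ p) x).
      by apply: cvgMr_tmp; apply: cvgD; [exact: cvg_cst|exact: cvg_id].
    exact: continuous_norm_powR.
  apply: cvgMr_tmp; apply: cvgD; [exact: cvg_cst|exact: continuous_norm_powR].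
pose d := eps `^ p^-1.
have d0 : 0 < d by rewrite powR_gt0.
pose m := Num.max (-1) (1 - d).
have m1 : m < 1 by rewrite /m; case: (leP (-1) (1 - d)); lra.
have mm : -1 <= m by rewrite /m le_max lexx.
have [||c /[!in_itv]/= /andP[c1 cm] cmin] := @EVT_min _ g (-1) m.
- exact: mm.
- exact: continuous_subspaceT.
have gc0 : 0 < g c by rewrite subr_gt0 powR_midpoint_norm_lt// c1/= (le_lt_trans cm).
have g0 b : -1 <= b <= 1 -> 0 <= g b.
  move=> /andP[b1]; rewrite le_eqVlt => /predU1P[->|bl1].
    by rewrite /g normr1 powR1 -[1 + 1]/(2%:R) divff// normr1 powR1 subrr.
  by rewrite subr_ge0 ltW// powR_midpoint_norm_lt// b1.
exists (2 `^ p / g c) => [|b b11]; first by rewrite divr_gt0// powR_gt0.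
have b0 := g0 _ b11; move: b11 => /andP[bN1 b1].
have [bm|mb] := leP b m.
  rewrite -/(g b) (@le_trans _ _ (2 `^ p))//.
    by apply: ge0_ler_powR; rewrite ?nnegrE// ?(ltW p0)// ger0_norm; lra.
  have h : g c <= g b by apply: cmin; rewrite in_itv/= bN1.
  rewrite -mulrA ler_wpDl ?(ltW eps0)// ler_peMr ?powR_ge0//.
  by rewrite mulrC ler_pdivlMr// mul1r.
apply: (@le_trans _ _ eps); last by rewrite lerDl mulr_ge0// divr_ge0 ?powR_ge0// ltW.
have -> : eps = d `^ p by rewrite /d -powRrM mulVf ?gt_eqF// powRr1// ltW.
apply: ge0_ler_powR; rewrite ?nnegrE ?(ltW p0) ?(ltW d0)//.
rewrite ger0_norm ?subr_ge0//; move: mb; rewrite /m gt_max; lra.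
Qed.

(** Uniform convexity of L^p in pointwise form: the p-th power of the distance
    is controlled by the convexity gap at the midpoint, up to a small multiple
    of the masses. By homogeneity it suffices to treat a = 1 and |b| <= 1. *)
Lemma powR_uniform_convex p eps : 1 < p -> 0 < eps -> exists2 C, 0 < C &
  forall a b, `|a - b| `^ p <= eps * (`|a| `^ p + `|b| `^ p) +
    C * ((`|a| `^ p + `|b| `^ p) / 2 - `|(a + b) / 2| `^ p).
Proof.
move=> p1 eps0; have p0 : 0 < p by lra.
have [C C0 H] := powR_uniform_convex1 p1 eps0; exists C => // a b.
wlog ab : a b / `|b| <= `|a|.
  move=> G; have [/G//|/ltW/G] := leP `|b| `|a|.
  by rewrite distrC [a + b]addrC [_ `^ p + _]addrC.
have [a0|a0] := eqVneq a 0.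
  move: ab; rewrite a0 normr0 normr_le0 => /eqP ->.
  by rewrite subrr addr0 mul0r normr0 powR0 ?gt_eqF// addr0 mulr0 mul0r subrr mulr0 addr0.
have an0 : 0 < `|a| by rewrite normr_gt0.
set t := b / a; have bE : b = a * t by rewrite /t mulrCA divff// mulr1.
have t1 : -1 <= t <= 1 by rewrite -ler_norml /t normrM normfV ler_pdivrMr// mul1r.
have := H _ t1.
have e1 : a - b = a * (1 - t) by rewrite {1}bE; ring.
have e2 : (a + b) / 2 = a * ((1 + t) / 2) by rewrite {1}bE; ring.
have e3 : `|b| `^ p = `|a| `^ p * `|t| `^ p by rewrite {1}bE normrM powRM.
rewrite e1 e2 e3 2!(normrM a) !(powRM _ (normr_ge0 a) (normr_ge0 _)).
have ap : 0 < `|a| `^ p by rewrite powR_gt0.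
rewrite -(ler_pM2l ap); set A := `|a| `^ p => h.
apply: le_trans h _.
have h1 : eps * A <= eps * (A + A * `|t| `^ p).
  by rewrite ler_wpM2l ?(ltW eps0)// lerDl mulr_ge0 ?powR_ge0// ltW.
have -> : forall u v, A * (eps + C * ((1 + u) / 2 - v)) = eps * A + C * ((A + A * u) / 2 - A * v).
  by move=> u v; ring.
by rewrite lerD2r.
Qed.

(** For small b, Bernoulli's inequality at x = 1 + b and at 1 / x puts the
    remainder between 0 and (x^(p-1) - 1) (x - 1); for |b| bounded away from 0
    every term is dominated by |b|^p. *)
Lemma powR_derivative_estimate1 p eps : 1 < p -> 0 < eps -> exists2 C, 0 < C &
  forall b, `| `|1 + b| `^ p / p - p^-1 - b| <= eps * `|b| + C * `|b| `^ p.
Proof.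
move=> p1 eps0; have p0 : 0 < p by lra.
have [d /= d0 Hd] : \forall x \near (1 : R), `| `|1| `^ (p - 1) - `|x| `^ (p - 1)| < eps.
  apply: (@cvgr_dist_lt _ _ _ (nbhs (1:R)) _ (fun x : R => `|x| `^ (p - 1))) => //.
  by apply: continuous_norm_powR; lra.
pose e := Num.min d 1.
have e0 : 0 < e by rewrite lt_min d0 ltr01.
(* The summands dominate, in this order, the terms |1 + b|^p / p, 1 / p and
   |b| when |b| >= e. *)
pose C := ((e^-1 + 1) `^ p + p^-1 * e^-1 `^ p + e^-1 `^ (p - 1)).
have ei : 0 < e^-1 by rewrite invr_gt0.
exists C => [|b].
  by rewrite /C addr_gt0 ?addr_gt0 ?mulr_gt0 ?powR_gt0 ?invr_gt0 ?addr_gt0.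
have [be|eb] := ltP `|b| e.
  apply: (@le_trans _ _ (eps * `|b|)); last first.
    by rewrite lerDl mulr_ge0 ?powR_ge0// /C !addr_ge0 ?mulr_ge0 ?powR_ge0 ?invr_ge0// ltW.
  have [bd b1] : `|b| < d /\ `|b| < 1 by move: be; rewrite lt_min => /andP.
  have x0 : 0 < 1 + b by move: b1; rewrite ltr_norml; lra.
  rewrite (gtr0_norm x0); set x := 1 + b; have bE : b = x - 1 by rewrite /x; ring.
  have lo : 1 + p * (x - 1) <= x `^ p by apply: powR_ge1Dx => //; exact: ltW.
  have := @powR_ge1Dx _ p x^-1 p1; rewrite invr_ge0 ltW// => /(_ isT).
  rewrite powR_inv ?(ltW x0)// => up.
  have xp0 : 0 < x `^ p by rewrite powR_gt0.
  have {}up : x `^ p - 1 <= p * x `^ (p - 1) * (x - 1).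
    rewrite -mulr_powRB1 ?(ltW x0)//; rewrite -(ler_pM2l xp0) mulfV ?gt_eqF// in up.
    move: up; rewrite -mulr_powRB1 ?(ltW x0)//; set X := x `^ (p - 1).
    have -> : x * X * (1 + p * (x^-1 - 1)) = x * X + p * X * (x * x^-1 - x) by ring.
    rewrite mulfV ?gt_eqF//; lra.
  have near1 : `|1 - x `^ (p - 1)| < eps.
    have := Hd x; rewrite /= normr1 powR1 (gtr0_norm x0); apply.
    by rewrite /ball/= /x opprD addNKr normrN.
  have -> : x `^ p / p - p^-1 - b = (x `^ p - 1 - p * (x - 1)) / p.
    by rewrite bE; field; rewrite gt_eqF.
  rewrite normrM normfV (gtr0_norm p0) ler_pdivrMr//.
  rewrite ger0_norm; last by lra.
  apply: (@le_trans _ _ (p * ((x `^ (p - 1) - 1) * (x - 1)))); first by lra.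
  rewrite mulrC ler_pM2r// (le_trans (ler_norm _))// normrM distrC -bE.
  by rewrite ler_wpM2r// ltW.
have b0 : 0 < `|b| by exact: lt_le_trans eb.
have eb1 : 1 <= e^-1 * `|b| by rewrite mulrC ler_pdivlMr// mul1r.
apply: (@le_trans _ _ (C * `|b| `^ p)); last by rewrite lerDr mulr_ge0// ltW.
have pV : 0 < p^-1 by rewrite invr_gt0.
have pV1 : p^-1 <= 1 by rewrite invf_le1// ltW.
rewrite (le_trans (ler_normB _ _))// /C mulrDl; apply: lerD; last first.
  rewrite -(mulr_powRB1 (normr_ge0 b) p0) mulrCA ler_peMr// -powRM ?(ltW ei)//.
  by apply: powR_ge1 => //; lra.
rewrite (le_trans (ler_normB _ _))// mulrDl; apply: lerD; last first.
  rewrite gtr0_norm// -mulrA -powRM ?(ltW ei)// ler_peMr ?(ltW pV)//.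
  by apply: powR_ge1 => //; lra.
rewrite ger0_norm ?divr_ge0 ?powR_ge0 ?(ltW p0)//.
rewrite (@le_trans _ _ (`|1 + b| `^ p))//; first by rewrite ler_piMr ?powR_ge0.
rewrite -powRM ?addr_ge0 ?(ltW ei)//; apply: ge0_ler_powR; rewrite ?nnegrE ?mulr_ge0 ?addr_ge0 ?(ltW ei) ?(ltW p0)//.
by rewrite mulrDl mul1r (le_trans (ler_normD _ _))// normr1 lerD2r.
Qed.

Lemma norm_phi_p p a : 1 < p -> `|phi_p p a| = `|a| `^ (p - 1).
Proof.
move=> p1; have [->|a0] := eqVneq a 0.
  by rewrite /phi_p mulr0 normr0 powR0// gt_eqF// subr_gt0.
rewrite /phi_p normrM ger0_norm ?powR_ge0// mulrC -[in RHS](@mulr_powRB1 _ _ (p - 1))//; last lra.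
by congr (_ * _ `^ _); ring.
Qed.

(** Pointwise form of the differentiability of the integral of |w|^p. The
    constant does not depend on a, so that the estimate can be integrated over
    all values of w. *)
Lemma powR_derivative_estimate p eps : 1 < p -> 0 < eps -> exists2 C, 0 < C &
  forall a b, `| `|a + b| `^ p / p - `|a| `^ p / p - phi_p p a * b| <=
    eps * (`|a| `^ (p - 1) * `|b|) + C * `|b| `^ p.
Proof.
move=> p1 eps0; have p0 : 0 < p by lra.
have pV : 0 < p^-1 by rewrite invr_gt0.
have pV1 : p^-1 <= 1 by rewrite invf_le1// ltW.
have [C C0 H] := powR_derivative_estimate1 p1 eps0.
exists (C + 1); [lra|move=> a b].
have [->|a0] := eqVneq a 0.
  rewrite add0r normr0 powR0 ?gt_eqF// mul0r subr0 /phi_p mulr0 mul0r subr0.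
  rewrite ger0_norm ?divr_ge0 ?powR_ge0 ?(ltW p0)//.
  have bp := powR_ge0 `|b| p.
  rewrite [X in _ <= X + _]mulrC powR0 ?mul0r ?add0r; last by rewrite gt_eqF//; lra.
  rewrite ?mul0r ?add0r; nra.
set t := b / a; have bE : b = a * t by rewrite /t mulrCA divff// mulr1.
have ap : 0 < `|a| `^ p by rewrite powR_gt0// normr_gt0.
have an0 : 0 < `|a| by rewrite normr_gt0.
have := H t; rewrite -(ler_pM2l ap) => h.
have e1 : phi_p p a * b = `|a| `^ p * t.
  rewrite /phi_p bE mulrA -mulrA -[in RHS](@mulr_powRB1 _ _ p)//.
  rewrite -[in RHS](@mulr_powRB1 _ _ (p - 1))//; last lra.
  have -> : p - 1 - 1 = p - 2 by ring.
  have : `|a| * `|a| = a * a by rewrite -normrM ger0_norm// -expr2 sqr_ge0.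
  by set X := _ `^ _ => e; rewrite (mulrA `|a|) e; ring.
have e2 : `|a + b| `^ p = `|a| `^ p * `|1 + t| `^ p.
  by rewrite bE -[X in `|X + _|]mulr1 -mulrDr normrM powRM.
rewrite e1 e2; have -> : forall A B, A * B / p - A / p - A * t = A * (B / p - p^-1 - t).
  by move=> A B; ring.
rewrite normrM (gtr0_norm ap) (le_trans h)//.
rewrite mulrDr !mulrA [_ * C]mulrC -!mulrA -powRM// -normrM -bE.
apply: lerD; last by rewrite ler_wpM2r ?powR_ge0//; lra.
have -> : `|b| = `|a| * `|t| by rewrite {1}bE normrM.
rewrite -(mulr_powRB1 (normr_ge0 a) p0) le_eqVlt; apply/predU1P; left; ring.
Qed.

End UniformConvexity.

(** * Integration of real-valued functions *)

Section AlmostEverywhere.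
Import HBNNSimple.
Context {R : realType}.
Notation mu := (@lebesgue_measure R).
Local Open Scope ereal_scope.

Lemma ae_impl (P Q : R -> Prop) : (forall x, P x -> Q x) ->
  {ae mu, forall x, P x} -> {ae mu, forall x, Q x}.
Proof. by move=> PQ; apply: filterS; first exact: (ae_filter_ringOfSetsType mu). Qed.

Lemma ae_everywhere (P : R -> Prop) : (forall x, P x) -> {ae mu, forall x, P x}.
Proof. by move=> h; apply: filterE; first exact: (ae_filter_ringOfSetsType mu). Qed.

Lemma ae_impl2 (P Q S : R -> Prop) : (forall x, P x -> Q x -> S x) ->
  {ae mu, forall x, P x} -> {ae mu, forall x, Q x} -> {ae mu, forall x, S x}.
Proof. by move=> PQ; apply: filterS2; first exact: (ae_filter_ringOfSetsType mu). Qed.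

(** A simple function below f can be cut off on the null set where f and g
    differ; this is why f and g may be arbitrary functions. *)
Lemma ge0_integral_le_ae_eq (f g : R -> \bar R) :
  (forall x, 0 <= f x) -> (forall x, 0 <= g x) ->
  {ae mu, forall x, f x = g x} -> \int[mu]_x f x <= \int[mu]_x g x.
Proof.
move=> f0 g0 [N [mN N0 fgN]].
rewrite [leLHS]ge0_integralTE//; apply: ge_ereal_sup => _ [h hf <-].
have mC : measurable (~` N) by exact: measurableC.
pose h' := proj_nnsfun h mC.
have -> : sintegral mu (h) =
    sintegral mu (h').
  rewrite -!integralT_nnsfun; apply: ae_eq_integral => //.
  - exact/measurable_EFinP.
  - exact/measurable_EFinP.
  exists N; split => // x /= hx; apply: contrapT => Nx; apply: hx => _.
  by rewrite mindicE mem_set// mulr1.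
rewrite [leRHS]ge0_integralTE//; apply: ereal_sup_ubound; exists h' => // x /=.
rewrite mindicE; have [|xN] := boolP (x \in ~` N).
  rewrite inE => xN; rewrite mulr1 (le_trans (hf x))//.
  have <- : f x = g x by apply: contrapT => H; apply/xN/fgN.
  exact: lexx.
by rewrite mulr0.
Qed.

(** The integrands are arbitrary because the functions of the energy space are
    only almost everywhere equal to Borel functions. *)
Lemma ae_integral (D : set R) (f g : R -> \bar R) :
  {ae mu, forall x, D x -> f x = g x} ->
  \int[mu]_(x in D) f x = \int[mu]_(x in D) g x.
Proof.
move=> fg; rewrite integral_mkcond [RHS]integral_mkcond integralE [RHS]integralE.
have fgD : {ae mu, forall x, (f \_ D) x = (g \_ D) x}.
  move: fg; apply: ae_impl => x h; rewrite !patchE.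
  by case: ifPn => // /[1!inE] /h.
by congr (_ - _); apply/eqP; rewrite eq_le; apply/andP; split;
  apply: ge0_integral_le_ae_eq => //; move: fgD; apply: ae_impl => x h;
  rewrite ?funeposE ?funenegE h.
Qed.

Lemma ae_Rintegral (D : set R) (f g : R -> R) :
  {ae mu, forall x, D x -> f x = g x} ->
  (\int[mu]_(x in D) f x = \int[mu]_(x in D) g x)%R.
Proof.
move=> fg; congr fine; apply: ae_integral; move: fg.
by apply: ae_impl => x h /h ->.
Qed.

End AlmostEverywhere.

Section RealIntegrability.
Context {R : realType}.
Notation mu := (@lebesgue_measure R).
Implicit Types (D : set R) (f g : R -> R) (k a b : R).

Definition Rintegrable D f : Prop := mu.-integrable D (EFin \o f).

Lemma Rintegrable_measurable D f : Rintegrable D f -> measurable_fun D f.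
Proof. by move=> /integrableP[/measurable_EFinP]. Qed.

Lemma Rintegrable_le D f g : measurable D -> measurable_fun D f ->
  (forall x, D x -> `|f x| <= g x) -> Rintegrable D g -> Rintegrable D f.
Proof.
move=> mD mf fg; apply: le_integrable => //; first exact/measurable_EFinP.
by move=> x Dx /=; rewrite lee_fin (le_trans (fg x Dx))// ler_norm.
Qed.

Lemma RintegrableD D f g : measurable D -> Rintegrable D f -> Rintegrable D g ->
  Rintegrable D (fun x => f x + g x).
Proof. by move=> mD; exact: integrableD. Qed.

Lemma RintegrableZ D f k : measurable D -> Rintegrable D f -> Rintegrable D (fun x => k * f x).
Proof. by move=> mD; exact: integrableZl. Qed.

Lemma RintegrableB D f g : measurable D -> Rintegrable D f -> Rintegrable D g ->
  Rintegrable D (fun x => f x - g x).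
Proof.
move=> mD fi gi; have := RintegrableD mD fi (RintegrableZ (-1) mD gi).
by apply: eq_integrable => // x _ /=; rewrite mulN1r.
Qed.

Lemma Rintegrable_norm D f : measurable D -> Rintegrable D f -> Rintegrable D (fun x => `|f x|).
Proof. by move=> mD; exact: integrable_norm. Qed.

Lemma Rintegrable_cst a b k : Rintegrable `[a, b] (fun=> k).
Proof.
apply/integrableP; split; first exact/measurable_EFinP.
rewrite integral_cst//= lebesgue_measure_itv/=.
by case: ifPn => _; rewrite ?mule0 ?ltry// -EFinD -EFinM ltry.
Qed.

Lemma Rintegrable_bounded a b f k : measurable_fun `[a, b] f ->
  (forall x, x \in `[a, b] -> `|f x| <= k) -> Rintegrable `[a, b] f.
Proof. by move=> mf fk; apply: (Rintegrable_le _ mf _ (Rintegrable_cst a b k)). Qed.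

Lemma RintegrableS D D' f : measurable D -> measurable D' -> D' `<=` D ->
  Rintegrable D f -> Rintegrable D' f.
Proof. by move=> mD mD' sub; exact: integrableS. Qed.

Lemma Rintegrable_eq D f g : measurable D -> (forall x, D x -> f x = g x) -> Rintegrable D f -> Rintegrable D g.
Proof.
by move=> mD fg; apply: eq_integrable => // x /[!inE] Dx /=; rewrite fg.
Qed.

Lemma measurable_norm_powR D p f : measurable_fun D f ->
  measurable_fun D (fun t => `|f t| `^ p).
Proof.
move=> mf; apply: (measurableT_comp (measurable_powR p)).
exact: measurableT_comp.
Qed.

Lemma Rintegrable_powR_lin D p k f g : measurable D -> 0 <= p ->
  measurable_fun D f -> measurable_fun D g ->
  Rintegrable D (fun t => `|f t| `^ p) -> Rintegrable D (fun t => `|g t| `^ p) ->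
  Rintegrable D (fun t => `|k * f t + g t| `^ p).
Proof.
move=> mD p0 mf mg fi gi.
apply: (@Rintegrable_le _ _ (fun t => 2 `^ p * (`|k| `^ p * `|f t| `^ p + `|g t| `^ p))) => //.
- by apply: measurable_norm_powR; apply: measurable_funD => //; exact: measurable_funM.
- move=> x Dx; rewrite ger0_norm ?powR_ge0// (le_trans (powR_normD _ _ p0))//.
  by rewrite normrM powRM.
- by apply: RintegrableZ => //; apply: RintegrableD => //; exact: RintegrableZ.
Qed.

Lemma Rintegrable_powR_normed a b p f : 1 < p -> measurable_fun `[a, b] f ->
  Rintegrable `[a, b] (fun t => `|f t| `^ p) -> Rintegrable `[a, b] f.
Proof.
move=> p1 mf fi; apply: (@Rintegrable_le _ _ (fun t => 1 + `|f t| `^ p)) => //.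
- move=> x _; have [x1|x1] := leP `|f x| 1.
    by rewrite (le_trans x1)// lerDl powR_ge0.
  by rewrite ler_wpDl// le1r_powR// ltW.
- by apply: RintegrableD => //; exact: Rintegrable_cst.
Qed.

End RealIntegrability.

Section RealHoelder.
Context {R : realType}.
Notation mu := (@lebesgue_measure R).
Implicit Types (D : set R) (f g : R -> R) (p q : R).

Lemma Lnorm_patch D f p : 0 < p ->
  (\int[mu]_(x in D) (`|f x| `^ p)%:E)%E \is a fin_num ->
  'N[mu]_(p%:E)[EFin \o (f \_ D)]%E = ((\int[mu]_(x in D) (`|f x| `^ p)) `^ p^-1)%:E.
Proof.
move=> p0 fin; rewrite Lnorm.unlock /Rintegral.
have -> : (\int[mu]_x (`|(EFin \o (f \_ D)) x| `^ p) = \int[mu]_(x in D) (`|f x| `^ p)%:E)%E.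
  rewrite [RHS]integral_mkcond; apply: eq_integral => x _ /=.
  rewrite !patchE; case: ifPn => _ //=.
  by rewrite normr0 powR0// gt_eqF.
by rewrite -[X in poweR X _]fineK// poweR_EFin.
Qed.

Lemma Rhoelder D p q f g : measurable D -> 0 < p -> 0 < q -> p^-1 + q^-1 = 1 ->
  measurable_fun D f -> measurable_fun D g ->
  Rintegrable D (fun x => `|f x| `^ p) -> Rintegrable D (fun x => `|g x| `^ q) ->
  Rintegrable D (fun x => f x * g x) /\
  \int[mu]_(x in D) `|f x * g x| <=
    (\int[mu]_(x in D) (`|f x| `^ p)) `^ p^-1 *
    (\int[mu]_(x in D) (`|g x| `^ q)) `^ q^-1.
Proof.
move=> mD p0 q0 pq mf mg ifp igq.
have mf' : measurable_fun setT (f \_ D) by apply/(measurable_restrictT _ _).1.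
have mg' : measurable_fun setT (g \_ D) by apply/(measurable_restrictT _ _).1.
have := hoelder mu mf' mg' p0 q0 pq.
rewrite !Lnorm_patch//; last 2 first.
- exact: integrable_fin_num.
- exact: integrable_fin_num.
rewrite Lnorm1 => H.
have E : (\int[mu]_x `|(EFin \o ((f \_ D) \* (g \_ D))%R) x|)%E =
    (\int[mu]_(x in D) (`|f x * g x|)%:E)%E.
  rewrite [RHS]integral_mkcond; apply: eq_integral => x _ /=.
  by rewrite !patchE; case: ifPn => _ //=; rewrite mul0r normr0.
have mfg : measurable_fun D (fun x => f x * g x) by exact: measurable_funM.
have ifg : mu.-integrable D (fun x => (f x * g x)%:E).
  apply/integrableP; split; first exact/measurable_EFinP.
  by rewrite -E; apply: le_lt_trans H _; rewrite ltry.
split => //; move: H; rewrite E -EFinM.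
rewrite -[X in (X <= _)%E]fineK ?lee_fin//.
rewrite fin_numElt (lt_le_trans (ltNyr 0)) ?integral_ge0//=.
by move/integrableP : ifg => -[].
Qed.

End RealHoelder.

Section PatchedIntegrals.
Context {R : realType}.
Notation mu := (@lebesgue_measure R).
Implicit Types (D : set R) (f : R -> R).

Lemma Rintegrable_patch D f : measurable D -> Rintegrable D f -> Rintegrable setT (f \_ D).
Proof.
by move=> mD fi; have := (integrable_mkcond (mu := mu) (EFin \o f) mD).1 fi; rewrite restrict_EFin.
Qed.

Lemma le_Rintegral_subset D D' f : measurable D -> measurable D' -> D `<=` D' ->
  (forall x, D' x -> 0 <= f x) -> Rintegrable D' f ->
  \int[mu]_(x in D) f x <= \int[mu]_(x in D') f x.
Proof.
move=> mD mD' sD f0 fi; rewrite [leLHS]Rintegral_mkcond [leRHS]Rintegral_mkcond.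
apply: le_Rintegral => //.
- by apply: Rintegrable_patch => //; exact: RintegrableS fi.
- exact: Rintegrable_patch.
move=> x _; rewrite !patchE; case: ifPn => [|_]; last by case: ifPn => // /[!inE] /f0.
by rewrite inE => /sD H; rewrite mem_set.
Qed.

End PatchedIntegrals.
Section NormIntegral.
Context {R : realType}.
Notation mu := (@lebesgue_measure R).
Implicit Types (D : set R) (f : R -> R).

Lemma le_normr_Rintegrable D f : measurable D -> Rintegrable D f ->
  `|\int[mu]_(x in D) f x| <= \int[mu]_(x in D) `|f x|.
Proof. by move=> mD fi; apply: le_normr_Rintegral. Qed.

Lemma Rintegral_cst_itv (T M : R) : 0 <= T -> \int[mu]_(t in `[0, T]) M = M * T.
Proof.
move=> T0; rewrite Rintegral_cst//= lebesgue_measure_itv/= lte_fin.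
case: ifPn; first by rewrite -EFinB subr0.
by rewrite -leNgt => T0'; have -> : T = 0 by apply/eqP; rewrite eq_le T0 T0'.
Qed.

Lemma Rintegral_itv_bound (T M : R) g : 0 <= T -> Rintegrable `[0, T] g ->
  (forall t, t \in `[0, T] -> `|g t| <= M) -> `|\int[mu]_(t in `[0, T]) g t| <= M * T.
Proof.
move=> T0 ig gM; have mD := measurable_itv `[0, T] : measurable `[0, T]%classic.
apply: le_trans (le_normr_Rintegrable mD ig) _; rewrite -(Rintegral_cst_itv M T0).
by apply: le_Rintegral => //; [exact: Rintegrable_norm|exact: Rintegrable_cst].
Qed.

End NormIntegral.

(** * The space L^p on an interval *)

Section LpOnInterval.
Context {R : realType}.
Notation mu := (@lebesgue_measure R).
Variables (T : R).
Implicit Types (p q k M : R) (u v w : R -> R).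

(** The mass of u: the p-th power of its L^p norm on [0, T]. *)
Definition pmass p u : R := \int[mu]_(t in `[0, T]) (`|u t| `^ p).

Definition aeq u w : Prop := {ae mu, forall t, t \in `[0, T] -> u t = w t}.

(** Borel representatives of the p-integrable classes on [0, T], extended by 0
    so that convolutions may be written as integrals over the line. *)
Definition LpT p w : Prop :=
  [/\ measurable_fun setT w, forall t, t \notin `[0, T] -> w t = 0 &
      Rintegrable `[0, T] (fun t => `|w t| `^ p)].

Lemma aeq_refl u : aeq u u. Proof. exact: ae_everywhere. Qed.

Lemma aeq_sym u w : aeq u w -> aeq w u.
Proof. by apply: ae_impl => t h /h. Qed.

Lemma aeq_trans u v w : aeq u v -> aeq v w -> aeq u w.
Proof. by apply: ae_impl2 => t h1 h2 tT; rewrite h1// h2. Qed.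

Lemma aeq_on u w : {in `[0, T], u =1 w} -> aeq u w.
Proof. by move=> h; apply: ae_everywhere => t /h. Qed.

Lemma aeq_comp2 (op : R -> R -> R) u v u' v' : aeq u u' -> aeq v v' ->
  aeq (fun t => op (u t) (v t)) (fun t => op (u' t) (v' t)).
Proof. by apply: ae_impl2 => t h1 h2 tT; rewrite h1// h2. Qed.

Lemma aeq_Rintegral u w : aeq u w ->
  \int[mu]_(t in `[0, T]) u t = \int[mu]_(t in `[0, T]) w t.
Proof. by move=> uw; apply: ae_Rintegral; apply: ae_impl uw. Qed.

Lemma pmass_ae p u w : aeq u w -> pmass p u = pmass p w.
Proof. by move=> uw; apply: ae_Rintegral; apply: ae_impl uw => t h /h ->. Qed.

Lemma pmass_ge0 p u : 0 <= pmass p u.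
Proof. by apply: Rintegral_ge0 => t _; exact: powR_ge0. Qed.

Lemma LpT_measurable p w (D : set R) : LpT p w -> measurable_fun D w.
Proof. by move=> [mw _ _]; exact: measurable_funTS. Qed.

Lemma LpT_lin p k v w : 0 <= p -> LpT p v -> LpT p w ->
  LpT p (fun t => k * v t + w t).
Proof.
move=> p0 [mv v0 iv] [mw w0 iw]; split.
- by apply: measurable_funD => //; apply: measurable_funM.
- by move=> t tT; rewrite v0// w0// mulr0 addr0.
- by apply: Rintegrable_powR_lin => //; exact: measurable_funTS.
Qed.

Lemma LpT_bounded p w M : measurable_fun setT w ->
  (forall t, t \notin `[0, T] -> w t = 0) ->
  (forall t, t \in `[0, T] -> `|w t| <= M) -> 0 <= p -> LpT p w.
Proof.
move=> mw w0 wM p0; split => //.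
apply: (@Rintegrable_bounded _ _ _ _ (M `^ p)).
- by apply: measurable_norm_powR; exact: measurable_funTS.
- move=> t tT /=; rewrite ger0_norm ?powR_ge0//.
  have wM' := wM t tT.
  by apply: ge0_ler_powR; rewrite ?nnegrE// (le_trans _ wM').
Qed.

Lemma LpT0 p : 0 <= p -> LpT p (fun=> 0).
Proof. by move=> p0; apply: (@LpT_bounded _ _ 0) => // t _; rewrite normr0. Qed.

Lemma LpT_Rintegrable p w : 1 < p -> LpT p w -> Rintegrable `[0, T] w.
Proof.
move=> p1 [mw _ iw]; apply: (Rintegrable_powR_normed p1) => //; exact: measurable_funTS.
Qed.

Lemma LpTB p v w : 0 <= p -> LpT p v -> LpT p w -> LpT p (v \- w).
Proof.
move=> p0 hv hw; have := LpT_lin (-1) p0 hw hv.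
by congr LpT; apply/funext => t /=; ring.
Qed.

Lemma LpTD p v w : 0 <= p -> LpT p v -> LpT p w -> LpT p (v \+ w).
Proof.
move=> p0 hv hw; have := LpT_lin 1 p0 hv hw.
by congr LpT; apply/funext => t /=; ring.
Qed.

Lemma LpTZ p k v : 0 <= p -> LpT p v -> LpT p (fun t => k * v t).
Proof.
move=> p0 hv; have := LpT_lin k p0 hv (LpT0 p0).
by congr LpT; apply/funext => t /=; ring.
Qed.

Lemma pmassZ p k w : LpT p w -> pmass p (fun t => k * w t) = `|k| `^ p * pmass p w.
Proof.
move=> [_ _ iw]; rewrite /pmass -RintegralZl//.
by apply: eq_Rintegral => t _; rewrite normrM powRM.
Qed.

Lemma pmassBC p v w : pmass p (v \- w) = pmass p (w \- v).
Proof. by apply: eq_Rintegral => t _ /=; rewrite distrC. Qed.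

Lemma pmassD p v w : 0 <= p -> LpT p v -> LpT p w ->
  pmass p (v \+ w) <= 2 `^ p * (pmass p v + pmass p w).
Proof.
move=> p0 hv hw; have [_ _ ivw] := LpTD p0 hv hw.
case: hv hw => [mv v0 iv] [mw w0 iw].
rewrite /pmass -RintegralD// -RintegralZl//; last exact: RintegrableD.
apply: le_Rintegral => //; first by apply: RintegrableZ => //; exact: RintegrableD.
by move=> t _ /=; exact: powR_normD.
Qed.

Lemma pmass_bounded p v M : 0 <= T -> 0 <= p -> Rintegrable `[0, T] (fun t => `|v t| `^ p) ->
  (forall t, t \in `[0, T] -> `|v t| <= M) -> pmass p v <= M `^ p * T.
Proof.
move=> T0 p0 iv vM.
rewrite -Rintegral_cst_itv//; apply: le_Rintegral => //; first exact: Rintegrable_cst.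
move=> t tT; have h := vM t tT.
by apply: ge0_ler_powR; rewrite ?nnegrE// (le_trans _ h).
Qed.

Lemma inLpP p u : 1 <= p -> inLp T p u <-> exists2 w, LpT p w & aeq u w.
Proof.
move=> p1; have p0 : 0 < p by exact: lt_le_trans p1.
split=> [[w hw uw]|[w [mw w0 iw] uw]].
  exists (w \_ `[0, T]); last first.
    apply: ae_impl uw => t h tT; rewrite h// patchE mem_set//.
  have mw : measurable_fun setT w.
    by move: hw; rewrite inE => /andP[/[!inE]].
  split.
  - by apply/(measurable_restrictT _ _).1 => //; exact: measurable_funTS.
  - by move=> t /negP tT; rewrite patchE memNset.
  - have iw := Lfun_integrable p1 hw.
    apply: (@Rintegrable_eq _ _ (fun t => `|w t| `^ p)) => //.
      by move=> t tT; rewrite patchE mem_set.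
    by apply: (@RintegrableS _ setT).
exists w => //; rewrite inE; apply/andP; split; first by rewrite inE.
rewrite inE/= /finite_norm.
have -> : w = w \_ `[0, T].
  apply/funext => t; rewrite patchE; case: ifPn => // /negP tT; apply: w0.
  by apply/negP => H; apply: tT; rewrite inE.
rewrite Lnorm_patch ?ltry//; exact: integrable_fin_num.
Qed.

Lemma LpT_inLp p u w : 1 <= p -> LpT p w -> aeq u w -> inLp T p u.
Proof. by move=> p1 hw uw; apply/inLpP => //; exists w. Qed.

Lemma LpnormE_pmass p u w : 0 < p -> LpT p w -> aeq u w ->
  LpnormE T p u = ((pmass p w) `^ p^-1)%:E.
Proof.
move=> p0 [mw w0 iw] uw.
have E : (\int[mu]_(x in `[0%R, T]) (`|u x| `^ p)%:E =
    \int[mu]_(x in `[0%R, T]) (`|w x| `^ p)%:E)%E.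
  by apply: ae_integral; apply: ae_impl uw => t h /h ->.
have fin : (\int[mu]_(x in `[0%R, T]) (`|u x| `^ p)%:E)%E \is a fin_num.
  rewrite E; exact: integrable_fin_num.
by rewrite -(pmass_ae _ uw) -(Lnorm_patch p0 fin).
Qed.

Lemma graph_norm_pmass p u v w z : 0 < p -> LpT p w -> aeq u w ->
  LpT p z -> aeq v z ->
  graph_norm T p u v = ((pmass p w + pmass p z) `^ p^-1)%:E.
Proof.
move=> p0 hw uw hz vz; have pE y : 0 <= y -> ((y `^ p^-1)%:E `^ p = y%:E)%E.
  by move=> y0; rewrite poweR_EFin -powRrM mulVf ?gt_eqF// powRr1.
rewrite /graph_norm (LpnormE_pmass p0 hw uw) (LpnormE_pmass p0 hz vz).
have E : ((pmass p w `^ p^-1)%:E `^ p + (pmass p z `^ p^-1)%:E `^ p =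
    (pmass p w + pmass p z)%:E)%E.
  rewrite EFinD; exact: (f_equal2 _ (pE _ (pmass_ge0 _ _)) (pE _ (pmass_ge0 _ _))).
by rewrite E poweR_EFin.
Qed.

End LpOnInterval.

Section LpCompleteness.
Context {R : realType}.
Notation mu := (@lebesgue_measure R).
Variables (T p : R).
Hypotheses (T0 : 0 < T) (p1 : 1 < p).
Implicit Types (u v w : R -> R).

Let p0 : 0 < p. Proof. exact: lt_trans p1. Qed.

Lemma conjugate_exponent : exists2 q : R, 0 < q & p^-1 + q^-1 = 1.
Proof.
exists (1 - p^-1)^-1; last by rewrite invrK addrC subrK.
by rewrite invr_gt0 subr_gt0 invf_lt1.
Qed.

Lemma L1_le_pmass : exists2 C, 0 < C & forall w, LpT T p w ->
  \int[mu]_(t in `[0, T]) `|w t| <= C * pmass T p w `^ p^-1.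
Proof.
have [q q0 pq] := conjugate_exponent; exists (T `^ q^-1); first exact: powR_gt0.
move=> w [mw w0 iw].
have mwD : measurable_fun `[0, T] w by exact: measurable_funTS.
have i1 : Rintegrable `[0, T] (fun=> `|1 : R| `^ q) by exact: Rintegrable_cst.
have [||_] := @Rhoelder R `[0, T]%classic p q w (fun=> 1) _ p0 q0 pq mwD _ iw i1.
- exact: measurable_itv.
- exact: measurable_cst.
have -> : \int[mu]_(x in `[0, T]) (`|1 : R| `^ q) = T.
  by rewrite (Rintegral_cst_itv _ (ltW T0)) normr1 powR1 mul1r.
under eq_Rintegral do rewrite mulr1.
by rewrite mulrC.
Qed.

Lemma limn_einf_le_near (u : (\bar R)^nat) (e : \bar R) :
  (\forall n \near \oo, (u n <= e)%E) -> (limn_einf u <= e)%E.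
Proof.
move=> [N _ H]; rewrite limn_einf_lim; apply: lime_le; first exact: is_cvg_einfs.
near=> n; apply: (@le_trans _ _ (u (maxn n N))).
  by apply: ereal_inf_lbound; exists (maxn n N) => //=; rewrite leq_maxl.
by apply: H => /=; rewrite leq_maxr.
Unshelve. all: by end_near. Qed.

(** The sum of the increments has a finite integral, hence is finite almost
    everywhere, and absolutely convergent series converge. *)
Lemma ae_cvg_of_summable (v : (R -> R)^nat) :
  (forall n, LpT T p (v n)) ->
  (forall k, \int[mu]_(t in `[0, T]) `|v k.+1 t - v k t| <= 1 / (2 ^ (k + 1))%:R) ->
  {ae mu, forall t, t \in `[0, T] -> cvgn (fun n => v n t)}.
Proof.
move=> hv hd.
pose g k t : \bar R := (`|v k.+1 t - v k t|)%:E.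
have ig k : Rintegrable `[0, T] (fun t => `|v k.+1 t - v k t|).
  apply: Rintegrable_norm => //; apply: (LpT_Rintegrable p1); exact: LpTB (ltW p0) (hv _) (hv _).
have mg k : measurable_fun `[0, T] (g k).
  by apply/measurable_EFinP; exact: Rintegrable_measurable (ig k).
have g0 k t : `[0, T]%classic t -> (0 <= g k t)%E by rewrite lee_fin.
have sumfin : (\int[mu]_(t in `[0%R, T]) (\sum_(0 <= k <oo) g k t) <= 1)%E.
  rewrite integral_nneseries//.
  have := @cvg_geometric_eseries_half R 1 0; rewrite expr0 divr1 => /cvg_lim <- //.
  apply: lee_nneseries => [k _ _|k _]; first by apply: integral_ge0 => t; exact: g0.
  have := hd k; rewrite -lee_fin /Rintegral fineK//.
  exact: (integrable_fin_num _ (ig k)).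
have ifin : mu.-integrable `[0, T] (fun t => \sum_(0 <= k <oo) g k t)%E.
  apply/integrableP; split.
    apply: (ge0_emeasurable_sum (P := xpredT)) => [k t tT _|k _]; [exact: g0|exact: mg].
  apply: (@le_lt_trans _ _ 1%E); last exact: ltry.
  apply: le_trans sumfin; rewrite le_eqVlt; apply/orP; left; apply/eqP.
  apply: eq_integral => t /[!inE] tT; rewrite gee0_abs//.
  by apply: nneseries_ge0 => k _ _; exact: g0.
have := @integrable_ae _ _ _ mu _ (measurable_itv _) _ ifin.
apply: ae_impl => t ht tT; have {ht} := ht tT.
set S := (\sum_(0 <= k <oo) g k t)%E => Sfin.
have : cvgn [normed series (fun k => v k.+1 t - v k t)].
  apply: nondecreasing_is_cvgn.
    by apply: nondecreasing_series => n _ _ /=.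
  exists (fine S) => _ [n _ <-]; rewrite -lee_fin fineK//.
  have -> : ([normed series (fun k => v k.+1 t - v k t)] n)%:E = (\sum_(0 <= k < n) g k t)%E.
    by rewrite /series/= sumEFin.
  by apply: nneseries_lim_ge => k _ _; exact: g0.
move/normed_cvg => cs.
have -> : (fun n => v n t) = (fun n => v 0%N t + series (fun k => v k.+1 t - v k t) n).
  apply/funext => n; have := eq_sum_telescope (fun n => v n t) n.
  by rewrite /telescope.
by apply: is_cvgD => //; exact: is_cvg_cst.
Qed.

(** Riesz-Fischer: a subsequence with L^1-summable increments converges almost
    everywhere, and Fatou's lemma passes the Cauchy bound on to the limit. *)
Lemma LpT_complete (w : (R -> R)^nat) : (forall n, LpT T p (w n)) ->
  (forall e, 0 < e -> exists N, forall m n, (N <= m)%N -> (N <= n)%N ->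
    pmass T p (w m \- w n) < e) ->
  exists2 l, LpT T p l & forall e, 0 < e -> exists N, forall n, (N <= n)%N ->
    pmass T p (w n \- l) <= e.
Proof.
move=> hw cauchy; have [C C0 HC] := L1_le_pmass.
pose d k := ((1 / (2 ^ (k + 1))%:R) / C) `^ p.
have pw2 k : 0 < 1 / (2 ^ (k + 1))%:R :> R.
  by rewrite divr_gt0// ltr0n expn_gt0.
have d0 k : 0 < d k by rewrite powR_gt0// divr_gt0.
have /choice[N HN] : forall k, exists N, forall m n, (N <= m)%N -> (N <= n)%N ->
    pmass T p (w m \- w n) < d k.
  by move=> k; exact: cauchy.
(* Partial sums of N i + 1: nondecreasing, and at least both N k and k. *)
pose n_ k := (\sum_(i < k.+1) (N i + 1))%N.
have nN k : (N k <= n_ k)%N by rewrite /n_ big_ord_recr/= addn1 addnS (leq_trans _ (leqnSn _))// leq_addl.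
have nS k : (n_ k <= n_ k.+1)%N by rewrite [leqRHS]/n_ big_ord_recr/= leq_addr.
have nk k : (k <= n_ k)%N.
  by elim: k => // k IH; rewrite {1}/n_ big_ord_recr/= -/(n_ k) addn1 addnS ltnS (leq_trans IH)// leq_addr.
pose v k := w (n_ k).
have hv k : LpT T p (v k) by exact: hw.
have aecvg : {ae mu, forall t, t \in `[0, T] -> cvgn (fun n => v n t)}.
  apply: ae_cvg_of_summable => // k.
  have := HC _ (LpTB (ltW p0) (hv k.+1) (hv k)) => /le_trans; apply.
  rewrite mulrC -ler_pdivlMr//.
  have -> : 1 / (2 ^ (k + 1))%:R / C = d k `^ p^-1.
    by rewrite /d -powRrM mulfV ?gt_eqF// powRr1// divr_ge0// ltW.
  apply: ge0_ler_powR; rewrite ?nnegrE ?pmass_ge0 ?invr_ge0 ?(ltW p0) ?(ltW (d0 k))//.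
  by apply/ltW/HN; rewrite ?nN// (leq_trans (nN k)).
(* The upper limit is Borel, and it is the limit wherever there is one. *)
pose l t := fine (limn_esup (fun k => (v k t)%:E)).
have ml : measurable_fun setT l.
  apply: (@measurableT_comp _ _ _ _ _ _ (fine : \bar R -> R) _ (fun t => limn_esup (fun k => (v k t)%:E))) => //.
  apply: measurable_fun_limn_esup => n; apply/measurable_EFinP.
  by case: (hv n).
have lv t : cvgn (fun n => v n t) -> v n t @[n --> \oo] --> l t.
  move=> cv; have h : (v n t)%:E @[n --> \oo] --> (limn (fun n => v n t))%:E.
    by apply: cvg_EFin; [exact: nearW|exact: cv].
  by rewrite /l (cvg_limn_einf_sup h).2.
have l0 t : t \notin `[0, T] -> l t = 0.
  move=> tT; rewrite /l (_ : (fun k => _) = fun=> 0%E); last first.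
    by apply/funext => k; case: (hv k) => _ ->.
  by rewrite (cvg_limn_einf_sup (cvg_cst _)).2.
have fat u e : LpT T p u -> (\forall k \near \oo, pmass T p (u \- v k) <= e) ->
    (\int[mu]_(t in `[0%R, T]) ((`|u t - l t| `^ p)%:E) <= e%:E)%E.
  move=> hu he.
  have mf k : measurable_fun `[0, T] (fun t => (`|u t - v k t| `^ p)%:E).
    apply/measurable_EFinP; apply: measurable_norm_powR.
    by apply: measurable_funB; apply: LpT_measurable; [exact: hu|exact: hv].
  have f0 k t : `[0, T]%classic t -> (0 <= (`|u t - v k t| `^ p)%:E)%E.
    by rewrite lee_fin powR_ge0.
  apply: (@le_trans _ _ (limn_einf (fun k => \int[mu]_(t in `[0%R, T]) ((`|u t - v k t| `^ p)%:E))%E)).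
    apply: le_trans (fatou mu (measurable_itv `[0, T]) mf f0).
    rewrite le_eqVlt; apply/orP; left; apply/eqP.
    apply: ae_integral; apply: ae_impl aecvg => t h tT.
    have {}h := lv _ (h tT); symmetry.
    have hc : (`|u t - v k t| `^ p)%:E @[k --> \oo] --> (`|u t - l t| `^ p)%:E.
      apply: cvg_EFin; first exact: nearW.
      apply: (@cvg_comp _ _ _ (fun k => u t - v k t) (fun x : R => `|x| `^ p)); last first.
        exact: continuous_norm_powR.
      by apply: cvgB => //; exact: cvg_cst.
    by rewrite (cvg_limn_einf_sup hc).1.
  apply: limn_einf_le_near; apply: filterS he => k.
  rewrite -lee_fin /pmass /Rintegral fineK//.
  by case: (LpTB (ltW p0) hu (hv k)) => _ _ /(@integrable_fin_num _ _ _ mu _ (measurable_itv _)).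
have near_v e : 0 < e -> exists N, forall n, (N <= n)%N ->
    \forall k \near \oo, pmass T p (w n \- v k) <= e.
  move=> e0; have [M HM] := cauchy e e0; exists M => n Mn.
  exists M => // k /= Mk; apply/ltW/HM => //; exact: leq_trans (nk k).
have integ u e : LpT T p u -> (\forall k \near \oo, pmass T p (u \- v k) <= e) ->
    LpT T p (u \- l).
  move=> hu he; split.
  - by apply: measurable_funB => //; case: hu.
  - by move=> t tT /=; rewrite l0// subr0; case: hu => _ ->.
  - apply/integrableP; split.
      apply/measurable_EFinP; apply: measurable_norm_powR.
      apply: measurable_funB; first exact: LpT_measurable hu.
      exact: measurable_funTS.
    apply: (@le_lt_trans _ _ e%:E); last exact: ltry.
    apply: le_trans (fat _ _ hu he); rewrite le_eqVlt; apply/orP; left; apply/eqP.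
    by apply: eq_integral => t _ /=; rewrite ger0_norm// powR_ge0.
have hl : LpT T p l.
  have [M HM] := near_v 1 ltr01.
  have := LpTB (ltW p0) (hw M) (integ _ _ (hw M) (HM M (leqnn _))).
  by congr LpT; apply/funext => t /=; ring.
exists l => // e e0; have [M HM] := near_v e e0; exists M => n Mn.
have he := HM n Mn; have := fat _ _ (hw n) he.
rewrite -lee_fin /pmass /Rintegral fineK//.
by case: (integ _ _ (hw n) he) => _ _ /(@integrable_fin_num _ _ _ mu _ (measurable_itv _)).
Qed.

End LpCompleteness.

Section MassConvexity.
Context {R : realType}.
Notation mu := (@lebesgue_measure R).
Variables (T p : R).
Hypothesis p1 : 1 < p.
Implicit Types (v w : R -> R).

Let p0 : 0 <= p. Proof. by apply: ltW; exact: lt_trans p1. Qed.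

Lemma le_Rintegral_lin (D : set R) (k l : R) (f g h : R -> R) : measurable D ->
  Rintegrable D f -> Rintegrable D g -> Rintegrable D h ->
  (forall t, D t -> f t <= k * g t + l * h t) ->
  \int[mu]_(t in D) f t <= k * \int[mu]_(t in D) g t + l * \int[mu]_(t in D) h t.
Proof.
move=> mD fi gi hi fgh; rewrite -(@RintegralZl _ _ _ mu _ _ k mD gi) -(@RintegralZl _ _ _ mu _ _ l mD hi).
have kg := RintegrableZ k mD gi; have lh := RintegrableZ l mD hi.
by rewrite -RintegralD//; apply: le_Rintegral => //; exact: RintegrableD.
Qed.

Lemma pmass_uniform_convex eps : 0 < eps -> exists2 C, 0 < C & forall v w,
  LpT T p v -> LpT T p w -> pmass T p (v \- w) <= eps * (pmass T p v + pmass T p w) +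
    C * ((pmass T p v + pmass T p w) / 2 - pmass T p (fun t => (v t + w t) / 2)).
Proof.
move=> e0; have [C C0 HC] := powR_uniform_convex p1 e0; exists C => // v w hv hw.
have [_ _ iv] := hv; have [_ _ iw] := hw.
have [_ _ ib] := LpTB p0 hv hw.
have [_ _ im] : LpT T p (fun t => (v t + w t) / 2).
  by have := LpTZ 2^-1 p0 (LpTD p0 hv hw); congr LpT; apply/funext => t /=; rewrite mulrC.
have iD := RintegrableD (measurable_itv _) iv iw.
have := @le_Rintegral_lin _ (eps + C / 2) (- C) _ _ _ (measurable_itv _) ib iD im.
rewrite RintegralD// -!/(pmass _ _ _) => H.
have E (a b c : R) : (eps + C / 2) * (a + b) + - C * c = eps * (a + b) + C * ((a + b) / 2 - c) by ring.
rewrite -E; apply: H.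
move=> t _; apply: le_trans (HC (v t) (w t)) _.
by rewrite E.
Qed.

End MassConvexity.

Section PmassDerivative.
Context {R : realType}.
Notation mu := (@lebesgue_measure R).
Variables (T p : R).
Hypothesis p1 : 1 < p.
Implicit Types (v w h : R -> R).

Let p0 : 0 < p. Proof. exact: lt_trans p1. Qed.

Lemma measurable_phi_p w (D : set R) : measurable_fun D w ->
  measurable_fun D (fun t => phi_p p (w t)).
Proof.
by move=> mw; apply: measurable_funM => //; exact: (measurable_norm_powR (p - 2) mw).
Qed.

(** Hoelder's inequality for the weight |w|^(p-1), which is in L^q for the
    conjugate exponent q because (p - 1) q = p. *)
Lemma powR_weight w : LpT T p w -> exists2 K, 0 <= K & forall h, LpT T p h ->
  Rintegrable `[0, T] (fun t => `|w t| `^ (p - 1) * `|h t|) /\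
  \int[mu]_(t in `[0, T]) (`|w t| `^ (p - 1) * `|h t|) <= K * pmass T p h `^ p^-1.
Proof.
move=> [mw w0 iw]; have [q q0 pq] := conjugate_exponent p1.
have pq1 : (p - 1) * q = p.
  have qE : q^-1 = (p - 1) / p.
    by move: pq => /(congr1 (fun x => x - p^-1)); rewrite addrAC subrr add0r => ->; field; rewrite gt_eqF.
  by rewrite -[q]invrK qE invf_div mulrCA divff ?mulr1// gt_eqF// subr_gt0.
pose k t := `|w t| `^ (p - 1).
have kE t : `|k t| `^ q = `|w t| `^ p by rewrite /k ger0_norm ?powR_ge0// -powRrM pq1.
exists ((\int[mu]_(t in `[0, T]) (`|k t| `^ q)) `^ q^-1) => [|h [mh h0 ih]].
  exact: powR_ge0.
have mk : measurable_fun `[0, T] k by apply: measurable_norm_powR; exact: measurable_funTS.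
have mhT : measurable_fun `[0, T] (fun t => `|h t|).
  by apply: measurableT_comp => //; exact: measurable_funTS.
have ik : Rintegrable `[0, T] (fun t => `|k t| `^ q).
  by apply: (Rintegrable_eq _ _ iw) => // t _; rewrite kE.
have ih' : Rintegrable `[0, T] (fun t => `| `|h t| | `^ p).
  by apply: (Rintegrable_eq _ _ ih) => // t _; rewrite normr_id.
have qp : q^-1 + p^-1 = 1 by rewrite addrC.
have [i1 H] := @Rhoelder R `[0, T]%classic q p k (fun t => `|h t|) (measurable_itv _) q0 p0 qp mk mhT ik ih'.
split; first exact: i1.
have E : \int[mu]_(x in `[0, T]) (`| `|h x| | `^ p) = pmass T p h.
  by apply: eq_Rintegral => t _; rewrite normr_id.
rewrite E in H; apply: le_trans H; apply: le_Rintegral.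
- exact: measurable_itv.
- exact: i1.
- exact: (Rintegrable_norm (measurable_itv _) i1).
by move=> t _; exact: ler_norm.
Qed.

Lemma phi_p_integral w : LpT T p w -> exists2 K, 0 <= K & forall h, LpT T p h ->
  Rintegrable `[0, T] (fun t => phi_p p (w t) * h t) /\
  `|\int[mu]_(t in `[0, T]) (phi_p p (w t) * h t)| <= K * pmass T p h `^ p^-1.
Proof.
move=> hw; have [K K0 HK] := powR_weight hw; exists K => // h hh.
have [i1 H] := HK h hh.
have i2 : Rintegrable `[0, T] (fun t => phi_p p (w t) * h t).
  apply: (Rintegrable_le _ _ _ i1) => //.
    apply: measurable_funM; last exact: LpT_measurable hh.
    by apply: measurable_phi_p; exact: LpT_measurable hw.
  by move=> t _; rewrite normrM norm_phi_p.
split => //; apply: le_trans (le_normr_Rintegrable (measurable_itv _) i2) _.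
apply: le_trans H; apply: le_Rintegral => //; first exact: (Rintegrable_norm _ i2).
by move=> t _; rewrite normrM norm_phi_p.
Qed.

Lemma pmass_norm h : pmass T p h = (pmass T p h `^ p^-1) `^ p.
Proof. by rewrite -powRrM mulVf ?gt_eqF// powRr1// pmass_ge0. Qed.

(** In the integral of the pointwise remainder, the linear part has a small
    factor and is bounded by powR_weight; the other part is of order p > 1 in
    the norm of h. *)
Lemma pmass_frechet w eps : LpT T p w -> 0 < eps -> exists2 d, 0 < d & forall h,
  LpT T p h -> pmass T p h `^ p^-1 < d ->
  `|p^-1 * pmass T p (w \+ h) - p^-1 * pmass T p w -
    \int[mu]_(t in `[0, T]) (phi_p p (w t) * h t)| <= eps * pmass T p h `^ p^-1.
Proof.
move=> hw e0; have [K K0 HK] := powR_weight hw.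
have [K' _ HK'] := phi_p_integral hw.
have e1 : 0 < eps / 2 / (K + 1) by rewrite !divr_gt0// ltr_wpDl.
have [C C0 HC] := powR_derivative_estimate p1 e1.
have p10 : 0 < p - 1 by rewrite subr_gt0.
have eC : 0 < eps / 2 / C by rewrite !divr_gt0.
exists ((eps / 2 / C) `^ (p - 1)^-1) => [|h hh hd]; first by rewrite powR_gt0.
have [i1 H1] := HK h hh; have [i2 _] := HK' h hh.
have [_ _ iw] := hw; have [_ _ ih] := hh; have [_ _ iwh] := LpTD (ltW p0) hw hh.
have mD := measurable_itv `[0, T] : measurable `[0, T]%classic.
pose g t := p^-1 * `|w t + h t| `^ p - p^-1 * `|w t| `^ p - phi_p p (w t) * h t.
have iA := RintegrableZ p^-1 mD iwh; have iB := RintegrableZ p^-1 mD iw.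
have ig : Rintegrable `[0, T] g by apply: RintegrableB => //; exact: RintegrableB.
have -> : p^-1 * pmass T p (w \+ h) - p^-1 * pmass T p w -
    \int[mu]_(t in `[0, T]) (phi_p p (w t) * h t) = \int[mu]_(t in `[0, T]) g t.
  rewrite /g RintegralB//; last exact: RintegrableB.
  by rewrite RintegralB// !RintegralZl.
apply: le_trans (le_normr_Rintegrable mD ig) _.
have := @le_Rintegral_lin _ `[0, T]%classic (eps / 2 / (K + 1)) C (fun t => `|g t|) _ _ mD (Rintegrable_norm mD ig) i1 ih.
rewrite -/(pmass T p h) => H.
have {}H := H (fun t _ => _).
apply: (le_trans (H _)).
  move=> t; rewrite /g ![p^-1 * _]mulrC; exact: HC.
set N := pmass T p h `^ p^-1 in H1 hd *.
have N0 : 0 <= N by exact: powR_ge0.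
have hN : pmass T p h <= (eps / 2 / C) * N.
  rewrite pmass_norm -/N; have [->|NN] := eqVneq N 0; first by rewrite mulr0 powR0// gt_eqF.
  have Np : 0 < N by rewrite lt0r NN.
  rewrite -[leLHS](@mulr_powRB1 _ N p) //.
  rewrite mulrC ler_wpM2r//.
  have -> : eps / 2 / C = ((eps / 2 / C) `^ (p - 1)^-1) `^ (p - 1).
    by rewrite -powRrM mulVf ?gt_eqF// powRr1// ltW.
  by apply: ge0_ler_powR; rewrite ?nnegrE ?powR_ge0 ?ltW.
rewrite [leRHS](_ : _ = eps / 2 * N + eps / 2 * N); last by field.
apply: lerD.
  apply: (@le_trans _ _ (eps / 2 / (K + 1) * ((K + 1) * N))).
    by rewrite ler_wpM2l ?(ltW e1)// (le_trans H1)// ler_wpM2r// lerDl.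
  by rewrite mulrA divfK// gt_eqF// ltr_wpDl.
rewrite (le_trans (ler_wpM2l (ltW C0) hN))// mulrA.
by rewrite [X in X * _](_ : _ = eps / 2)//; field; rewrite gt_eqF.
Qed.

(** Differentiability at w, together with the boundedness of the derivative.
    *)
Lemma pmass_continuous w eps : LpT T p w -> 0 < eps -> exists2 d, 0 < d & forall v,
  LpT T p v -> pmass T p (v \- w) < d -> `|pmass T p v - pmass T p w| < eps.
Proof.
move=> hw e0; have [K K0 HK] := phi_p_integral hw.
have [d d0 Hd] := pmass_frechet hw (ltr01 : (0 : R) < 1).
pose c := Num.min d (eps / (p * (K + 1 + 1))).
have M0 : 0 < p * (K + 1 + 1) by rewrite mulr_gt0// !ltr_wpDl// addr_ge0.
have c0 : 0 < c by rewrite lt_min d0 divr_gt0.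
exists (c `^ p) => [|v hv vc]; first by rewrite powR_gt0.
have hh := LpTB (ltW p0) hv hw.
have {vc} : pmass T p (v \- w) `^ p^-1 < c.
  rewrite ltNge; apply/negP => H; move: vc; rewrite ltNge => /negP; apply.
  by rewrite [leRHS]pmass_norm; apply: ge0_ler_powR; rewrite ?nnegrE ?powR_ge0 ?(ltW c0) ?(ltW p0).
have [_ H1] := HK _ hh; have := Hd _ hh.
have -> : w \+ (v \- w) = v by apply/funext => t /=; ring.
move: (pmass T p (v \- w) `^ p^-1) (powR_ge0 (pmass T p (v \- w)) p^-1) H1 => N N0.
move: (\int[mu]_(_ in _) _) (pmass T p v) (pmass T p w) => I a b HI H.
rewrite lt_min => /andP[Nd Nc]; have {}H := H Nd.
have -> : a - b = p * ((p^-1 * a - p^-1 * b - I) + I) by field; rewrite gt_eqF.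
rewrite normrM (ger0_norm (ltW p0)).
apply: (@le_lt_trans _ _ (p * ((K + 1) * N))).
  rewrite ler_wpM2l ?(ltW p0)// (le_trans (ler_normD _ _))// mulrDl addrC lerD//.
apply: (@le_lt_trans _ _ (p * (K + 1 + 1) * N)).
  by rewrite mulrA ler_wpM2r// ler_wpM2l ?(ltW p0)// lerDl.
by rewrite mulrC -ltr_pdivlMr.
Qed.

End PmassDerivative.

(** * Power kernels and their convolutions *)

Section AffineInvariance.
Context {R : realType}.
Notation mu := (@lebesgue_measure R).
Implicit Types (a b x y : R).

Let affine a b (x : measurableTypeR R) : measurableTypeR R := (a : R) * x + b.

Let measurable_affine a b : measurable_fun setT (affine a b).
Proof. by apply: measurable_funD => //; exact: measurable_funM. Qed.

Let push a b : {measure set (measurableTypeR R) -> \bar R} :=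
  measure_function_pushforward__canonical__measure_function_Measure mu (measurable_affine a b).

Let affine_measure a b : {measure set (measurableTypeR R) -> \bar R} :=
  mscale (NngNum (normr_ge0 a)) (push a b).

Let lebesgue_measure_affine a b (A : set (measurableTypeR R)) : a != 0 -> measurable A ->
  mu A = affine_measure a b A.
Proof.
move=> a0 mA.
have na0 : 0 < `|a| by rewrite normr_gt0.
apply: lebesgue_measure_unique => // _ /ocitvP [->|[[x y] /= xy ->]].
  by rewrite !measure0.
rewrite /affine_measure/= /mscale/= /pushforward lebesgue_measure_itv/= lte_fin xy.
have [a0'|a0'] := ltP 0 a.
  have -> : affine a b @^-1` `]x, y] = `](x - b) / a, (y - b) / a]%classic.
    apply/seteqP; split => z; rewrite /= !in_itv/= /affine ltr_pdivrMr// ler_pdivlMr// (mulrC z).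
      by rewrite ltrBlDr lerBrDr.
    by rewrite ltrBlDr lerBrDr.
  rewrite lebesgue_measure_itv/= lte_fin ltr_pM2r ?invr_gt0// ltrD2r xy.
  rewrite -!EFinB -EFinM; congr (_%:E).
  by rewrite gtr0_norm// -mulrBl mulrCA divff ?mulr1//; ring.
have {}a0' : a < 0 by rewrite lt_neqAle a0.
have -> : affine a b @^-1` `]x, y] = `[(y - b) / a, (x - b) / a[%classic.
  apply/seteqP; split => z; rewrite /= !in_itv/= /affine ltr_ndivlMr// ler_ndivrMr// (mulrC z).
    by rewrite ltrBlDr lerBrDr andbC.
  by rewrite ltrBlDr lerBrDr andbC.
rewrite lebesgue_measure_itv/= lte_fin ltr_nM2r ?invr_lt0// ltrD2r xy.
rewrite -!EFinB -EFinM; congr (_%:E).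
by rewrite ltr0_norm// -mulrBl mulNr mulrCA divff ?mulr1//; ring.
Qed.

(** The image of Lebesgue measure under x |-> a x + b, multiplied by |a|,
    takes the same values on intervals as Lebesgue measure, hence equals it.
    *)
Lemma ge0_integral_affine a b (f : R -> R) : a != 0 -> measurable_fun setT f ->
  (forall x, 0 <= f x) ->
  (\int[mu]_x (f x)%:E = `|a|%:E * \int[mu]_x (f (a * x + b)%R)%:E)%E.
Proof.
move=> a0 mf f0; have mEf : measurable_fun setT (EFin \o f) by exact/measurable_EFinP.
rewrite (@eq_measure_integral _ _ _ _ (affine_measure a b)); last first.
  by move=> A mA _; apply: lebesgue_measure_affine.
rewrite ge0_integral_mscale//; last by move=> x _; rewrite lee_fin.
congr (_ * _)%E.
rewrite (ge0_integral_pushforward (measurable_affine a b) mu)//.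
by move=> x _; rewrite lee_fin.
Qed.

End AffineInvariance.

Section PowerIntegral.
Context {R : realType}.
Notation mu := (@lebesgue_measure R).
Implicit Types (a b x y t g : R).

Lemma continuous_powR_pos g x : 0 < x -> {for x, continuous (fun y => y `^ g)}.
Proof.
move=> x0; apply: differentiable_continuous; apply/derivable1_diffP.
by apply: derivable_powR; rewrite in_itv/= x0.
Qed.

Lemma integral_powR_segment g a t : 0 < g -> 0 < a -> a < t ->
  (\int[mu]_(x in `[a, t]) (x `^ (g - 1))%:E = (t `^ g / g - a `^ g / g)%:E)%E.
Proof.
move=> g0 a0 at_; pose F x := x `^ g / g.
have dF x : 0 < x -> derivable F x 1.
  move=> x0; apply: derivableM; last exact: derivable_cst.
  by apply: derivable_powR; rewrite in_itv/= x0.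
have cF x : 0 < x -> {for x, continuous F}.
  by move=> x0; apply: differentiable_continuous; apply/derivable1_diffP/dF.
rewrite EFinB; apply: (@continuous_FTC2 _ (fun x => x `^ (g - 1)) F) => //.
- apply: continuous_in_subspaceT => x; rewrite inE/= in_itv/= => /andP[ax _].
  by apply: continuous_powR_pos; exact: lt_le_trans ax.
- split.
  + by move=> x; rewrite in_itv/= => /andP[ax _]; apply: dF; exact: lt_trans ax.
  + by apply: cvg_at_right_filter; exact: cF.
  + by apply: cvg_at_left_filter; apply: cF; exact: lt_trans at_.
- move=> x; rewrite in_itv/= => /andP[ax _]; have x0 : 0 < x by exact: lt_trans ax.
  rewrite /F derive1E deriveM//; last first.
    by apply: derivable_powR; rewrite in_itv/= x0.
  rewrite -!derive1E powR_derive1 ?in_itv/= ?x0// derive1_cst.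
  by rewrite scaler0 add0r /GRing.scale/= mulrA mulVf ?mul1r// gt_eqF.
Qed.

(** The singularity at 0 is reached by monotone convergence along the segments
    [t / n, t]. *)
Lemma integral_powR0 g t : 0 < g -> 0 <= t ->
  (\int[mu]_(x in `]0%R, t]) (x `^ (g - 1))%:E = (t `^ g / g)%:E)%E.
Proof.
move=> g0; rewrite le_eqVlt => /predU1P[<-|t0].
  by rewrite set_itv_ge ?bnd_simp//= ?integral_set0 ?powR0 ?gt_eqF ?mul0r.
pose F n : set R := `[t / n.+2%:R, t]%classic.
have -> : `]0, t]%classic = \bigcup_n F n.
  apply/seteqP; split => x /=; rewrite ?in_itv/=.
    move=> /andP[x0 xt]; pose n := Num.truncn (t / x).
    exists n => //; rewrite /F/= in_itv/= xt andbT ler_pdivrMr// mulrC -ler_pdivrMr//.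
    rewrite (le_trans (ltW (truncnS_gt _)))// ler_nat//.
  move=> [n _]; rewrite /F/= in_itv/= => /andP[nx ->]; rewrite andbT.
  by apply: lt_le_trans nx; rewrite divr_gt0.
have hF : (fun n => \int[mu]_(x in F n) (x `^ (g - 1))%:E)%E =
    (fun n => (t `^ g / g - (t / n.+2%:R) `^ g / g)%:E).
  apply/funext => n; apply: integral_powR_segment => //; first by rewrite divr_gt0.
  by rewrite ltr_pdivrMr// ltr_pMr// ltr1n.
have c1 : (fun n => \int[mu]_(x in F n) (x `^ (g - 1))%:E)%E @ \oo -->
   (\int[mu]_(x in \bigcup_n F n) (x `^ (g - 1))%:E)%E.
  apply: ge0_nondecreasing_set_cvg_integral => //.
  - move=> m n mn; apply/subsetPset => x; rewrite /F/= !in_itv/= => /andP[mx ->].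
    rewrite andbT (le_trans _ mx)// ler_pM2l// lef_pV2 ?posrE ?ltr0n// ler_nat.
    by rewrite !ltnS.
  - by move=> n; exact: measurable_itv.
  - by move=> n; apply/measurable_EFinP; apply: measurable_funTS; exact: measurable_powR.
  - by move=> n x _; rewrite lee_fin powR_ge0.
have c0 : (fun n => t / n.+2%:R) @ \oo --> (0 : R).
  rewrite -(mulr0 t); apply: cvgMl_tmp.
  by have := @cvg_harmonic R; rewrite -cvg_shiftS.
have c2 : (fun n => (t `^ g / g - (t / n.+2%:R) `^ g / g)%:E) @ \oo --> (t `^ g / g)%:E.
  apply: cvg_EFin; first exact: nearW.
  rewrite -[X in _ --> X]subr0; apply: cvgB; first exact: cvg_cst.
  rewrite -(mul0r g^-1); apply: cvgMr_tmp.
  have -> : 0 = `|0 : R| `^ g by rewrite normr0 powR0// gt_eqF.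
  have -> : (fun n => (t / n.+2%:R) `^ g) = (fun x : R => `|x| `^ g) \o (fun n => t / n.+2%:R).
    by apply/funext => n /=; rewrite ger0_norm// divr_ge0// ltW.
  apply: (@cvg_comp _ _ _ (fun n => t / n.+2%:R) (fun x : R => `|x| `^ g) _ (nbhs (0:R))); last first.
    exact: continuous_norm_powR.
  exact: c0.
apply: (@cvg_unique _ (@ereal_hausdorff R) _ _ _ _ c1); rewrite hF; exact: c2.
Qed.

End PowerIntegral.

Section Convolution.
Context {R : realType}.
Notation mu := (@lebesgue_measure R).
Implicit Types (b g s t : R) (u v w : R -> R).

(** The Riemann-Liouville integral of order b, without the factor 1 /
    Gamma(b). *)
Definition conv b w t : R := \int[mu]_(s in `[0, t]) ((t - s) `^ (b - 1) * w s).

Lemma measurable_kernel g t : measurable_fun setT (fun s : R => (t - s) `^ g).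
Proof.
apply: (measurableT_comp (measurable_powR g)).
by apply: measurable_funB => //; exact: measurable_cst.
Qed.

Lemma kernel_integral g s t : 0 < g -> s <= t ->
  Rintegrable `[s, t] (fun x => (t - x) `^ (g - 1)) /\
  \int[mu]_(x in `[s, t]) ((t - x) `^ (g - 1)) = (t - s) `^ g / g.
Proof.
move=> g0 st.
have mk : measurable_fun setT (fun x : R => x `^ (g - 1)) by exact: measurable_powR.
pose f : R -> R := (fun x => x `^ (g - 1)) \_ `]0, t - s].
have mf : measurable_fun setT f.
  by apply/(measurable_restrictT _ _).1 => //; exact: measurable_funTS.
have f0 x : 0 <= f x by rewrite /f patchE; case: ifP => // _; exact: powR_ge0.
have E : (\int[mu]_(x in `[s, t]) ((t - x) `^ (g - 1))%:E = ((t - s) `^ g / g)%:E)%E.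
  have ts0 : 0 <= t - s by rewrite subr_ge0.
  have <- : (\int[mu]_x (f x)%:E = ((t - s) `^ g / g)%:E)%E.
    rewrite -(integral_powR0 g0 ts0) [RHS]integral_mkcond.
    by apply: eq_integral => x _; rewrite /f !patchE; case: ifP.
  rewrite (@ge0_integral_affine _ (-1) t f)// ?oppr_eq0 ?oner_eq0// normrN1 mul1e.
  rewrite -integral_itv_bndo_bndc; last first.
    by apply/measurable_EFinP; apply: measurable_funTS; exact: measurable_kernel.
  rewrite integral_mkcond; apply: eq_integral => x _.
  rewrite /f !patchE !mem_setE !in_itv/= mulN1r [- x + t]addrC subr_gt0 lerD2l lerN2 andbC.
  by case: ifP.
split.
  apply/integrableP; split.
    by apply/measurable_EFinP; apply: measurable_funTS; exact: measurable_kernel.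
  under eq_integral do rewrite /= ger0_norm ?powR_ge0//.
  by rewrite E ltry.
by rewrite /Rintegral E.
Qed.

Lemma conv0 b w : conv b w 0 = 0.
Proof. by rewrite /conv set_itv1 Rintegral_set1. Qed.

End Convolution.

Section ConvolutionOnLp.
Context {R : realType}.
Notation mu := (@lebesgue_measure R).
Variables (T p : R).
Hypotheses (T0 : 0 < T) (p1 : 1 < p).
Implicit Types (b g s t q : R) (u v w k : R -> R).

Let p0 : 0 < p. Proof. exact: lt_trans p1. Qed.

Lemma pmass_sub (D : set R) w : measurable D -> D `<=` `[0, T] -> LpT T p w ->
  \int[mu]_(x in D) (`|w x| `^ p) <= pmass T p w.
Proof.
by move=> mD sD [mw w0 iw]; apply: le_Rintegral_subset.
Qed.

Lemma LpT_holder (D : set R) q k w : measurable D -> D `<=` `[0, T] ->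
  0 < q -> p^-1 + q^-1 = 1 -> measurable_fun D k ->
  Rintegrable D (fun x => `|k x| `^ q) -> LpT T p w ->
  Rintegrable D (fun x => k x * w x) /\
  `|\int[mu]_(x in D) (k x * w x)| <=
    (\int[mu]_(x in D) (`|k x| `^ q)) `^ q^-1 * pmass T p w `^ p^-1.
Proof.
move=> mD sD q0 pq mk ik hw; case: (hw) => mw w0 iw.
have mwD : measurable_fun D w by exact: measurable_funTS.
have iD : Rintegrable D (fun x => `|w x| `^ p) by exact: RintegrableS iw.
have qp : q^-1 + p^-1 = 1 by rewrite addrC.
have [ikw H] := @Rhoelder R D q p k w mD q0 p0 qp mk mwD ik iD.
have {}ikw : Rintegrable D (fun x => k x * w x) by exact: ikw.
split; [exact: ikw|have := le_normr_Rintegrable mD ikw => /le_trans; apply].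
apply: le_trans H _; apply: ler_wpM2l; first exact: powR_ge0.
apply: ge0_ler_powR; rewrite ?nnegrE ?invr_ge0 ?(ltW p0) ?pmass_ge0//.
  by apply: Rintegral_ge0 => x _; exact: powR_ge0.
exact: pmass_sub.
Qed.

Variable b : R.
Hypotheses (b1 : b <= 1) (bp : p^-1 < b).

(** The condition 1 / p < b is exactly the integrability of the q-th power of
    the kernel, whose exponent is (b - 1) q > -1. *)
Let conj_exp : exists q, [/\ 1 <= q, p^-1 + q^-1 = 1, 0 < (b - 1) * q + 1 &
  ((b - 1) * q + 1) / q = b - p^-1].
Proof.
have [q q0 pq] := conjugate_exponent p1; exists q.
have pV : 0 < p^-1 by rewrite invr_gt0.
have q1 : 1 <= q by rewrite -[leRHS]invrK -[leLHS]invr1 lef_pV2 ?posrE ?invr_gt0//; lra.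
have qq : q^-1 * q = 1 by rewrite mulVf// gt_eqF.
split => //; last by rewrite mulrDl mul1r mulfK ?gt_eqF//; lra.
have h : 0 < b - 1 + q^-1 by move: bp pq; lra.
have : 0 < (b - 1 + q^-1) * q by exact: mulr_gt0.
by rewrite mulrDl qq.
Qed.

Lemma conv_integrable w t : LpT T p w -> t <= T ->
  Rintegrable `[0, t] (fun s => (t - s) `^ (b - 1) * w s).
Proof.
move=> hw tT; have [q [q1 pq g0 _]] := conj_exp.
have q0 : 0 < q by exact: lt_le_trans q1.
have [t0|t0] := ltP t 0.
  rewrite /Rintegrable set_itv_ge ?bnd_simp -?ltNge//.
  exact: integrable_set0.
have [ik _] := kernel_integral g0 t0.
have [] // := @LpT_holder `[0, t]%classic q (fun s => (t - s) `^ (b - 1)) w _ _ q0 pq _ _ hw.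
- by move=> x /=; rewrite !in_itv/= => /andP[-> /le_trans ->].
- by apply: measurable_funTS; exact: measurable_kernel.
- apply: Rintegrable_eq ik => // x _; rewrite ger0_norm ?powR_ge0// -powRrM.
  by congr (_ `^ _); ring.
Qed.

Lemma conv_lin (k : R) v w t : LpT T p v -> LpT T p w -> t <= T ->
  conv b (fun s => k * v s + w s) t = k * conv b v t + conv b w t.
Proof.
move=> hv hw tT; have iv := conv_integrable hv tT; have iw := conv_integrable hw tT.
rewrite /conv -RintegralZl// -RintegralD//; last exact: RintegrableZ.
by apply: eq_Rintegral => s _; ring.
Qed.

(** Both parts of the increment are estimated by Hoelder's inequality. For the
    difference of the two kernels, superadditivity of the q-th power, (x -
    y)^q <= x^q - y^q, turns the L^q norm into a difference of explicit
    integrals. *)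
Lemma conv_hoelder : exists2 C, 0 < C & forall w s t, LpT T p w ->
  0 <= s -> s <= t -> t <= T ->
  `|conv b w t - conv b w s| <= C * (t - s) `^ (b - p^-1) * pmass T p w `^ p^-1.
Proof.
have arith (A C I M : R) : C - I = M -> A <= C -> A - I <= M by lra.
have [q [q1 pq g0 gq]] := conj_exp; set g := (b - 1) * q + 1 in g0 gq.
have q0 : 0 < q by exact: lt_le_trans q1.
exists (2 * (g^-1) `^ q^-1) => [|w s t hw s0 st tT].
  by rewrite mulr_gt0// powR_gt0// invr_gt0.
have t0 : 0 <= t by exact: le_trans st.
have kq r x : `|(r - x) `^ (b - 1)| `^ q = (r - x) `^ (g - 1).
  rewrite ger0_norm ?powR_ge0// -powRrM; congr (_ `^ _); rewrite /g; ring.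
pose M := (t - s) `^ g / g.
have M0 : 0 <= M by rewrite divr_ge0 ?powR_ge0// ltW.
have ME : M `^ q^-1 = (g^-1) `^ q^-1 * (t - s) `^ (b - p^-1).
  rewrite /M powRM ?powR_ge0 ?invr_ge0 ?(ltW g0)// -powRrM mulrC; congr (_ * _ `^ _).
  by rewrite -gq; ring.
set P := pmass T p w `^ p^-1.
suff [H1 H2] : `|\int[mu]_(x in `[s, t]) ((t - x) `^ (b - 1) * w x)| <= M `^ q^-1 * P /\
    `|\int[mu]_(x in `[0, s[) (((t - x) `^ (b - 1) - (s - x) `^ (b - 1)) * w x)| <= M `^ q^-1 * P.
  have it := conv_integrable hw tT; have is_ := conv_integrable hw (le_trans st tT).
  have its : Rintegrable `[0, s] (fun x => (t - x) `^ (b - 1) * w x).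
    apply: RintegrableS it => // x /=; rewrite !in_itv/= => /andP[-> /le_trans ->]//.
  have -> : conv b w t - conv b w s = \int[mu]_(x in `[s, t]) ((t - x) `^ (b - 1) * w x) +
      \int[mu]_(x in `[0, s[) (((t - x) `^ (b - 1) - (s - x) `^ (b - 1)) * w x).
    have -> : \int[mu]_(x in `[s, t]) ((t - x) `^ (b - 1) * w x) =
        conv b w t - \int[mu]_(x in `[0, s]) ((t - x) `^ (b - 1) * w x).
      rewrite /conv Rintegral_itvB ?bnd_simp// Rintegral_itv_obnd_cbnd//.
      apply: RintegrableS it => // x /=; rewrite !in_itv/= => /andP[/ltW /(le_trans s0) -> ->]//.
    have -> : \int[mu]_(x in `[0, s[) (((t - x) `^ (b - 1) - (s - x) `^ (b - 1)) * w x) =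
        \int[mu]_(x in `[0, s]) ((t - x) `^ (b - 1) * w x) - conv b w s.
      rewrite /conv -RintegralB//.
      under eq_Rintegral do rewrite mulrBl.
      rewrite Rintegral_itv_bndo_bndc//.
      apply: (@RintegrableS _ `[0, s]) => //; last exact: RintegrableB.
      by move=> x /=; rewrite !in_itv/= => /andP[-> /ltW ->].
    by rewrite addrA subrK.
  rewrite (le_trans (ler_normD _ _))// (le_trans (lerD H1 H2))// ME.
  by rewrite le_eqVlt; apply/orP; left; apply/eqP; ring.
split.
  have [ik vk] := kernel_integral g0 st.
  have ik' : Rintegrable `[s, t] (fun x => `|(t - x) `^ (b - 1)| `^ q).
    by apply: Rintegrable_eq ik => // x _; rewrite kq.
  have vk' : \int[mu]_(x in `[s, t]) (`|(t - x) `^ (b - 1)| `^ q) = M.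
    by rewrite /M -vk; apply: eq_Rintegral => x _; rewrite kq.
  have [|||_] := @LpT_holder `[s, t]%classic q (fun x => (t - x) `^ (b - 1)) w _ _ q0 pq _ ik' hw.
  - exact: measurable_itv.
  - by move=> x /=; rewrite !in_itv/= => /andP[/(le_trans s0) -> /le_trans ->].
  - by apply: measurable_funTS; exact: measurable_kernel.
  by move=> H; apply: le_trans H _; rewrite vk'.
have [ikt vkt] := kernel_integral g0 t0; have [iks vks] := kernel_integral g0 s0.
have [ikst vkst] := kernel_integral g0 st.
pose k x := (t - x) `^ (b - 1) - (s - x) `^ (b - 1).
have mk : measurable_fun `[0, s[ k.
  by apply: measurable_funTS; apply: measurable_funB; exact: measurable_kernel.
have ikt' : Rintegrable `[0, s] (fun x => (t - x) `^ (g - 1)).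
  by apply: RintegrableS ikt => // x /=; rewrite !in_itv/= => /andP[-> /le_trans ->].
pose h x := (s - x) `^ (g - 1) - (t - x) `^ (g - 1).
have ih : Rintegrable `[0, s] h by exact: RintegrableB.
have ih' : Rintegrable `[0, s[ h.
  by apply: RintegrableS ih => // x /=; rewrite !in_itv/= => /andP[-> /ltW ->].
have kh x : `[0, s[%classic x -> `|k x| `^ q <= h x.
  rewrite /= in_itv/= => /andP[x0 xs].
  have sx : 0 < s - x by rewrite subr_gt0.
  have tx : 0 < t - x by rewrite subr_gt0 (lt_le_trans xs).
  have le1 : (t - x) `^ (b - 1) <= (s - x) `^ (b - 1).
    have -> : b - 1 = - (1 - b) by ring.
    rewrite !powRN lef_pV2 ?posrE ?powR_gt0//.
    by apply: ge0_ler_powR; rewrite ?nnegrE ?(ltW sx) ?(ltW tx) ?subr_ge0// lerD2r.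
  rewrite /k distrC ger0_norm ?subr_ge0// (le_trans (powR_superadd q1 _))//.
    by rewrite powR_ge0.
  by rewrite -[X in X `^ q](ger0_norm (powR_ge0 _ _)) kq -[X in _ - X `^ q](ger0_norm (powR_ge0 _ _)) kq.
have ik : Rintegrable `[0, s[ (fun x => `|k x| `^ q).
  apply: (Rintegrable_le _ _ _ ih') => //; first exact: measurable_norm_powR.
  by move=> x xs; rewrite ger0_norm ?powR_ge0//; exact: kh.
have [||_] := @LpT_holder `[0, s[%classic q k w _ _ q0 pq mk ik hw.
- exact: measurable_itv.
- by move=> x /=; rewrite !in_itv/= => /andP[-> /ltW /le_trans ->]//; exact: le_trans tT.
move=> /le_trans; apply; rewrite ler_wpM2r ?powR_ge0//.
apply: ge0_ler_powR; rewrite ?nnegrE ?invr_ge0 ?(ltW q0)//.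
  by apply: Rintegral_ge0 => x _; exact: powR_ge0.
apply: (@le_trans _ _ (\int[mu]_(x in `[0, s[) h x)); first exact: le_Rintegral.
rewrite Rintegral_itv_bndo_bndc// RintegralB// vks.
have : \int[mu]_(x in `[0, t]) ((t - x) `^ (g - 1)) - \int[mu]_(x in `[0, s]) ((t - x) `^ (g - 1)) = (t - s) `^ g / g.
  rewrite Rintegral_itvB ?bnd_simp// Rintegral_itv_obnd_cbnd//.
  by apply: RintegrableS ikst => // x /=; rewrite !in_itv/= => /andP[/ltW -> ->].
rewrite vkt !subr0 -/M; move: (\int[mu]_(x in `[0, s]) ((t - x) `^ (g - 1))) => I h1.
apply: (arith _ _ _ _ h1).
by rewrite ler_pM2r ?invr_gt0//; apply: ge0_ler_powR; rewrite ?nnegrE ?(ltW g0).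
Qed.

End ConvolutionOnLp.

Section BetaKernel.
Context {R : realType}.
Notation mu := (@lebesgue_measure R).
Implicit Types (b g s t x y : R) (u v w : R -> R).

(** The power is cut off at 0 so that convolutions on [0, t] become integrals
    over the line, to which Fubini's theorem applies. *)
Definition kernel b x : R := if 0 < x then x `^ (b - 1) else 0.

Lemma kernel_ge0 b x : 0 <= kernel b x.
Proof. by rewrite /kernel; case: ifP => // _; exact: powR_ge0. Qed.

Lemma measurable_kernel_pos b : measurable_fun setT (kernel b).
Proof.
have -> : kernel b = (fun x => x `^ (b - 1)) \_ `]0, +oo[.
  by apply/funext => x; rewrite /kernel patchE mem_setE in_itv/= andbT.
apply/(measurable_restrictT _ _).1 => //; apply: measurable_funTS.
exact: measurable_powR.
Qed.

Lemma patch_kernel b w t : b != 1 -> (forall s, s < 0 -> w s = 0) ->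
  (fun s => kernel b (t - s) * w s) =
  (fun s => (t - s) `^ (b - 1) * w s) \_ `[0, t].
Proof.
move=> b1 w0; apply/funext => s; rewrite patchE mem_setE in_itv/= /kernel subr_gt0.
have [s0|s0] := ltP s 0; first by rewrite w0// mulr0.
case: ltgtP => [ts|//|->]; rewrite ?mul0r//.
by rewrite subrr powR0 ?mul0r// subr_eq0.
Qed.

Lemma conv_kernel b w t : b != 1 -> (forall s, s < 0 -> w s = 0) ->
  \int[mu]_s (kernel b (t - s) * w s) = conv b w t.
Proof. by move=> b1 w0; rewrite patch_kernel// -Rintegral_mkcond. Qed.

(** The two singular factors are separated by the midpoint: on each half of
    ]0, 1[ one of them is at most 2. *)
Lemma kernel_prod_le b s : 0 < b < 1 ->
  kernel b (1 - s) * kernel (1 - b) s <=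
  2 * (((fun s => (1 - s) `^ (b - 1)) \_ `[0, 1]) s + ((fun s => s `^ (1 - b - 1)) \_ `]0, 1]) s).
Proof.
move=> /andP[b0 b1]; rewrite /kernel subr_gt0 !patchE !mem_setE !in_itv/=.
have -> : point = 0 :> R by [].
have [s0|s0] := leP s 0.
  by rewrite mulr0 mulr_ge0// addr0; case: ifP => // _; exact: powR_ge0.
have [s1|s1] := ltP s 1; last first.
  rewrite mul0r mulr_ge0// addr_ge0//; case: ifP => // _; exact: powR_ge0.
rewrite (ltW s0) (ltW s1)/=.
have half x (c : R) : 2^-1 <= x -> - 1 <= c <= 0 -> x `^ c <= 2.
  move=> x2 /andP[c1 c0]; have x0 : 0 < x by lra.
  have -> : c = - (- c) by ring.
  rewrite powRN -[leRHS]invrK lef_pV2 ?posrE ?powR_gt0//.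
  apply: (@le_trans _ _ (2^-1 `^ (- c))).
    rewrite -[leLHS]powRr1//; apply: ger_powR; last lra.
    by rewrite invr_gt0 invf_le1//=; lra.
  by apply: ge0_ler_powR; rewrite ?nnegrE//; lra.
have k1 := powR_ge0 (1 - s) (b - 1); have k2 := powR_ge0 s (1 - b - 1).
have [s2|s2] := leP s 2^-1.
  have h : (1 - s) `^ (b - 1) <= 2 by apply: half; [lra|apply/andP; split; lra].
  by move: h k1 k2; move: ((1 - s) `^ (b - 1)) (s `^ (1 - b - 1)) => x y; clear; nra.
have h : s `^ (1 - b - 1) <= 2 by apply: half; [lra|apply/andP; split; lra].
by move: h k1 k2; move: ((1 - s) `^ (b - 1)) (s `^ (1 - b - 1)) => x y; clear; nra.
Qed.

Definition beta_kernel b x : \bar R := (\int[mu]_s (kernel b (x - s) * kernel (1 - b) s)%:E)%E.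

Lemma measurable_kernel_prod b x :
  measurable_fun setT (fun s => kernel b (x - s) * kernel (1 - b) s).
Proof.
apply: measurable_funM; last exact: measurable_kernel_pos.
apply: (measurableT_comp (measurable_kernel_pos b)).
by apply: measurable_funB => //; exact: measurable_cst.
Qed.

Lemma measurable_kernel_shift b t x :
  measurable_fun setT (fun s => kernel b (t - s) * kernel (1 - b) (s - x)).
Proof.
apply: measurable_funM.
  apply: (measurableT_comp (measurable_kernel_pos b)).
  by apply: measurable_funB => //; exact: measurable_cst.
apply: (measurableT_comp (measurable_kernel_pos (1 - b))).
by apply: measurable_funB => //; exact: measurable_cst.
Qed.

Lemma kernel_prod_ge0 b x s : 0 <= kernel b (x - s) * kernel (1 - b) s.
Proof. by rewrite mulr_ge0 ?kernel_ge0. Qed.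

Lemma beta_kernel_fin b : 0 < b < 1 -> (beta_kernel b 1 < +oo)%E.
Proof.
move=> hb; have /andP[b0 b1] := hb.
have [i1 _] := @kernel_integral R b 0 1 b0 ler01.
have i2 : Rintegrable `]0, 1] (fun s : R => s `^ (1 - b - 1)).
  apply/integrableP; split.
    by apply/measurable_EFinP; apply: measurable_funTS; exact: measurable_powR.
  under eq_integral do rewrite /= ger0_norm ?powR_ge0//.
  by rewrite integral_powR0 ?ltry// subr_gt0.
have := RintegrableZ 2 measurableT (RintegrableD measurableT (Rintegrable_patch (measurable_itv _) i1) (Rintegrable_patch (measurable_itv _) i2)).
have mk := measurable_kernel_prod b 1.
move=> /(Rintegrable_le measurableT mk); have h x : `|kernel b (1 - x) * kernel (1 - b) x| <= 2 * (((fun s => (1 - s) `^ (b - 1)) \_ `[0, 1]) x + ((fun s => s `^ (1 - b - 1)) \_ `]0, 1]) x).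
  by rewrite ger0_norm ?kernel_prod_ge0//; exact: kernel_prod_le.
move=> /(_ (fun x _ => h x)) /integrableP[_]; apply: le_lt_trans.
rewrite le_eqVlt; apply/orP; left; apply/eqP; apply: eq_integral => x _ /=.
by rewrite ger0_norm ?kernel_prod_ge0.
Qed.

Lemma beta_kernel_ge1 b : 0 < b < 1 -> (1 <= beta_kernel b 1)%E.
Proof.
move=> /andP[b0 b1].
have e : (\int[mu]_s ((\1_(`]0%R, 1%R[%classic : set R) s)%:E) = 1)%E.
  by rewrite integral_indic//= setIT lebesgue_measure_itv/= lte_fin ltr01 -EFinB subr0.
rewrite -[leLHS]e.
apply: ge0_le_integral => //=.
- by apply/measurable_EFinP; exact: measurable_indic.
- by apply/measurable_EFinP; exact: measurable_kernel_prod.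
move=> x _; rewrite lee_fin indicE mem_setE in_itv/= /kernel.
case: (boolP (0 < x < 1)) => [/andP[x0 x1]|_]; last exact: kernel_prod_ge0.
have ge1 y c : 0 < y < 1 -> c <= 0 -> 1 <= y `^ c.
  move=> /andP[y0 y1] c0; rewrite -[leLHS](powRr0 y).
  by apply: ger_powR => //; rewrite y0 ltW.
rewrite subr_gt0 x0 x1; rewrite -[leLHS]mul1r; apply: ler_pM => //; apply: ge1; lra.
Qed.

Lemma kernelM b x y : 0 < x -> kernel b (x * y) = x `^ (b - 1) * kernel b y.
Proof.
move=> x0; rewrite /kernel pmulr_rgt0//; case: ifPn => [y0|_]; last by rewrite mulr0.
by rewrite powRM// ltW.
Qed.

(** Homogeneity of degree b - 1 and - b makes the convolution of the two
    kernels constant on the positive half-line. *)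
Lemma beta_kernel_scale b x : 0 < x -> beta_kernel b x = beta_kernel b 1.
Proof.
move=> x0; rewrite /beta_kernel.
rewrite (@ge0_integral_affine _ x 0)//; last 3 first.
- by rewrite gt_eqF.
- exact: measurable_kernel_prod.
- by move=> s; exact: kernel_prod_ge0.
rewrite -ge0_integralZl//; last 2 first.
- apply/measurable_EFinP; apply: (measurableT_comp (measurable_kernel_prod b x)).
  by apply: measurable_funD => //; apply: measurable_funM.
- by move=> s _; rewrite lee_fin kernel_prod_ge0.
apply: eq_integral => s _; rewrite -EFinM; congr (_%:E).
rewrite addr0 (_ : x - x * s = x * (1 - s)); last by ring.
rewrite !kernelM// gtr0_norm//.
rewrite mulrACA mulrA -powRD; last by apply/implyP => _; rewrite gt_eqF.
have -> : b - 1 + (1 - b - 1) = - 1 by ring.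
by rewrite powR_inv1 ?(ltW x0)// !mulrA divff ?mul1r// gt_eqF.
Qed.

Lemma beta_kernel_le0 b x : x <= 0 -> beta_kernel b x = 0%E.
Proof.
move=> x0; rewrite /beta_kernel integral0_eq// => s _.
rewrite /kernel; case: ifPn => [xs|_]; last by rewrite mul0r.
case: ifPn => [s0|_]; last by rewrite mulr0.
by exfalso; move: xs s0 x0; lra.
Qed.

Lemma beta_kernel_sym b : beta_kernel b 1 = beta_kernel (1 - b) 1.
Proof.
rewrite /beta_kernel (@ge0_integral_affine _ (-1) 1)//; last 2 first.
- exact: measurable_kernel_prod.
- by move=> s; exact: kernel_prod_ge0.
rewrite normrN1 mul1e; apply: eq_integral => s _; congr (_%:E).
rewrite mulrC; congr (_ * _); congr kernel; ring.
Qed.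

(** The value B(b, 1 - b) of Euler's beta function. *)
Definition Beta b : R := fine (beta_kernel b 1).

Lemma BetaE b : 0 < b < 1 -> beta_kernel b 1 = (Beta b)%:E.
Proof.
move=> hb; rewrite /Beta fineK// fin_numElt beta_kernel_fin// andbT.
by rewrite (lt_le_trans _ (beta_kernel_ge1 hb))// ltNyr.
Qed.

Lemma Beta_gt0 b : 0 < b < 1 -> 0 < Beta b.
Proof.
by move=> hb; rewrite (lt_le_trans ltr01)// -lee_fin -BetaE// beta_kernel_ge1.
Qed.

Lemma Beta_sym b : Beta (1 - b) = Beta b.
Proof. by rewrite /Beta -beta_kernel_sym. Qed.

(** Fubini's theorem makes the iterated convolution a convolution with
    beta_kernel, which is constant on the positive half-line. *)
Lemma conv_conv b w t : 0 < b < 1 -> (forall s, s < 0 -> w s = 0) ->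
  Rintegrable setT w ->
  (forall s, s <= t -> Rintegrable `[0, s] (fun r => (s - r) `^ (1 - b - 1) * w r)) ->
  conv b (conv (1 - b) w) t = Beta b * \int[mu]_(s in `[0, t]) w s.
Proof.
move=> hb w0 iw hin; have [b1 b1'] : b != 1 /\ 1 - b != 1.
  by move: hb => /andP[? ?]; split; apply/eqP; lra.
have mw := Rintegrable_measurable iw.
pose G (z : measurableTypeR R * measurableTypeR R) : \bar R :=
  (kernel b (t - z.1) * (kernel (1 - b) (z.1 - z.2) * w z.2))%:E.
have mG : measurable_fun setT G.
  apply/measurable_EFinP; apply: measurable_funM.
    apply: (measurableT_comp (measurable_kernel_pos b)).
    by apply: measurable_funB => //; exact: measurable_cst.
  apply: measurable_funM; last exact: (measurableT_comp mw).
  apply: (measurableT_comp (measurable_kernel_pos (1 - b))).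
  exact: measurable_funB.
have inner r : (\int[mu]_s (kernel b (t - s) * kernel (1 - b) (s - r))%:E)%E = beta_kernel b (t - r).
  rewrite (@ge0_integral_affine _ 1 r) ?oner_eq0//; last 2 first.
  - exact: measurable_kernel_shift.
  - by move=> s; rewrite mulr_ge0 ?kernel_ge0.
  rewrite normr1 mul1e; apply: eq_integral => s _; congr (_%:E).
  by rewrite mul1r addrK; congr (kernel _ _ * _); ring.
pose S : R -> R := (w \_ `]-oo, t[).
have iS : Rintegrable setT S.
  by apply: Rintegrable_patch => //; apply: RintegrableS iw.
have Gnorm r : (\int[mu]_s `|G (s, r)|)%E = (Beta b * `|S r|)%:E.
  have -> : (\int[mu]_s `|G (s, r)| = \int[mu]_s ((`|w r|)%:E * (kernel b (t - s) * kernel (1 - b) (s - r))%:E))%E.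
    apply: eq_integral => s _; rewrite /G/= !normrM !(ger0_norm (kernel_ge0 _ _)) -EFinM.
    by congr (_%:E); ring.
  rewrite ge0_integralZl//; last 2 first.
  - by apply/measurable_EFinP; exact: measurable_kernel_shift.
  - by move=> s _; rewrite lee_fin mulr_ge0 ?kernel_ge0.
  rewrite inner /S patchE mem_setE in_itv/=; case: ltP => rt.
    by rewrite beta_kernel_scale ?subr_gt0// BetaE// -EFinM mulrC.
  by rewrite beta_kernel_le0 ?subr_le0// mule0 normr0 mulr0.
have Gval r : (\int[mu]_s G (s, r))%E = (Beta b * S r)%:E.
  have -> : (\int[mu]_s G (s, r) = \int[mu]_s ((w r)%:E * (kernel b (t - s) * kernel (1 - b) (s - r))%:E))%E.
    apply: eq_integral => s _; rewrite /G/= -EFinM; congr (_%:E); ring.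
  rewrite integralZl//; last first.
    apply/integrableP; split.
      by apply/measurable_EFinP; exact: measurable_kernel_shift.
    under eq_integral do rewrite /= ger0_norm ?mulr_ge0 ?kernel_ge0//.
    rewrite inner; have [tr|tr] := ltP r t.
      by rewrite beta_kernel_scale ?subr_gt0// beta_kernel_fin.
    by rewrite beta_kernel_le0 ?subr_le0 ?ltry.
  rewrite inner /S patchE mem_setE in_itv/=; case: ltP => rt.
    by rewrite beta_kernel_scale ?subr_gt0// BetaE// -EFinM mulrC.
  by rewrite beta_kernel_le0 ?subr_le0// mule0 mulr0.
have iG : (mu \x mu)%E.-integrable setT G.
  apply/(integrable21ltyP mu mu mG).2.
  have /integrableP[_] := RintegrableZ (Beta b) measurableT (Rintegrable_norm measurableT iS).
  apply: le_lt_trans; rewrite le_eqVlt; apply/orP; left; apply/eqP.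
  have B0 r : 0 <= Beta b * `|S r| by rewrite mulr_ge0// ltW// Beta_gt0.
  by apply: eq_integral => r _; rewrite Gnorm /= (ger0_norm (B0 r)).
have := Fubini iG.
have -> : (\int[mu]_r \int[mu]_s G (s, r) = \int[mu]_r (Beta b * S r)%:E)%E.
  by apply: eq_integral => r _; exact: Gval.
have -> : (\int[mu]_s \int[mu]_r G (s, r) =
    \int[mu]_s (kernel b (t - s) * conv (1 - b) w s)%:E)%E.
  apply: eq_integral => s _; rewrite /G/= /kernel subr_gt0; case: ltP => st; last first.
    by rewrite mul0r; apply: integral0_eq => r _; rewrite mul0r.
  have ik : Rintegrable setT (fun r => kernel (1 - b) (s - r) * w r).
    by rewrite patch_kernel//; apply: Rintegrable_patch => //; exact: hin (ltW st).
  have -> : (\int[mu]_r ((t - s) `^ (b - 1) * (kernel (1 - b) (s - r) * w r))%:E =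
      \int[mu]_r (((t - s) `^ (b - 1))%:E * (kernel (1 - b) (s - r) * w r)%:E))%E.
    by apply: eq_integral => r _; rewrite EFinM.
  rewrite integralZl// -conv_kernel// EFinM; congr (_ * _)%E.
  by rewrite /Rintegral fineK//; exact: integrable_fin_num.
move=> /(f_equal fine) E.
have cneg s : s < 0 -> conv (1 - b) w s = 0.
  by move=> s0; rewrite /conv set_itv_ge ?bnd_simp -?ltNge// Rintegral_set0.
rewrite -conv_kernel//.
rewrite /Rintegral E -/(Rintegral mu setT (fun r => Beta b * S r)) RintegralZl//; congr (_ * _).
rewrite [RHS]Rintegral_mkcond; apply: ae_Rintegral.
exists [set t]; split => //; first exact: lebesgue_measure_set1.
move=> s /= h; apply: contrapT => /eqP st; apply: h => _.
rewrite /S !patchE !mem_setE !in_itv/=; have [s0|s0] := ltP s 0.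
  by rewrite w0//; case: ifP.
by rewrite /= [s <= t]le_eqVlt (negbTE st).
Qed.

End BetaKernel.

Section GammaConstant.
Context {R : realType}.
Notation mu := (@lebesgue_measure R).
Implicit Types (g s t : R).

Let gint g s : R := s `^ (g - 1) * expR (- s).

Let measurable_gint g : measurable_fun setT (gint g).
Proof.
apply: measurable_funM; first exact: measurable_powR.
apply: continuous_measurable_fun => x.
apply: (@continuous_comp R R R (fun x => - x) expR x); first exact: opp_continuous.
exact: continuous_expR.
Qed.

Let gint_ge0 g s : 0 <= gint g s.
Proof. by rewrite mulr_ge0 ?powR_ge0 ?expR_ge0. Qed.

(** The defining integral is total, so that its positivity includes its
    finiteness; compare the integrand with s^(g-1) on ]0, 1] and with exp (-
    s) elsewhere. *)
Lemma Gamma_gt0 g : 0 < g <= 1 -> 0 < Gamma g.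
Proof.
move=> /andP[g0 g1].
pose F : \bar R := (\int[mu]_(s in `]0%R, +oo[) (gint g s)%:E)%E.
have mP : measurable_fun setT (fun s : R => s `^ (g - 1)) by exact: measurable_powR.
have up : (F <= (g^-1)%:E + 1)%E.
  have -> : ((g^-1)%:E + 1 = \int[mu]_s (((fun s => s `^ (g - 1)) \_ `]0, 1]) s)%:E +
      \int[mu]_s (exponential_pdf 1 s)%:E)%E.
    rewrite integral_exponential_pdf//; congr (_ + _)%E.
    have /= := integral_powR0 g0 ler01; rewrite powR1 mul1r => <-.
    by rewrite integral_mkcond; apply: eq_integral => s _; rewrite !patchE; case: ifP.
  rewrite -ge0_integralD//; last 4 first.
  - by move=> s _; rewrite lee_fin patchE; case: ifP => // _; exact: powR_ge0.
  - apply/measurable_EFinP; apply/(measurable_restrictT _ _).1 => //.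
    exact: measurable_funTS.
  - by move=> s _; rewrite lee_fin exponential_pdf_ge0.
  - by apply/measurable_EFinP; exact: measurable_exponential_pdf.
  rewrite /F [leLHS]integral_mkcond; apply: ge0_le_integral => //.
  - by move=> s _; rewrite patchE; case: ifP => // _; rewrite lee_fin.
  - apply/(measurable_restrictT _ _).1 => //; apply/measurable_EFinP.
    exact: (measurable_funTS (measurable_gint g)).
  - apply: emeasurable_funD; apply/measurable_EFinP; last exact: measurable_exponential_pdf.
    by apply/(measurable_restrictT _ _).1 => //; exact: measurable_funTS.
  move=> s _; rewrite -EFinD !patchE !mem_setE !in_itv/= andbT.
  have [s0|s0] := ltP 0 s; last first.
    by rewrite lee_fin addr_ge0// exponential_pdf_ge0.
  rewrite lee_fin /gint /exponential_pdf patchE mem_setE in_itv/= andbT (ltW s0) mulN1r mul1r.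
  have e1 : expR (- s) <= 1 by rewrite -[leRHS]expR0 ler_expR oppr_le0 ltW.
  have [s1|s1] := leP s 1.
    rewrite -[leLHS]addr0; apply: lerD; last exact: expR_ge0.
    by rewrite ler_piMr ?powR_ge0.
  rewrite add0r ler_piMl ?expR_ge0// -[leRHS](powRr0 s); apply: ler_powR; first exact: ltW.
  by rewrite subr_le0.
have lo : ((expR (-1) / g)%:E <= F)%E.
  have -> : ((expR (-1) / g)%:E = \int[mu]_(s in `]0%R, 1%R]) (expR (-1) * s `^ (g - 1))%:E)%E.
    have /= := integral_powR0 g0 ler01; rewrite powR1 mul1r => E.
    under eq_integral do rewrite EFinM.
    rewrite ge0_integralZl//; last 2 first.
    - by apply/measurable_EFinP; exact: measurable_funTS.
    - by move=> s _; rewrite lee_fin powR_ge0.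
    by rewrite E EFinM.
  apply: (@le_trans _ _ (\int[mu]_(s in `]0%R, 1%R]) (gint g s)%:E)%E).
    apply: ge0_le_integral => //.
    - by move=> s _; rewrite lee_fin mulr_ge0 ?expR_ge0 ?powR_ge0.
    - by apply/measurable_EFinP; apply: measurable_funM => //; exact: measurable_funTS.
    - by apply/measurable_EFinP; exact: (measurable_funTS (measurable_gint g)).
    move=> s; rewrite /= in_itv/= => /andP[s0 s1].
    by rewrite lee_fin mulrC ler_wpM2l ?powR_ge0// ler_expR lerN2.
  apply: ge0_subset_integral => //.
  - by apply/measurable_EFinP; exact: (measurable_funTS (measurable_gint g)).
  - by move=> s _; rewrite lee_fin.
  - by move=> s; rewrite /= !in_itv/= => /andP[->].
rewrite /Gamma/= /Rintegral -/F; apply: fine_gt0; apply/andP; split.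
  by apply: lt_le_trans lo; rewrite lte_fin divr_gt0 ?expR_gt0.
by apply: le_lt_trans up _; rewrite -EFinD ltry.
Qed.

End GammaConstant.

(** * The fractional integral and the fractional derivative *)

Section HoelderContinuity.
Context {R : realType}.
Implicit Types (A : set R) (C g : R) (f : R -> R).

Lemma hoelder_within_continuous A C g f : 0 < g ->
  (forall x y, A x -> A y -> x <= y -> `|f y - f x| <= C * (y - x) `^ g) ->
  {within A, continuous f}.
Proof.
move=> g0 H.
have {}H x y : A x -> A y -> `|f x - f y| <= C * `|x - y| `^ g.
  move=> Ax Ay; have [xy|/ltW yx] := leP x y.
    by rewrite distrC [`|x - y|]distrC [`|y - x|]ger0_norm ?subr_ge0//; exact: H.
  by rewrite [`|x - y|]ger0_norm ?subr_ge0//; exact: H.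
apply/subspace_continuousP => x Ax; apply/cvgrPdist_lt => e e0.
have cx : (fun y => C * `|x - y| `^ g) @ nbhs x --> (0 : R).
  have -> : 0 = C * `|x - x| `^ g by rewrite subrr normr0 powR0 ?mulr0// gt_eqF.
  apply: cvgMl_tmp; apply: (@continuous_comp R R R (fun y => x - y) (fun y => `|y| `^ g) x).
    by apply: cvgB; [exact: cvg_cst|exact: cvg_id].
  exact: continuous_norm_powR.
have cxe : \forall y \near x, C * `|x - y| `^ g < e by exact: (cvgr_lt 0 cx e e0).
rewrite near_withinE; apply: filterS cxe => y hy Ay.
by apply: le_lt_trans hy; exact: H.
Qed.

End HoelderContinuity.

Section FractionalOperators.
Context {R : realType}.
Notation mu := (@lebesgue_measure R).
Variables (T p alpha : R).
Hypotheses (T0 : 0 < T) (p1 : 1 < p) (ap : p^-1 < alpha) (a1 : alpha <= 1).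
Implicit Types (s t q : R) (u v w : R -> R).

Let p0 : 0 < p. Proof. exact: lt_trans p1. Qed.
Let pV0 : 0 < p^-1. Proof. by rewrite invr_gt0. Qed.
Let a0 : 0 < alpha. Proof. exact: lt_trans ap. Qed.

(** The Riemann-Liouville integral of order alpha. Its constant 1 /
    Gamma(alpha) is written through the beta function, which is what conv_conv
    produces. *)
Definition fracI w t : R :=
  (if alpha == 1 then 1 else Gamma (1 - alpha) / Beta alpha) * conv alpha w t.

Lemma LpT_RintegrableT q w : 1 < q -> LpT T q w -> Rintegrable setT w.
Proof.
move=> q1 hw; have := Rintegrable_patch (measurable_itv _) (LpT_Rintegrable q1 hw).
congr Rintegrable; apply/funext => s; rewrite patchE; case: ifPn => // /negP sT.
by case: hw => _ -> //; apply/negP => H; apply: sT; rewrite inE.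
Qed.

Lemma LpT_neg q w s : LpT T q w -> s < 0 -> w s = 0.
Proof. by move=> [_ w0 _] s0; apply: w0; rewrite in_itv/= leNgt s0. Qed.

Lemma conv1 w t : conv 1 w t = \int[mu]_(s in `[0, t]) w s.
Proof. by apply: eq_Rintegral => s _; rewrite subrr powRr0 mul1r. Qed.

Lemma eq_conv b u v t : {in `[0, t], u =1 v} -> conv b u t = conv b v t.
Proof. by move=> uv; apply: eq_Rintegral => s; rewrite inE/= => /uv ->. Qed.

Lemma ae_conv b u v t : aeq T u v -> t <= T -> conv b u t = conv b v t.
Proof.
move=> uv tT; apply: ae_Rintegral; apply: ae_impl uv => s h /=; rewrite in_itv/=.
by move=> /andP[s0 st]; rewrite h// in_itv/= s0 (le_trans st).
Qed.

Lemma convZ b (k : R) q w t : 1 < q -> q^-1 < b -> b <= 1 -> LpT T q w -> t <= T ->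
  conv b (fun s => k * w s) t = k * conv b w t.
Proof.
move=> q1 qb b1 hw tT; have i := conv_integrable q1 qb hw tT.
by rewrite /conv -RintegralZl//; apply: eq_Rintegral => s _; rewrite mulrCA.
Qed.

Lemma RLprim_eq u v t : {in `[0, T], u =1 v} -> 0 <= t <= T ->
  RLprim alpha u t = RLprim alpha v t.
Proof.
move=> uv /andP[t0 tT]; rewrite /RLprim; case: ifP => _.
  by rewrite uv// in_itv/= t0.
congr (_ * _); apply: eq_conv => s; rewrite in_itv/= => /andP[s0 st].
by rewrite uv// in_itv/= s0 (le_trans st).
Qed.

(** Abel's inversion formula: the kernels of orders alpha and 1 - alpha
    convolve to a constant. *)
Lemma RLprim_fracI w t : LpT T p w -> 0 <= t <= T ->
  RLprim alpha (fracI w) t = \int[mu]_(s in `[0, t]) w s.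
Proof.
move=> hw /andP[t0 tT]; rewrite /RLprim /fracI.
case: eqVneq => [->|an1]; first by rewrite mul1r conv1.
have al1 : alpha < 1 by rewrite lt_neqAle an1.
set c := Gamma (1 - alpha) / Beta alpha.
have hcw : LpT T p (fun s => c * w s) by apply: LpTZ => //; exact: ltW.
have aE : 1 - (1 - alpha) = alpha by ring.
have hb : 0 < 1 - alpha < 1 by apply/andP; split; move: al1 a0; lra.
have := @conv_conv R (1 - alpha) (fun s => c * w s) t hb (fun s => LpT_neg hcw) (LpT_RintegrableT p1 hcw).
rewrite aE => H; have {}H := H (fun s st => conv_integrable p1 ap hcw (le_trans st tT)).
have -> : RLint (1 - alpha) (fun t => c * conv alpha w t) t =
    (Gamma (1 - alpha))^-1 * conv (1 - alpha) (conv alpha (fun s => c * w s)) t.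
  congr (_ * _); apply: eq_conv => s; rewrite in_itv/= => /andP[s0 st].
  by rewrite (convZ _ p1 ap a1 hw)// (le_trans st).
rewrite H Beta_sym RintegralZl//; last first.
  apply: (@RintegrableS _ setT) => //; exact: LpT_RintegrableT p1 hw.
have G0 : 0 < Gamma (1 - alpha) by apply: Gamma_gt0; apply/andP; split; move: al1 a0; lra.
have B0 : 0 < Beta alpha by apply: Beta_gt0; rewrite a0.
by move: (\int[mu]_(x in _) _) => I; rewrite /c; field; rewrite !gt_eqF.
Qed.

(** The preimage is the integral of w of order 1 - alpha. A bounded function
    is in every L^q, and for q large the kernel of that order satisfies the
    integrability condition as well. *)
Lemma fracI_onto_bounded w (M : R) : measurable_fun setT w -> (forall t, t \notin `[0, T] -> w t = 0) ->
  (forall t, t \in `[0, T] -> `|w t| <= M) ->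
  exists2 v, LpT T p v & forall t, 0 <= t <= T -> fracI v t = \int[mu]_(s in `[0, t]) w s.
Proof.
move=> mw w0 wM.
have [aE|an1] := eqVneq alpha 1.
  exists w; first by apply: LpT_bounded wM _ => //; exact: ltW.
  by move=> t _; rewrite /fracI aE eqxx mul1r conv1.
have al1 : alpha < 1 by rewrite lt_neqAle an1.
have G0 : 0 < Gamma (1 - alpha) by apply: Gamma_gt0; apply/andP; split; move: al1 a0; lra.
have B0 : 0 < Beta alpha by apply: Beta_gt0; rewrite a0.
(* Any q with 1 / q < 1 - alpha would do. *)
pose q := 2 / (1 - alpha).
have q1 : 1 < q by rewrite /q ltr_pdivlMr ?subr_gt0//; move: al1 a0; lra.
have qa : q^-1 < 1 - alpha.
  rewrite /q invfM invrK; move: al1; lra.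
have a1' : 1 - alpha <= 1 by move: a0; lra.
pose c := (Gamma (1 - alpha))^-1.
have hw : LpT T q w by apply: LpT_bounded wM _ => //; move: q1; lra.
have hcw : LpT T q (fun s => c * w s) by apply: LpTZ => //; move: q1; lra.
have [C C0 HC] := conv_hoelder T q1 a1' qa.
pose P := pmass T q (fun s => c * w s) `^ q^-1.
pose v0 t := conv (1 - alpha) (fun s => c * w s) t.
have v0c : {within `[0, T], continuous v0}.
  apply: (@hoelder_within_continuous _ _ (C * P) (1 - alpha - q^-1)); first by rewrite subr_gt0.
  move=> x y; rewrite /= !in_itv/= => /andP[x0 _] /andP[_ yT] xy.
  by rewrite mulrAC; exact: HC.
have mv0 : measurable_fun `[0, T] v0 by exact: subspace_continuous_measurable_fun.
have v0M t : t \in `[0, T] -> `|v0 t| <= C * T `^ (1 - alpha - q^-1) * P.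
  rewrite in_itv/= => /andP[t0 tT]; have := HC _ 0 t hcw (lexx _) t0 tT.
  rewrite conv0 !subr0 => /le_trans; apply; rewrite ler_wpM2r ?powR_ge0//.
  rewrite ler_wpM2l ?(ltW C0)//; apply: ge0_ler_powR; rewrite ?nnegrE ?(ltW T0)//.
  by rewrite subr_ge0 ltW.
have hv : LpT T p (v0 \_ `[0, T]).
  apply: (@LpT_bounded _ _ _ _ (C * T `^ (1 - alpha - q^-1) * P)).
  - by apply/(measurable_restrictT _ _).1.
  - by move=> t /negP tT; rewrite patchE memNset.
  - by move=> t tT; rewrite patchE mem_set// v0M.
  - exact: ltW.
exists (v0 \_ `[0, T]) => // t /andP[t0 tT].
have aE : 1 - (1 - alpha) = alpha by ring.
rewrite /fracI (negbTE an1).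
have -> : conv alpha (v0 \_ `[0, T]) t = conv alpha (conv (1 - alpha) (fun s => c * w s)) t.
  apply: eq_conv => s; rewrite in_itv/= => /andP[s0 st].
  by rewrite patchE mem_set//= in_itv/= s0 (le_trans st).
rewrite conv_conv//.
- rewrite RintegralZl//; last by apply: (@RintegrableS _ setT) => //; exact: LpT_RintegrableT q1 hw.
  by move: (\int[mu]_(x in _) _) => I; rewrite /c; field; rewrite !gt_eqF.
- by rewrite a0.
- by move=> s; exact: LpT_neg hcw.
- exact: LpT_RintegrableT q1 hcw.
- by move=> s st; apply: conv_integrable hcw _ => //; exact: le_trans tT.
Qed.
End FractionalOperators.

Section FractionalDerivative.
Context {R : realType}.
Notation mu := (@lebesgue_measure R).
Variables (T p alpha : R).
Hypotheses (T0 : 0 < T) (p1 : 1 < p) (ap : p^-1 < alpha) (a1 : alpha <= 1).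
Implicit Types (s t q : R) (u v w : R -> R).

Let p0 : 0 < p. Proof. exact: lt_trans p1. Qed.
Let pV0 : 0 < p^-1. Proof. by rewrite invr_gt0. Qed.

Lemma ae_neq (a : R) : {ae mu, forall t, t != a}.
Proof.
exists [set a]; split => //; first exact: lebesgue_measure_set1.
by move=> t /= /negP; rewrite negbK => /eqP.
Qed.

Lemma near_itv_oo t : t \in `]0, T[ -> \forall y \near t, y \in `[0, T].
Proof.
move=> tT; have /= := near_in_itvoo tT; apply: filterS => y.
by apply: subset_itv; rewrite bnd_simp.
Qed.

(** By the Lebesgue differentiation theorem, the primitive of w is
    differentiable almost everywhere with derivative w. *)
Lemma fracD_of_prim u w : LpT T p w ->
  (forall t, 0 <= t <= T -> RLprim alpha u t = \int[mu]_(s in `[0, t]) w s) ->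
  fracD_exists T alpha u /\ aeq T (fracD alpha u) w.
Proof.
move=> hw huw; pose F t := \int[mu]_(s in `[0, t]) w s.
have iw := LpT_RintegrableT p1 hw.
have dF : {ae mu, forall t, 0 < t -> derivable F t 1 /\ derive1 F t = w t}.
  have := @FTC1 R w (BLeft 0) (fun y => RintegrableS measurableT (measurable_itv _) (@subsetT _ _) iw).
  move=> /(_ (open_integrable_locally openT iw)).
  by move=> F0; apply: ae_impl F0 => t h t0; apply: h; rewrite lte_fin.
have eqF t : t \in `]0, T[ -> \forall y \near t, F y = RLprim alpha u y.
  move=> /near_itv_oo; apply: filterS => y yT; rewrite huw//.
have H : {ae mu, forall t, t \in `]0, T[ ->
    derivable (RLprim alpha u) t 1 /\ fracD alpha u t = w t}.
  apply: ae_impl dF => t h tT; have t0 : 0 < t by move: tT; rewrite in_itv/= => /andP[].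
  have [d1 d2] := h t0; have e := eqF _ tT; split.
    exact: near_eq_derivable e d1.
  by rewrite /fracD derive1E -(near_eq_derive _ e) -derive1E.
split; first by apply: ae_impl H => t h /h [].
(* The open interval is extended to [0, T] by discarding the endpoints. *)
have := ae_impl2 (fun t h1 h2 => conj h1 h2) (ae_neq 0) (ae_neq T).
apply: ae_impl2 H => t h [t0 tT] tI; apply: (h _).2.
by move: tI; rewrite !in_itv/= !lt_neqAle eq_sym t0 tT => ->.
Qed.

Lemma fracD_fracI u w : LpT T p w -> {in `[0, T], u =1 fracI alpha w} ->
  fracD_exists T alpha u /\ aeq T (fracD alpha u) w.
Proof.
move=> hw uw; apply: fracD_of_prim => // t tT.
by rewrite (RLprim_eq _ uw tT) (RLprim_fracI p1 ap a1 hw).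
Qed.

Lemma fracI_lin (k : R) v w t : LpT T p v -> LpT T p w -> t <= T ->
  fracI alpha (fun s => k * v s + w s) t = k * fracI alpha v t + fracI alpha w t.
Proof. by move=> hv hw tT; rewrite /fracI (conv_lin p1 ap k hv hw tT); ring. Qed.

Lemma fracIB v w t : LpT T p v -> LpT T p w -> t <= T ->
  fracI alpha (v \- w) t = fracI alpha v t - fracI alpha w t.
Proof.
move=> hv hw tT; have := fracI_lin (-1) hw hv tT.
rewrite (_ : (fun s => _) = v \- w); last by apply/funext => s /=; ring.
by move=> ->; ring.
Qed.

Lemma fracI_0 w : fracI alpha w 0 = 0.
Proof. by rewrite /fracI conv0 mulr0. Qed.

Lemma fracI_hoelder : exists2 C, 0 < C & forall w s t, LpT T p w ->
  0 <= s -> s <= t -> t <= T ->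
  `|fracI alpha w t - fracI alpha w s| <= C * pmass T p w `^ p^-1 * (t - s) `^ (alpha - p^-1).
Proof.
have [C C0 H] := conv_hoelder T p1 a1 ap.
set c := (if alpha == 1 then 1 else Gamma (1 - alpha) / Beta alpha : R).
exists ((`|c| + 1) * C) => [|w s t hw s0 st tT].
  by rewrite mulr_gt0// ltr_wpDl.
rewrite /fracI -/c -mulrBr normrM.
apply: (@le_trans _ _ ((`|c| + 1) * `|conv alpha w t - conv alpha w s|)).
  by rewrite ler_wpM2r// lerDl.
rewrite -!mulrA ler_wpM2l ?addr_ge0//.
by rewrite [_ * (t - s) `^ _]mulrC mulrA; exact: H.
Qed.

Lemma fracI_bounded : exists2 C, 0 < C & forall w t, LpT T p w -> 0 <= t <= T ->
  `|fracI alpha w t| <= C * pmass T p w `^ p^-1.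
Proof.
have [C C0 H] := fracI_hoelder.
exists (C * T `^ (alpha - p^-1)) => [|w t hw /andP[t0 tT]].
  by rewrite mulr_gt0// powR_gt0.
have := H w 0 t hw (lexx _) t0 tT; rewrite fracI_0 !subr0 => /le_trans; apply.
rewrite mulrAC ler_wpM2r ?powR_ge0// ler_wpM2l ?(ltW C0)//.
by apply: ge0_ler_powR; rewrite ?nnegrE ?(ltW T0)// subr_ge0 ltW.
Qed.

Lemma fracI_continuous w : LpT T p w -> {within `[0, T], continuous (fracI alpha w)}.
Proof.
move=> hw; have [C C0 H] := fracI_hoelder.
apply: (@hoelder_within_continuous _ _ (C * pmass T p w `^ p^-1) (alpha - p^-1)).
  by rewrite subr_gt0.
by move=> x y; rewrite /= !in_itv/= => /andP[x0 _] /andP[_ yT] xy; exact: H.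
Qed.

(** Since phi vanishes at 0, it is the primitive of its derivative, which is
    bounded on [0, T]. *)
Lemma C0inf_fracI phi : C0inf T phi ->
  exists2 w, LpT T p w & {in `[0, T], phi =1 fracI alpha w}.
Proof.
move=> [smooth phi0 phiT]; pose d : R -> R := derive1 phi.
have dphi t : derivable phi t 1 by have := smooth 0%N t.
have dd t : derivable d t 1 by have := smooth 1%N t.
have dc : continuous d.
  by move=> t; apply: differentiable_continuous; exact/derivable1_diffP.
have phic : continuous phi.
  by move=> t; apply: differentiable_continuous; exact/derivable1_diffP.
have [c _ cmax] : exists2 c, c \in `[0, T] & forall t, t \in `[0, T] -> `|d t| <= `|d c|.
  apply: (@EVT_max _ (fun t => `|d t|)); first exact: ltW.
  apply: continuous_subspaceT => t.
  by apply: (@continuous_comp R R R d (fun x => `|x|)); [exact: dc|exact: norm_continuous].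
have md : measurable_fun setT d by exact: continuous_measurable_fun.
pose b := d \_ `[0, T].
have mb : measurable_fun setT b.
  by apply/(measurable_restrictT _ _).1 => //; exact: measurable_funTS.
have b0 t : t \notin `[0, T] -> b t = 0.
  by move=> /negP tT; rewrite /b patchE memNset.
have bM t : t \in `[0, T] -> `|b t| <= `|d c|.
  by move=> tT; rewrite /b patchE mem_set// cmax.
have [w hw wE] := fracI_onto_bounded T0 p1 ap a1 mb b0 bM.
exists w => // t; rewrite in_itv/= => tT; rewrite wE//.
have /andP[t0 tT'] := tT.
have -> : \int[mu]_(s in `[0, t]) b s = \int[mu]_(s in `[0, t]) d s.
  apply: eq_Rintegral => s; rewrite inE/= in_itv/= => /andP[s0 st].
  by rewrite /b patchE mem_set//= in_itv/= s0 (le_trans st).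
move: t0; rewrite le_eqVlt => /predU1P[<-|t0].
  by rewrite set_itv1 Rintegral_set1 phi0.
have dc' : {within `[0, t], continuous d} by exact: continuous_subspaceT.
have E : derivable_oo_LRcontinuous phi 0 t.
  split => //; first by apply: cvg_at_right_filter; exact: phic.
  by apply: cvg_at_left_filter; exact: phic.
have := continuous_FTC2 t0 dc' E; rewrite phi0 sube0 => H.
by rewrite /Rintegral H.
Qed.

End FractionalDerivative.

(** * The energy space as a space of derivatives *)

Section PmassZero.
Context {R : realType}.
Notation mu := (@lebesgue_measure R).
Variables (T p : R).
Hypothesis (p0 : 0 < p).
Implicit Types (w : R -> R).

Lemma pmass0 : pmass T p (fun=> 0) = 0.
Proof.
rewrite /pmass (_ : (fun t => _) = cst 0).
  by rewrite /Rintegral integral0.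
by apply/funext => t; rewrite normr0 powR0// gt_eqF.
Qed.

Lemma pmass_eq0 w : LpT T p w -> pmass T p w = 0 -> aeq T w (fun=> 0).
Proof.
move=> [mw w0 iw] h.
have fin : (\int[mu]_(x in `[0%R, T]) (`|w x| `^ p)%:E)%E \is a fin_num.
  exact: integrable_fin_num.
have mf : measurable_fun `[0, T] (fun t => (`|w t| `^ p)%:E).
  by apply/measurable_EFinP; apply: measurable_norm_powR; exact: measurable_funTS.
have := (ae_eq_integral_abs mu (measurable_itv `[0, T]) mf).1.
under eq_integral do rewrite /= ger0_norm ?powR_ge0//.
rewrite -[X in X = _ -> _]fineK// -[fine _]/(pmass T p w) h => /(_ erefl).
apply: ae_impl => t ht /ht [] /powR_eq0_eq0 /eqP.
by rewrite normr_eq0 => /eqP.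
Qed.

End PmassZero.

Section LinearityHelpers.
Context {R : realType}.
Implicit Types (k t : R) (f g : R -> R).

Lemma fracI_cst0 (alpha t : R) : fracI alpha (fun=> 0) t = 0.
Proof.
rewrite /fracI /conv (_ : (fun s => _) = cst 0).
  by rewrite /Rintegral integral0 mulr0.
by apply/funext => s; rewrite mulr0.
Qed.

Lemma derive1_lin k f g t : derivable f t 1 -> derivable g t 1 ->
  derivable (fun t => k * f t + g t) t 1 /\
  derive1 (fun t => k * f t + g t) t = k * derive1 f t + derive1 g t.
Proof.
move=> df dg; have dk : derivable (k \*: f) t 1 by exact: derivableZ.
split; first exact: (derivableD dk dg).
by rewrite !derive1E (deriveD dk dg) deriveZ.
Qed.

Lemma ltr_lin_comb (A K d x y : R) : 0 < A -> 0 <= K -> x < d -> y < d ->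
  A * (K * x + y) < A * (K * d + d).
Proof.
move=> A0 K0 xd yd; rewrite ltr_pM2l//; apply: ler_ltD => //.
by rewrite ler_wpM2l// ltW.
Qed.

End LinearityHelpers.

Opaque pmass fracI.

Section EnergySpace.
Context {R : realType}.
Notation mu := (@lebesgue_measure R).
Variables (T p alpha : R).
Hypotheses (T0 : 0 < T) (p1 : 1 < p) (ap : p^-1 < alpha) (a1 : alpha <= 1).
Implicit Types (s t q : R) (u v w : R -> R).

Let p0 : 0 < p. Proof. exact: lt_trans p1. Qed.
Let pV0 : 0 < p^-1. Proof. by rewrite invr_gt0. Qed.

(** The closed subspace of L^p formed by the fractional derivatives of the
    elements of the energy space; the variational problem is solved there. *)
Definition derivative_space : set (R -> R) := [set w | LpT T p w /\
  forall e : R, 0 < e -> exists phi psi, [/\ C0inf T phi, LpT T p psi,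
    {in `[0, T], phi =1 fracI alpha psi} & pmass T p (w \- psi) < e]].

Lemma derive1n_lin (k : R) (f g : R -> R) n :
  (forall n t, derivable (derive1n n f) t 1) -> (forall n t, derivable (derive1n n g) t 1) ->
  derive1n n (fun t => k * f t + g t) = (fun t => k * derive1n n f t + derive1n n g t).
Proof.
move=> df dg; elim: n => // n IH; rewrite !derive1nS IH; apply/funext => t.
exact: (derive1_lin k (df n t) (dg n t)).2.
Qed.

Lemma C0inf_lin (k : R) (f g : R -> R) : C0inf T f -> C0inf T g ->
  C0inf T (fun t => k * f t + g t).
Proof.
move=> [df f0 fT] [dg g0 gT]; split; last 2 first.
- by rewrite f0 g0 mulr0 addr0.
- by rewrite fT gT mulr0 addr0.
move=> n t; rewrite (derive1n_lin k n df dg); exact: (derive1_lin k (df n t) (dg n t)).1.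
Qed.

Lemma pmass_lin (k : R) v w : LpT T p v -> LpT T p w ->
  pmass T p (fun t => k * v t + w t) <= 2 `^ p * (`|k| `^ p * pmass T p v + pmass T p w).
Proof.
move=> hv hw; have := pmassD (ltW p0) (LpTZ k (ltW p0) hv) hw.
by rewrite pmassZ.
Qed.

Lemma derivative_space_lin (k : R) v w : derivative_space v -> derivative_space w ->
  derivative_space (fun t => k * v t + w t).
Proof.
move=> [hv dv] [hw dw]; split; first exact: LpT_lin (ltW p0) hv hw.
move=> e e0; pose M := 2 `^ p * (`|k| `^ p + 1).
have M0 : 0 < M by rewrite mulr_gt0 ?powR_gt0// ltr_wpDl// powR_ge0.
have [f [x [Cf hx fx vx]]] := dv (e / M) (divr_gt0 e0 M0).
have [g [y [Cg hy gy wy]]] := dw (e / M) (divr_gt0 e0 M0).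
exists (fun t => k * f t + g t), (fun t => k * x t + y t); split.
- exact: C0inf_lin.
- exact: LpT_lin (ltW p0) hx hy.
- move=> t tT; rewrite (fracI_lin p1 ap k hx hy) ?fx ?gy//.
  by move: tT; rewrite in_itv/= => /andP[].
have -> : (fun t => k * v t + w t) \- (fun t => k * x t + y t) =
    (fun t => k * (v \- x) t + (w \- y) t) by apply/funext => t /=; ring.
apply: le_lt_trans (pmass_lin k (LpTB (ltW p0) hv hx) (LpTB (ltW p0) hw hy)) _.
have -> : e = 2 `^ p * (`|k| `^ p * (e / M) + e / M).
  by transitivity (M * (e / M)); [rewrite mulrC divfK ?gt_eqF//|rewrite /M; ring].
by apply: ltr_lin_comb vx wy; rewrite ?powR_gt0 ?powR_ge0.
Qed.

Lemma derivative_space_closed w : LpT T p w ->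
  (forall e : R, 0 < e -> exists2 v, derivative_space v & pmass T p (w \- v) < e) ->
  derivative_space w.
Proof.
move=> hw H; split => // e e0; pose M : R := 2 `^ p * 2.
have M0 : 0 < M by rewrite mulr_gt0 ?powR_gt0.
have [v [hv dv] wv] := H (e / M) (divr_gt0 e0 M0).
have [f [x [Cf hx fx vx]]] := dv (e / M) (divr_gt0 e0 M0).
exists f, x; split => //.
have -> : w \- x = (w \- v) \+ (v \- x) by apply/funext => t /=; ring.
apply: le_lt_trans (pmassD (ltW p0) (LpTB (ltW p0) hw hv) (LpTB (ltW p0) hv hx)) _.
have -> : e = 2 `^ p * (e / M + e / M).
  by rewrite /M; field; rewrite gt_eqF// powR_gt0.
have A0 : 0 < 2 `^ p :> R by rewrite powR_gt0.
by have := ltr_lin_comb A0 ler01 wv vx; rewrite !mul1r.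
Qed.

Lemma derivative_space0 : derivative_space (fun=> 0).
Proof.
split; first exact: LpT0 (ltW p0).
have h0 := LpT0 T (ltW p0).
move=> e e0; exists (fun=> 0), (fun=> 0); split => //.
- split => // n t; rewrite (_ : derive1n n _ = fun=> 0); first exact: derivable_cst.
  by elim: n => // n IH; rewrite derive1nS IH; apply/funext => s; rewrite derive1_cst.
- by move=> t _; rewrite fracI_cst0.
- rewrite (_ : _ \- _ = fun=> 0) ?(pmass0 T p0)//; apply/funext => t /=; exact: subrr.
Qed.

(** The smooth approximants vanish at T, and the value at T is continuous with
    respect to the L^p norm of the derivative. *)
Lemma derivative_space_end w : derivative_space w -> fracI alpha w T = 0.
Proof.
move=> [hw dw]; have [C C0 HC] := fracI_bounded T0 p1 ap a1.
apply/eqP; rewrite -normr_le0; apply/ler_addgt0Pr => e e0; rewrite add0r.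
have [f [x [[_ _ fT] hx fx wx]]] := dw ((e / C) `^ p) (powR_gt0 _ (divr_gt0 e0 C0)).
have TT : T \in `[0, T] by rewrite in_itv/= lexx ltW.
have xT : fracI alpha x T = 0 by rewrite -fx.
have hwx := LpTB (ltW p0) hw hx.
have <- : fracI alpha (w \- x) T = fracI alpha w T.
  by rewrite (fracIB p1 ap hw hx (lexx _)) xT subr0.
apply: le_trans (HC _ T hwx _) _; first by rewrite lexx ltW.
rewrite mulrC -ler_pdivlMr//.
have -> : e / C = ((e / C) `^ p) `^ p^-1.
  by rewrite -powRrM mulfV ?gt_eqF// powRr1// divr_ge0// ltW.
by apply: ge0_ler_powR; rewrite ?nnegrE ?pmass_ge0 ?powR_ge0// ltW.
Qed.

Lemma fracI_patch_LpT q w : 0 <= q -> LpT T p w -> LpT T q (fracI alpha w \_ `[0, T]).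
Proof.
move=> q0 hw; have [C C0 HC] := fracI_bounded T0 p1 ap a1.
apply: (@LpT_bounded _ _ _ _ (C * pmass T p w `^ p^-1)) => //.
- apply/(measurable_restrictT _ _).1 => //.
  apply: subspace_continuous_measurable_fun => //.
  exact: (fracI_continuous p1 ap a1 hw).
- by move=> t /negP tT; rewrite patchE memNset.
- by move=> t tT; rewrite patchE mem_set// HC//; move: tT; rewrite in_itv.
Qed.

Lemma aeq_patch u : aeq T u (u \_ `[0, T]).
Proof. by apply: aeq_on => t tT; rewrite patchE mem_set. Qed.

Lemma pmass_fracI : exists2 C, 0 < C & forall v w, LpT T p v -> LpT T p w ->
  pmass T p ((fracI alpha v \_ `[0, T]) \- (fracI alpha w \_ `[0, T])) <=
  C * pmass T p (v \- w).
Proof.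
have [C C0 HC] := fracI_bounded T0 p1 ap a1.
exists (C `^ p * T) => [|v w hv hw]; first by rewrite mulr_gt0// powR_gt0.
have hvw := LpTB (ltW p0) hv hw.
apply: (@le_trans _ _ ((C * pmass T p (v \- w) `^ p^-1) `^ p * T)).
  apply: pmass_bounded (ltW T0) (ltW p0) _ _.
    by case: (LpTB (ltW p0) (fracI_patch_LpT (ltW p0) hv) (fracI_patch_LpT (ltW p0) hw)).
  move=> t tT /=; rewrite !patchE !mem_set//.
  have /andP[t0 tT'] : 0 <= t <= T by move: tT; rewrite in_itv.
  by rewrite -(fracIB p1 ap hv hw tT') HC// t0.
rewrite powRM ?powR_ge0 ?(ltW C0)// -powRrM mulVf ?gt_eqF// powRr1 ?pmass_ge0//.
by rewrite mulrAC.
Qed.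

End EnergySpace.

Section OrderHelpers.
Context {R : realType}.
Implicit Types (A K d x y z : R).

Lemma ltr_lin_comb2 A K d x y z : 0 < A -> 0 <= K -> z <= K * x -> x < d -> y < d ->
  A * (y + z) < A * (K * d + d).
Proof.
move=> A0 K0 zx xd yd; rewrite ltr_pM2l// addrC; apply: ler_ltD => //.
by rewrite (le_trans zx)// ler_wpM2l// ltW.
Qed.

Lemma ltr_add_ge0 x y d : 0 <= x -> 0 <= y -> x + y < d -> x < d /\ y < d.
Proof. by move=> x0 y0 h; split; apply: le_lt_trans h; rewrite ?lerDl ?lerDr. Qed.

End OrderHelpers.

Section EnergySpaceRepresentation.
Context {R : realType}.
Notation mu := (@lebesgue_measure R).
Variables (T p alpha : R).
Hypotheses (T0 : 0 < T) (p1 : 1 < p) (ap : p^-1 < alpha) (a1 : alpha <= 1).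
Implicit Types (s t q : R) (u v w : R -> R).

Let p0 : 0 < p. Proof. exact: lt_trans p1. Qed.
Let pV0 : 0 < p^-1. Proof. by rewrite invr_gt0. Qed.

Lemma C0inf_rep phi psi : LpT T p psi -> {in `[0, T], phi =1 fracI alpha psi} ->
  aeq T phi (fracI alpha psi \_ `[0, T]) /\ aeq T (fracD alpha phi) psi.
Proof.
move=> hpsi e; split; last exact: (fracD_fracI p1 ap a1 hpsi e).2.
by apply: aeq_on => t tT; rewrite e// patchE mem_set.
Qed.

Lemma aeqB u v u' v' : aeq T u u' -> aeq T v v' -> aeq T (u \- v) (u' \- v').
Proof. exact: (aeq_comp2 (fun x y => x - y)). Qed.

(** The approximants of w are derivatives of smooth functions, and pmass_fracI
    carries the convergence over to the functions themselves. *)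
Lemma E0_intro u w : derivative_space T p alpha w -> fracD_exists T alpha u ->
  aeq T (fracD alpha u) w -> aeq T u (fracI alpha w) -> E0 T p alpha u.
Proof.
move=> [hw dw] du uw uI.
have [C C0 HC] := pmass_fracI T0 p1 ap a1.
have hI : LpT T p (fracI alpha w \_ `[0, T]) by exact: (fracI_patch_LpT T0 p1 ap a1 (ltW p0) hw).
have uI' : aeq T u (fracI alpha w \_ `[0, T]) by apply: aeq_trans uI _; exact: aeq_patch.
split => //.
- exact: (LpT_inLp (ltW p1) hI uI').
- exact: (LpT_inLp (ltW p1) hw uw).
pose e n : R := n.+1%:R^-1.
have /choice[phi Hphi] : forall n, exists phi, exists psi, [/\ C0inf T phi, LpT T p psi,
    {in `[0, T], phi =1 fracI alpha psi} & pmass T p (w \- psi) < e n].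
  by move=> n; apply: dw; rewrite invr_gt0.
exists phi => [k|]; first by have [psi []] := Hphi k.
have gE n : exists r, [/\ graph_norm T p (u \- phi n) (fracD alpha u \- fracD alpha (phi n)) = (r `^ p^-1)%:E,
    0 <= r & r <= (C + 1) * e n].
  have [psi [Cphi hpsi ephi small]] := Hphi n.
  have [aphi adphi] := C0inf_rep hpsi ephi.
  have hIpsi : LpT T p (fracI alpha psi \_ `[0, T]) by exact: (fracI_patch_LpT T0 p1 ap a1 (ltW p0) hpsi).
  exists (pmass T p ((fracI alpha w \_ `[0, T]) \- (fracI alpha psi \_ `[0, T])) + pmass T p (w \- psi)).
  split.
  - apply: graph_norm_pmass => //.
    + exact: LpTB (ltW p0) hI hIpsi.
    + exact: aeqB.
    + exact: LpTB (ltW p0) hw hpsi.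
    + exact: aeqB.
  - by rewrite addr_ge0 ?pmass_ge0.
  - apply: (@le_trans _ _ ((C + 1) * pmass T p (w \- psi))); last first.
      by rewrite ler_wpM2l ?(ltW small)// addr_ge0// ltW.
    by rewrite mulrDl mul1r lerD2r; exact: HC.
have /choice[r Hr] := gE.
have -> : (fun k => graph_norm T p (u \- phi k) (fracD alpha u \- fracD alpha (phi k))) =
    (fun k => (r k `^ p^-1)%:E) by apply/funext => k; have [] := Hr k.
apply: cvg_EFin; first exact: nearW.
have r0 : r @ \oo --> (0 : R).
  apply: (@squeeze_cvgr _ _ _ _ (fun=> 0) (fun n => (C + 1) * e n)).
  - by apply: nearW => n; have [_ -> ->] := Hr n.
  - exact: cvg_cst.
  - by rewrite -[X in _ --> X](mulr0 (C + 1)); apply: cvgMl_tmp; exact: cvg_harmonic.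
have -> : fine \o (fun k => (r k `^ p^-1)%:E) = (fun x : R => `|x| `^ p^-1) \o r.
  by apply/funext => n /=; have [_ h _] := Hr n; rewrite ger0_norm.
have -> : (0 : R) = `|0 : R| `^ p^-1 by rewrite normr0 powR0// gt_eqF.
apply: (@cvg_comp _ _ _ r (fun x : R => `|x| `^ p^-1) _ (nbhs (0 : R))) => //.
exact: continuous_norm_powR.
Qed.

(** The approximants converge together with their derivatives, and fracI is
    continuous, so that the function is recovered from its derivative in the
    limit. *)
Lemma E0_rep u : E0 T p alpha u ->
  exists w, [/\ derivative_space T p alpha w, aeq T (fracD alpha u) w,
    aeq T u (fracI alpha w) & fracD_exists T alpha u].
Proof.
move=> [/(inLpP T u (ltW p1))[u0 hu0 uu0] du /(inLpP T _ (ltW p1))[w hw dw] [phi Cphi cphi]].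
have [C C0 HC] := pmass_fracI T0 p1 ap a1.
have appr (e : R) : 0 < e -> exists phi psi, [/\ C0inf T phi, LpT T p psi,
    {in `[0, T], phi =1 fracI alpha psi}, pmass T p (w \- psi) < e &
    pmass T p (u0 \- (fracI alpha psi \_ `[0, T])) < e].
  move=> e0.
  have h0 : 0 < (e `^ p^-1) by rewrite powR_gt0.
  have [N _ HN] : \forall k \near \oo, (graph_norm T p (u \- phi k)%R (fracD alpha u \- fracD alpha (phi k))%R < (e `^ p^-1)%:E)%E.
    exact: (cphi _ (@nbhs_open_ereal_lt R 0 (fun=> e `^ p^-1) h0)).
  have {}HN := HN N (leqnn N).
  have [psi hpsi ephi] := C0inf_fracI T0 p1 ap a1 (Cphi N).
  have [aphi adphi] := C0inf_rep hpsi ephi.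
  have hIpsi : LpT T p (fracI alpha psi \_ `[0, T]) by exact: (fracI_patch_LpT T0 p1 ap a1 (ltW p0) hpsi).
  have E := graph_norm_pmass p0 (LpTB (ltW p0) hu0 hIpsi) (aeqB uu0 aphi) (LpTB (ltW p0) hw hpsi) (aeqB dw adphi).
  move: HN; rewrite /= E lte_fin => HN.
  have {}HN : pmass T p (u0 \- (fracI alpha psi \_ `[0, T])) + pmass T p (w \- psi) < e.
    rewrite ltNge; apply/negP => H; move: HN; rewrite ltNge => /negP; apply.
    by apply: ge0_ler_powR; rewrite ?nnegrE ?addr_ge0 ?pmass_ge0 ?(ltW e0) ?(ltW pV0).
  have [m1 m2] := ltr_add_ge0 (pmass_ge0 _ _ _) (pmass_ge0 _ _ _) HN.
  by exists (phi N), psi; split; [exact: Cphi|exact: hpsi|exact: ephi|exact: m2|exact: m1].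
have hW : derivative_space T p alpha w.
  split => // e e0; have [f [psi [cf hpsi ef h1 h2]]] := appr e e0.
  by exists f, psi.
exists w; split => //.
have hI : LpT T p (fracI alpha w \_ `[0, T]) by exact: (fracI_patch_LpT T0 p1 ap a1 (ltW p0) hw).
have hd := LpTB (ltW p0) hu0 hI.
have z : pmass T p (u0 \- (fracI alpha w \_ `[0, T])) = 0.
  apply/eqP; rewrite eq_le pmass_ge0 andbT; apply/ler_addgt0Pr => e e0; rewrite add0r.
  pose M := 2 `^ p * (C + 1).
  have M0 : 0 < M by rewrite mulr_gt0 ?powR_gt0// ltr_wpDl// ltW.
  have [f [psi [cf hpsi ef h1 h2]]] := appr (e / M) (divr_gt0 e0 M0).
  have hIpsi : LpT T p (fracI alpha psi \_ `[0, T]) by exact: (fracI_patch_LpT T0 p1 ap a1 (ltW p0) hpsi).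
  have -> : u0 \- (fracI alpha w \_ `[0, T]) = (u0 \- (fracI alpha psi \_ `[0, T])) \+
      ((fracI alpha psi \_ `[0, T]) \- (fracI alpha w \_ `[0, T])).
    by apply/funext => t /=; rewrite addrA subrK.
  apply: le_trans (pmassD (ltW p0) (LpTB (ltW p0) hu0 hIpsi) (LpTB (ltW p0) hIpsi hI)) _.
  have h3 := HC psi w hpsi hw; rewrite pmassBC in h1.
  have A0 : 0 < 2 `^ p :> R by rewrite powR_gt0.
  have -> : e = 2 `^ p * (C * (e / M) + e / M).
    by transitivity (M * (e / M)); [rewrite mulrC divfK ?gt_eqF//|rewrite /M; ring].
  by apply: ltW; exact: (ltr_lin_comb2 A0 (ltW C0) h3 h1 h2).
have := pmass_eq0 hd z; apply: ae_impl2 uu0 => t h1 h2 tT.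
by rewrite h1//; move: (h2 tT) => /= /eqP; rewrite subr_eq0 => /eqP ->; rewrite patchE mem_set.
Qed.

Lemma derivable_near_lin (k : R) (f g h : R -> R) t :
  (\forall y \near t, k * f y + g y = h y) -> derivable f t 1 -> derivable g t 1 ->
  derivable h t 1 /\ derive1 h t = k * derive1 f t + derive1 g t.
Proof.
move=> e df dg; have [d1 d2] := derive1_lin k df dg; split.
  exact: near_eq_derivable e d1.
by rewrite -d2 !derive1E (near_eq_derive _ e).
Qed.

(** Integrals of arbitrary functions are not additive; here u and v are almost
    everywhere equal to bounded functions, hence in an L^q for which the
    kernel of order 1 - alpha is integrable. *)
Lemma RLprim_lin (k : R) u v w z t : LpT T p w -> LpT T p z ->
  aeq T u (fracI alpha w) -> aeq T v (fracI alpha z) -> t \in `[0, T] ->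
  RLprim alpha (fun s => k * u s + v s) t = k * RLprim alpha u t + RLprim alpha v t.
Proof.
move=> hw hz uw vz; rewrite in_itv/= => /andP[t0 tT]; rewrite /RLprim; case: eqVneq => // an1.
have al1 : alpha < 1 by rewrite lt_neqAle an1.
have a0 : 0 < alpha by exact: lt_trans ap.
pose q := 2 / (1 - alpha).
have q1 : 1 < q by rewrite /q ltr_pdivlMr ?subr_gt0//; move: al1 a0; lra.
have qa : q^-1 < 1 - alpha.
  rewrite /q invfM invrK; move: al1; lra.
have q0 : 0 <= q by apply: ltW; exact: lt_trans q1.
have hw' := fracI_patch_LpT T0 p1 ap a1 q0 hw; have hz' := fracI_patch_LpT T0 p1 ap a1 q0 hz.
have uw' : aeq T u (fracI alpha w \_ `[0, T]) by apply: aeq_trans uw _; exact: aeq_patch.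
have vz' : aeq T v (fracI alpha z \_ `[0, T]) by apply: aeq_trans vz _; exact: aeq_patch.
rewrite /RLint -!/(conv _ _ _) (ae_conv _ uw' tT) (ae_conv _ vz' tT).
rewrite (ae_conv _ (aeq_comp2 (fun x y => k * x + y) uw' vz') tT).
by rewrite (conv_lin q1 qa k hw' hz' tT) mulrDr mulrCA.
Qed.

Lemma E0_lin (k : R) u v w z : E0 T p alpha u -> E0 T p alpha v ->
  derivative_space T p alpha w -> derivative_space T p alpha z ->
  aeq T (fracD alpha u) w -> aeq T u (fracI alpha w) ->
  aeq T (fracD alpha v) z -> aeq T v (fracI alpha z) ->
  [/\ E0 T p alpha (fun t => k * u t + v t),
      aeq T (fracD alpha (fun t => k * u t + v t)) (fun t => k * w t + z t) &
      aeq T (fun t => k * u t + v t) (fracI alpha (fun t => k * w t + z t))].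
Proof.
move=> Eu Ev Ww Wz Duw uw Dvz vz.
have [_ du _ _] := Eu; have [_ dv _ _] := Ev.
have [hw _] := Ww; have [hz _] := Wz.
have key : {ae mu, forall t, t \in `]0, T[ ->
    derivable (RLprim alpha (fun t => k * u t + v t)) t 1 /\
    fracD alpha (fun t => k * u t + v t) t = k * fracD alpha u t + fracD alpha v t}.
  apply: ae_impl2 dv du => t h1 h2 tT; have dv' := h1 tT; have du' := h2 tT.
  apply: derivable_near_lin du' dv'; have := near_itv_oo tT; apply: filterS => y yT.
  by rewrite (RLprim_lin k hw hz uw vz yT).
have aI : aeq T (fun t => k * u t + v t) (fracI alpha (fun t => k * w t + z t)).
  apply: aeq_trans (aeq_comp2 (fun x y => k * x + y) uw vz) _.
  apply: aeq_on => t; rewrite in_itv/= => /andP[_ tT].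
  by rewrite (fracI_lin p1 ap k hw hz tT).
have aD : aeq T (fracD alpha (fun t => k * u t + v t)) (fun t => k * w t + z t).
  apply: aeq_trans (aeq_comp2 (fun x y => k * x + y) Duw Dvz).
  have := ae_impl2 (fun t h1 h2 => conj h1 h2) (ae_neq 0) (ae_neq T).
  apply: ae_impl2 key => t h [t0 tT] tI; apply: (h _).2.
  by move: tI; rewrite !in_itv/= !lt_neqAle eq_sym t0 tT => ->.
have dE : fracD_exists T alpha (fun t => k * u t + v t).
  by apply: ae_impl key => t h /h [].
have hW := derivative_space_lin p1 ap k Ww Wz.
split; [exact: (E0_intro hW dE aD aI)|exact: aD|exact: aI].
Qed.

End EnergySpaceRepresentation.

Transparent pmass fracI.

(** * Families uniformly continuous on slabs, and their primitives *)

Section CompactBound.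
Context {R : realType}.

Lemma within_continuous_bounded (X : topologicalType) (K : set X) (g : X -> R) :
  compact K -> {within K, continuous g} ->
  exists2 M, 0 <= M & forall x, K x -> `|g x| <= M.
Proof.
move=> cK gc; have cc : compact [set g x | x in K] := continuous_compact gc cK.
have [B0 [_ HB0]] := @compact_bounded R R^o _ cc.
have HB := HB0 (B0 + 1) (ltr_pwDr ltr01 (lexx _)).
by exists `|B0 + 1| => // x Kx; apply: le_trans (ler_norm _); apply: HB; exists x.
Qed.

End CompactBound.

Section UniformlyContinuousFamilies.
Context {R : realType}.
Notation mu := (@lebesgue_measure R).
Variable (T : R).
Hypothesis (T0 : 0 < T).
Implicit Types (t x y M e : R) (u : R -> R) (f G : R -> R -> R).

Definition ucont_slabs G : Prop := forall M e, 0 < e -> exists2 d : R, 0 < d &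
  forall t t' x x', t \in `[0, T] -> t' \in `[0, T] -> `|x| <= M -> `|x'| <= M ->
    `|t - t'| < d -> `|x - x'| < d -> `|G t x - G t' x'| < e.

(** Compactness of the slab, in the following form: a property that holds near
    each of its points for all small d holds on the whole slab for some d. *)
Lemma within_ucont G :
  {within `[0, T] `*` [set: R], continuous (fun z : R * R => G z.1 z.2)} -> ucont_slabs G.
Proof.
move=> /subspace_continuousP Gc M e e0.
pose K : set (R * R) := `[0, T]%classic `*` `[- M, M]%classic.
have cK : compact K by apply: compact_setX; exact: segment_compact.
pose P (d : R) (z : R * R) := z.1 \in `[0, T] -> forall t' x', t' \in `[0, T] ->
  `|z.1 - t'| < d -> `|z.2 - x'| < d -> `|G z.1 z.2 - G t' x'| < e.
have NC := (compact_near_coveringP K).1 cK.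
have : \forall d \near (0 : R)^'+, K `<=` P d.
  apply: NC => -[t0 x0] [/= t0T x0M].
  have e2 : 0 < e / 2 by rewrite divr_gt0.
  have := Gc (t0, x0) (conj t0T I).
  move=> /cvgrPdist_lt /(_ _ e2); rewrite near_withinE => -[[A1 A2] /= [n1 n2] HA].
  have [r [r0 Hr]] : exists r : R, 0 < r /\ forall t x, t \in `[0, T] ->
      `|t0 - t| < r -> `|x0 - x| < r -> `|G t0 x0 - G t x| < e / 2.
    have /nbhs_ballP[r1 /= r10 H1] := n1; have /nbhs_ballP[r2 /= r20 H2] := n2.
    exists (Num.min r1 r2); split; first by rewrite lt_min r10.
    move=> t x tT; rewrite !lt_min => /andP[h1 _] /andP[_ h2].
    by apply: (HA (t, x)) => //; split; [exact: H1|exact: H2].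
  have r2 : 0 < r / 2 by rewrite divr_gt0.
  exists (ball (t0, x0) (r / 2), [set d | 0 < d < r / 2]) => /=.
    split; first exact: nbhsx_ballx.
    have := nbhs_right_lt r2; have := nbhs_right_gt (0 : R).
    by apply: filterS2 => d /= -> ->.
  move=> [[t x] d] /= [[ht hx] /andP[d0 dr]] tT t' x' t'T htt hxx.
  rewrite /ball /= in ht hx.
  have H1 : `|G t0 x0 - G t x| < e / 2.
    by apply: Hr => //; [apply: lt_le_trans ht _|apply: lt_le_trans hx _]; rewrite ler_pdivrMr// mulr2n mulrDr mulr1 lerDl ltW.
  have H2 : `|G t0 x0 - G t' x'| < e / 2.
    apply: Hr => //.
      rewrite (_ : t0 - t' = (t0 - t) + (t - t')); last ring.
      by rewrite (le_lt_trans (ler_normD _ _))// [ltRHS](splitr r) ltrD// (lt_trans htt).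
    rewrite (_ : x0 - x' = (x0 - x) + (x - x')); last ring.
    by rewrite (le_lt_trans (ler_normD _ _))// [ltRHS](splitr r) ltrD// (lt_trans hxx).
  rewrite (_ : _ - _ = (G t0 x0 - G t' x') - (G t0 x0 - G t x)); last ring.
  by rewrite (le_lt_trans (ler_normB _ _))// [ltRHS](splitr e) ltrD.
move=> H.
have [d [d0 Hd]] : exists d, 0 < d /\ K `<=` P d.
  by have [d [? ?]] := filter_ex (filterI (nbhs_right_gt (0 : R)) H); exists d.
exists d => // t t' x x' tT t'T xM x'M tt xx.
by apply: (Hd (t, x)) => //; split => //=; rewrite in_itv/= -ler_norml.
Qed.

Lemma within_slab_bounded G :
  {within `[0, T] `*` [set: R], continuous (fun z : R * R => G z.1 z.2)} ->
  forall M, exists B, forall t x, t \in `[0, T] -> `|x| <= M -> `|G t x| <= B.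
Proof.
move=> Gc M; pose K : set (R * R) := `[0, T]%classic `*` `[- M, M]%classic.
have cK : compact K by apply: compact_setX; exact: segment_compact.
have Kc : {within K, continuous (fun z : R * R => G z.1 z.2)}.
  by apply: continuous_subspaceW Gc => z [].
have [B _ HB] := within_continuous_bounded cK Kc.
exists B => t x tT xM; apply: (HB (t, x)); split => //=.
by rewrite in_itv/= -ler_norml.
Qed.

Lemma ucont_slice G t : ucont_slabs G -> t \in `[0, T] -> continuous (G t).
Proof.
move=> uG tT x; apply/cvgrPdist_lt => e e0.
have [d d0 H] := uG (`|x| + 1) e e0.
near=> y; apply: H => //.
- by rewrite lerDl.
- have : `|x - y| < 1 by near: y; exact: cvgr_dist_lt.
  move=> h; rewrite (_ : y = x - (x - y)); last ring.
  by rewrite (le_trans (ler_normB _ _))// lerD2l ltW.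
- by rewrite subrr normr0.
Unshelve. all: by end_near.
Qed.

Lemma ucont_comp G u : ucont_slabs G -> {within `[0, T], continuous u} ->
  {within `[0, T], continuous (fun t => G t (u t))}.
Proof.
move=> uG uc.
have [M _ HM] := within_continuous_bounded (@segment_compact _ 0 T) uc.
apply/subspace_continuousP => t /= tT; apply/cvgrPdist_lt => e e0.
have [d d0 H] := uG M e e0.
have /subspace_continuousP/(_ t tT)/cvgrPdist_lt/(_ d d0) := uc.
rewrite !near_withinE => h.
have h2 : \forall s \near t, `|t - s| < d by exact: (@nbhsx_ballx R R t d d0).
move: h h2; apply: filterS2 => s h h2 sT.
by apply: H => //; [exact: HM|exact: HM|exact: h].
Qed.

Lemma ucont_Rintegrable G u : ucont_slabs G -> {within `[0, T], continuous u} ->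
  Rintegrable `[0, T] (fun t => G t (u t)).
Proof.
by move=> uG uc; apply: continuous_compact_integrable; [exact: segment_compact|exact: ucont_comp].
Qed.

(** The base point is moved to the left of all points involved, so that the
    fundamental theorem of calculus applies on both sides of 0. *)
Lemma primitive_sub f t a y : continuous (f t) -> a < 0 -> a <= y ->
  primitive f t y = \int[mu]_(s in `[a, y]) f t s - \int[mu]_(s in `[a, 0]) f t s.
Proof.
move=> fc a0 ay.
have ii b c : Rintegrable `[b, c] (f t).
  apply: continuous_compact_integrable; first exact: segment_compact.
  exact: continuous_subspaceT.
have oc b c : Rintegrable `]b, c] (f t).
  by apply: RintegrableS (ii b c) => //; apply: subset_itv; rewrite bnd_simp.
rewrite /primitive; case: ifPn => y0.
  rewrite (Rintegral_itvB (ii a y)) ?bnd_simp ?(ltW a0)//.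
  by rewrite Rintegral_itv_obnd_cbnd//; exact: oc.
rewrite -ltNge in y0; rewrite -opprB.
rewrite (Rintegral_itvB (ii a 0)) ?bnd_simp ?(ltW y0)//.
by rewrite Rintegral_itv_obnd_cbnd//; exact: oc.
Qed.

Lemma primitive0 f t : primitive f t 0 = 0.
Proof. by rewrite /primitive lexx set_itv1 Rintegral_set1. Qed.

Lemma is_derive_primitive f t x : continuous (f t) -> is_derive x 1 (primitive f t) (f t x).
Proof.
move=> fc; pose a := - (`|x| + 1).
have ax : a < x by rewrite /a ltrNl (le_lt_trans (ler_norm _))// normrN ltrDl.
have a0 : a < 0 by rewrite /a oppr_lt0 ltr_wpDl.
have ii b c : Rintegrable `[b, c] (f t).
  apply: continuous_compact_integrable; first exact: segment_compact.
  exact: continuous_subspaceT.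
have xx1 : x < x + 1 by rewrite ltrDl.
pose F y := \int[mu]_(s in `[a, y]) f t s; pose K := \int[mu]_(s in `[a, 0]) f t s.
have E y : a <= y -> primitive f t y = F y - K by exact: primitive_sub.
have [d1 d2] : derivable F x 1 /\ derive1 F x = f t x.
  exact: continuous_FTC1_closed xx1 (ii a (x + 1)) ax (fc x).
move: F K => F K in E d1 d2 *.
have e : \forall y \near x, 1 * F y + (fun=> - K) y = primitive f t y.
  by have := lt_le_nbhsr ax; apply: filterS => y ay; rewrite E// mul1r.
have [h1 h2] := derivable_near_lin e d1 (@derivable_cst _ _ _ (- K) x 1).
by apply: DeriveDef => //; rewrite -derive1E h2 d2 derive1_cst mul1r addr0.
Qed.

Lemma mean_value (h h' : R -> R) x y : (forall z : R, is_derive z 1 h (h' z)) ->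
  exists z, [/\ `|z - x| <= `|y - x|, `|z| <= Num.max `|x| `|y| & h y - h x = h' z * (y - x)].
Proof.
move=> dh; have hc a b : {within `[a, b], continuous h}.
  apply: continuous_subspaceT => z; apply: differentiable_continuous.
  by apply/derivable1_diffP; exact: ex_derive.
case: (leP x y) => xy.
- have [z] := MVT_segment xy (fun z _ => dh z) (hc x y).
  rewrite in_itv/= => /andP[xz zy] E; exists z; split => //.
  + by rewrite !ger0_norm ?subr_ge0// lerD2r.
  + case: (ltrP z 0) => z0; rewrite le_max.
    * by rewrite (ltr0_norm z0) (ltr0_norm (le_lt_trans xz z0)) lerN2 xz.
    * by rewrite (ger0_norm z0) (ger0_norm (le_trans z0 zy)) zy orbT.
- have [z] := MVT_segment (ltW xy) (fun z _ => dh z) (hc y x).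
  rewrite in_itv/= => /andP[xz zy] E; exists z; split => //.
  + by rewrite !ler0_norm ?subr_le0 ?(ltW xy)// lerN2 lerD2r.
  + case: (ltrP z 0) => z0; rewrite le_max.
    * by rewrite (ltr0_norm z0) (ltr0_norm (le_lt_trans xz z0)) lerN2 xz orbT.
    * by rewrite (ger0_norm z0) (ger0_norm (le_trans z0 zy)) zy.
  + by rewrite -opprB E -mulrN opprB.
Qed.

(** In x the primitive is Lipschitz, f being bounded on the slab; in t the
    mean value theorem is applied to a difference of two primitives, which
    vanishes at x = 0. *)
Lemma ucont_primitive f :
  {within `[0, T] `*` [set: R], continuous (fun z : R * R => f z.1 z.2)} -> ucont_slabs (primitive f).
Proof.
move=> fc; have uf := within_ucont fc; move=> M e e0.
have [B HB] := within_slab_bounded fc `|M|.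
pose B' := `|B| + 1; have B'0 : 0 < B' by rewrite /B' ltr_wpDl.
pose M' := `|M| + 1; have M'0 : 0 < M' by rewrite /M' ltr_wpDl.
have e2 : 0 < e / 2 by rewrite divr_gt0.
have [d d0 Hd] := uf `|M| (e / 2 / M') (divr_gt0 e2 M'0).
exists (Num.min d (e / 2 / B')); first by rewrite lt_min d0 !divr_gt0.
move=> t t' x x' tT t'T xM x'M; rewrite !lt_min => /andP[tt _] /andP[_ xx].
have {}xM := le_trans xM (ler_norm M); have {}x'M := le_trans x'M (ler_norm M).
rewrite (_ : _ - _ = (primitive f t x - primitive f t x') +
  (primitive f t x' - primitive f t' x')); last by rewrite addrA subrK.
rewrite (le_lt_trans (ler_normD _ _))// [ltRHS](splitr e); apply: ltr_leD.
- have [z [_ zM ->]] := mean_value x' x (fun z => is_derive_primitive z (ucont_slice uf tT)).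
  have {}zM : `|z| <= `|M| by rewrite (le_trans zM)// ge_max xM x'M.
  rewrite normrM; apply: (@le_lt_trans _ _ (B' * `|x - x'|)).
    by rewrite ler_wpM2r// (le_trans (HB _ _ tT zM))// (le_trans (ler_norm _))// lerDl.
  by rewrite mulrC -ltr_pdivlMr.
- have dd (z : R) : is_derive z 1 (primitive f t \- primitive f t') (f t z - f t' z).
    by apply: is_deriveB; apply: is_derive_primitive; exact: (ucont_slice uf).
  have [z [_ zM]] := mean_value 0 x' dd.
  rewrite /= !primitive0 subrr !subr0 => ->.
  have {}zM : `|z| <= `|M| by rewrite (le_trans zM)// ge_max normr0 normr_ge0.
  rewrite normrM; apply: (@le_trans _ _ (e / 2 / M' * M')); last by rewrite divfK ?gt_eqF.
  apply: ler_pM => //; last by rewrite (le_trans x'M)// lerDl.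
  by apply: ltW; apply: Hd => //; rewrite subrr normr0.
Qed.

Lemma primitive_first_order f : ucont_slabs f -> forall M e, 0 < e -> exists2 d, 0 < d &
  forall t x h, t \in `[0, T] -> `|x| <= M -> `|h| < d ->
    `|primitive f t (x + h) - primitive f t x - f t x * h| <= e * `|h|.
Proof.
move=> uf M e e0; have [d d0 Hd] := uf (M + 1) e e0.
exists (Num.min d 1); first by rewrite lt_min d0 ltr01.
move=> t x h tT xM; rewrite lt_min => /andP[hd h1].
have [z []] := mean_value x (x + h) (fun z => is_derive_primitive z (ucont_slice uf tT)).
rewrite (_ : x + h - x = h); last ring.
move=> zx zM ->; rewrite -mulrBl normrM ler_wpM2r//.
have hx : `|x + h| <= M + 1 by rewrite (le_trans (ler_normD _ _))// lerD// ltW.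
have xM1 : `|x| <= M + 1 by rewrite (le_trans xM)// lerDl.
apply: ltW; apply: Hd => //.
- by rewrite (le_trans zM)// ge_max xM1 hx.
- by rewrite subrr normr0.
- exact: le_lt_trans hd.
Qed.

Lemma primitive_growth f t x r A : continuous (f t) -> 1 < r -> 0 <= A ->
  (forall y, `|f t y| <= A * `|y| `^ (r - 1)) -> `|primitive f t x| <= A * `|x| `^ r.
Proof.
move=> fc r1 A0 H; have [z []] := mean_value 0 x (fun z => is_derive_primitive z fc).
rewrite primitive0 !subr0 => zx _ ->; rewrite normrM.
apply: (@le_trans _ _ (A * `|x| `^ (r - 1) * `|x|)).
  rewrite ler_wpM2r// (le_trans (H z))// ler_wpM2l// ge0_ler_powR ?nnegrE// subr_ge0 ltW//.
rewrite -mulrA ler_wpM2l//; have [->|x0] := eqVneq x 0; first by rewrite normr0 mulr0 powR_ge0.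
by rewrite -{2}(powRr1 (normr_ge0 x)) -powRD ?subrK ?normr_eq0 ?x0 ?implybT.
Qed.

End UniformlyContinuousFamilies.

(** * Smooth bump functions *)

Section SmoothBump.
Context {R : realType}.
Implicit Types (s t C a : R) (h : R -> R) (Q : {poly R}).

Lemma is_derive_flat h a C : h a = 0 -> (forall s, `|h s| <= C * (s - a) ^+ 2) ->
  is_derive a 1 h 0.
Proof.
move=> ha H.
have cv : (s^-1 *: ((h \o shift a) (s *: 1) - h a)) @[s --> 0^'] --> (0 : R).
  apply/cvgr0Pnorm_le => e e0.
  have C0 : 0 < `|C| + 1 by rewrite ltr_wpDl.
  near=> s.
  have s0 : s != 0 by near: s; exact: nbhs_dnbhs_neq.
  rewrite ha subr0 /= /GRing.scale/= mulr1 normrM normfV ler_pdivrMl ?normr_gt0//.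
  rewrite (le_trans (H _))// addrK -real_normK ?num_real// expr2 mulrA mulrC.
  rewrite ler_wpM2l//.
  apply: (@le_trans _ _ ((`|C| + 1) * `|s|)).
    by rewrite ler_wpM2r// (le_trans (ler_norm _))// lerDl.
  rewrite mulrC -ler_pdivlMr//.
  by near: s; apply: dnbhs0_le; rewrite divr_gt0.
apply: DeriveDef; first by apply/cvg_ex; exists 0.
exact: (cvg_lim _ cv).
Unshelve. all: by end_near.
Qed.

Lemma expR_ge_pow (x : R) n : 0 <= x -> x ^+ n.+1 <= (n.+1)`!%:R * expR x.
Proof.
move=> x0; rewrite mulrC -ler_pdivrMr ?ltr0n ?fact_gt0//.
by apply: le_trans (expR_ge1Dxn n x0); rewrite lerDr.
Qed.

Variables (c d : R).
Hypothesis cd : c < d.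

Let q : {poly R} := ('X - c%:P) * (d%:P - 'X).

Let qE t : q.[t] = (t - c) * (d - t).
Proof. by rewrite /q !hornerE. Qed.

Let q_gt0 t : c < t < d -> 0 < q.[t].
Proof. by move=> /andP[ct td]; rewrite qE mulr_gt0// subr_gt0. Qed.

(** The functions exp (- 1 / q) q^-n Q on ]c, d[ extended by 0, where q = (t -
    c) (d - t): this family is stable under derivation, whence the smoothness
    of exp (- 1 / q). *)
Definition bump n Q t : R :=
  if c < t < d then expR (- (q.[t])^-1) * (q.[t])^-1 ^+ n * Q.[t] else 0.

Definition dbump n Q : {poly R} := deriv q * Q - n%:R *: (deriv q * q * Q) + q ^+ 2 * deriv Q.

(** The bound x^m <= m! exp x at x = 1 / q cancels the negative powers of q
    and leaves q^2, and q is at most (d - c) |t - a| at either endpoint a. *)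
Lemma bump_flat n Q : exists C, forall t a, a = c \/ a = d ->
  `|bump n Q t| <= C * (t - a) ^+ 2.
Proof.
have [B HB] : exists B, forall t, c <= t <= d -> `|Q.[t]| <= B.
  have Qc : {within `[c, d], continuous (horner Q)}.
    by apply: continuous_subspaceT; exact: continuous_horner.
  have [B _ HB] := within_continuous_bounded (@segment_compact _ c d) Qc.
  by exists B => t tcd; apply: HB; rewrite /= in_itv.
pose F : R := (n.+2)`!%:R; have F0 : 0 <= F by [].
exists (F * (d - c) ^+ 2 * `|B|) => t a aE; rewrite /bump; case: ifPn => tcd; last first.
  by rewrite normr0 (mulr_ge0 (mulr_ge0 (mulr_ge0 F0 (sqr_ge0 _)) (normr_ge0 _)) (sqr_ge0 _)).
have q0 := q_gt0 tcd; have /andP[ct td] := tcd.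
have Q1 : `|Q.[t]| <= `|B| by rewrite (le_trans (HB t _))// ?ler_norm ?(ltW ct) ?ltW.
have E1 : expR (- q.[t]^-1) * q.[t]^-1 ^+ n <= F * q.[t] ^+ 2.
  have V0 : 0 <= q.[t]^-1 by rewrite invr_ge0 ltW.
  have := expR_ge_pow n.+1 V0; rewrite -/F => h.
  rewrite expRN mulrC ler_pdivrMr ?expR_gt0//.
  have -> : q.[t]^-1 ^+ n = q.[t] ^+ 2 * q.[t]^-1 ^+ n.+2.
    by rewrite -(addn2 n) exprD mulrCA -exprMn divff ?gt_eqF// expr1n mulr1.
  by rewrite [leRHS]mulrAC [leRHS]mulrC; apply: ler_wpM2l h; exact: sqr_ge0.
have q2 : q.[t] ^+ 2 <= (d - c) ^+ 2 * (t - a) ^+ 2.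
  rewrite qE exprMn.
  case: aE => ->.
    rewrite mulrC ler_wpM2r ?sqr_ge0// ler_sqr ?nnegrE ?subr_ge0 ?(ltW ct) ?(ltW td) ?(ltW cd)//.
    by rewrite lerD2l lerN2 ltW.
  rewrite -[X in _ <= _ * X]sqrrN opprB ler_wpM2r ?sqr_ge0//.
  by rewrite ler_sqr ?nnegrE ?subr_ge0 ?(ltW ct) ?(ltW td) ?(ltW cd)// lerD2r ltW.
rewrite normrM [X in X * _]ger0_norm; last by rewrite mulr_ge0 ?expR_ge0// exprn_ge0// invr_ge0 ltW.
rewrite (_ : F * _ * _ * _ = (F * ((d - c) ^+ 2 * (t - a) ^+ 2)) * `|B|); last ring.
apply: ler_pM => //; first by rewrite mulr_ge0 ?expR_ge0// exprn_ge0// invr_ge0 ltW.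
by rewrite (le_trans E1)// ler_wpM2l.
Qed.

Lemma is_derive_near (h g : R -> R) t l : (\forall s \near t, h s = g s) ->
  is_derive t 1 h l -> is_derive t 1 g l.
Proof.
move=> e dh; apply: DeriveDef.
  by apply: (near_eq_derivable e); exact: ex_derive.
by rewrite -(near_eq_derive _ e) derive_val.
Qed.

Lemma bump_algebra (E x x' y y' : R) n : x != 0 ->
  E * x^-1 ^+ n * y' + y * (E * (n%:R * x^-1 ^+ n.-1 * (- x ^- 2 * x')) +
    x^-1 ^+ n * (E * - (- x ^- 2 * x'))) =
  E * x^-1 ^+ n.+2 * (x' * y - n%:R * (x' * (x * y)) + x ^+ 2 * y').
Proof.
move=> x0; case: n => [|n] /=; first by rewrite !expr0 mul0r mul0r; field.
rewrite !(exprSr _ n.+2) !(exprSr _ n.+1) !(exprSr _ n); move: (_ ^+ n) => z; by field.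
Qed.

Lemma bump_derive n Q t : is_derive t 1 (bump n Q) (bump n.+2 (dbump n Q) t).
Proof.
have out a : a = c \/ a = d -> is_derive a 1 (bump n Q) (bump n.+2 (dbump n Q) a).
  move=> aE; have [C HC] := bump_flat n Q.
  have z m P : bump m P a = 0 by rewrite /bump; case: aE => ->; rewrite ltxx ?andbF.
  by rewrite z; apply: is_derive_flat (z _ _) (fun s => HC s a aE).
case: (ltgtP t c) => tc; last by apply: out; left.
  rewrite {2}/bump (_ : c < t < d = false); last by rewrite ltNge (ltW tc).
  apply: (is_derive_near _ (is_derive_cst (0 : R) t (1 : R))).
  by have := lt_nbhsl tc; apply: filterS => s sc; rewrite /bump ltNge (ltW sc).
case: (ltgtP t d) => td; last by apply: out; right.
  rewrite {2}/bump tc td/=.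
  apply: (@is_derive_near (fun s => expR (- (q.[s])^-1) * (q.[s])^-1 ^+ n * Q.[s])).
    have h1 := lt_nbhsr tc; have h2 := lt_nbhsl td.
    by move: h1 h2; apply: filterS2 => s h1 h2; rewrite /bump h1 h2.
  have q0 : q.[t] != 0 by rewrite gt_eqF// q_gt0// tc.
  have dq := is_derive_poly q t; have dQ := is_derive_poly Q t.
  have dr : is_derive t 1 (fun s => (q.[s])^-1) (- q.[t] ^- 2 *: (deriv q).[t]) by exact: is_deriveV.
  have dn : is_derive t 1 (fun s => (q.[s])^-1 ^+ n) ((n%:R * (q.[t])^-1 ^+ n.-1) *: (- q.[t] ^- 2 *: (deriv q).[t])).
    have -> : (fun s => (q.[s])^-1 ^+ n) = (fun s => (q.[s])^-1) ^+ n by rewrite exprfctE.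
    exact: (is_deriveX n dr).
  have de : is_derive t 1 (fun s => expR (- (q.[s])^-1)) (expR (- (q.[t])^-1) * - (- q.[t] ^- 2 *: (deriv q).[t])).
    exact: is_derive1_comp (is_derive_expR _) (is_deriveN dr).
  have dP := is_deriveM (is_deriveM de dn) dQ.
  apply: (@eq_ind _ _ (fun l => is_derive t 1 _ l) dP).
  have -> : (dbump n Q).[t] = (deriv q).[t] * Q.[t] - n%:R * ((deriv q).[t] * (q.[t] * Q.[t]))
      + q.[t] ^+ 2 * (deriv Q).[t].
    rewrite /dbump; move: (deriv q) (deriv Q) (q) => A B C.
    by rewrite !(hornerD, hornerN, hornerM, hornerZ, horner_exp) !mulrA.
  exact: bump_algebra.
rewrite {2}/bump (_ : c < t < d = false); last by rewrite andbC ltNge (ltW td).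
apply: (is_derive_near _ (is_derive_cst (0 : R) t (1 : R))).
by have := lt_nbhsr td; apply: filterS => s sc; rewrite /bump andbC ltNge (ltW sc).
Qed.

Lemma bump_C0inf T : 0 <= c -> d <= T -> C0inf T (bump 0 1).
Proof.
move=> c0 dT; split.
- have [P HP] : exists P : nat -> {poly R}, forall n, derive1n n (bump 0 1) = bump n.*2 (P n).
    pose P := fix P n := if n is m.+1 then dbump m.*2 (P m) else 1 : {poly R}.
    exists P; elim=> // n IH; rewrite derive1nS IH; apply/funext => t.
    by rewrite derive1E; have := bump_derive n.*2 (P n) t => h; rewrite derive_val.
  by move=> n t; rewrite HP; have := bump_derive n.*2 (P n) t => h; exact: ex_derive.
- by rewrite /bump ltNge c0.
- by rewrite /bump [T < d]ltNge dT andbF.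
Qed.

Lemma bump_gt0 t : c < t < d -> 0 < bump 0 1 t <= 1.
Proof.
move=> tcd; have h1 : (1 : {poly R}).[t] = 1 by rewrite hornerE.
rewrite /bump tcd expr0 h1 !mulr1 expR_gt0/= -[leRHS]expR0 ler_expR.
by rewrite oppr_le0 invr_ge0 ltW// q_gt0.
Qed.

Lemma bump_out t : ~~ (c < t < d) -> bump 0 1 t = 0.
Proof. by rewrite /bump => /negbTE ->. Qed.

End SmoothBump.

(** * Uniformly Cauchy subsequences *)

Section HoelderCompactness.
Context {R : realType}.
Variables (T : R).
Hypothesis T0 : 0 < T.
Implicit Types (s t e M L th : R).

(** A cluster point l for pointwise convergence exists by Tychonoff's theorem
    and inherits the Hoelder bound; closeness to l on a fine finite grid then
    implies uniform closeness. *)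
Lemma hoelder_subsequence (u : nat -> R -> R) M L th : 0 < th -> 0 < L ->
  (forall n t, 0 <= t <= T -> `|u n t| <= M) ->
  (forall n s t, 0 <= s -> s <= t -> t <= T -> `|u n t - u n s| <= L * (t - s) `^ th) ->
  exists2 k : nat -> nat, (forall n, (n <= k n)%N) &
    forall e, 0 < e -> exists N, forall m n, (N <= m)%N -> (N <= n)%N ->
      forall t, 0 <= t <= T -> `|u (k m) t - u (k n) t| <= e.
Proof.
move=> th0 L0 uM uH.
pose v n (t : R) := if 0 <= t <= T then u n t else 0.
have vM n t : - `|M| <= v n t <= `|M|.
  rewrite -ler_norml /v; case: ifPn => tT; last by rewrite normr0.
  by rewrite (le_trans (uM n t tT))// ler_norm.
have cK := @tychonoff R (fun=> R) (fun=> `[- `|M|, `|M|]%classic) (fun=> @segment_compact _ _ _).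
have Fv : ((v : nat -> (prod_topology (fun _ : R => R))) @ \oo) [set f | forall i : R, `[- `|M|, `|M|]%classic (f i)].
  by exists 0%N => // n _ t /=; rewrite in_itv/= vM.
have [l [_ lcl]] := cK _ _ Fv.
have grid (N : nat) (e : R) (I : finType) (x : I -> R) : 0 < e ->
    exists n, (N <= n)%N /\ forall i, `|v n (x i) - l (x i)| < e.
  move=> e0.
  have nb : nbhs l [set g : prod_topology (fun _ : R => R) | forall i, `|g (x i) - l (x i)| < e].
    apply: (@filter_forall _ I (fun i => [set g : prod_topology (fun _ : R => R) |
      `|g (x i) - l (x i)| < e]) (nbhs l) (nbhs_filter l)) => i.
    have nA : nbhs (l (x i) : R) [set y : R | `|y - l (x i)| < e].
      by have := @nbhsx_ballx R R (l (x i)) e e0; apply: filterS => y; rewrite /ball/= distrC.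
    exact: (@proj_continuous R (fun=> R) (x i) l _ nA).
  have Fn : ((v : nat -> (prod_topology (fun _ : R => R))) @ \oo) [set v n | n in [set n | (N <= n)%N]].
    by exists N => // n /= Nn; exists n.
  have [_ [[n Nn <-] h]] := lcl _ _ Fn nb.
  by exists n.
have lH s t : 0 <= s -> s <= t -> t <= T -> `|l t - l s| <= L * (t - s) `^ th.
  move=> s0 st tT; apply/ler_addgt0Pr => e e0.
  have e2 : 0 < e / 2 by rewrite divr_gt0.
  have [n [_ h]] := grid 0%N (e / 2) bool (fun b => if b then t else s) e2.
  have := h true; have := h false; rewrite /v s0 (le_trans st tT) (le_trans s0 st) tT/= => h1 h2.
  rewrite (_ : l t - l s = (u n t - u n s) + ((u n s - l s) - (u n t - l t))); last ring.
  rewrite (le_trans (ler_normD _ _))// lerD ?uH// (le_trans (ler_normB _ _))//.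
  by rewrite [leRHS]splitr lerD// ltW.
have unif (N : nat) (e : R) : 0 < e ->
    exists n, (N <= n)%N /\ forall t, 0 <= t <= T -> `|u n t - l t| <= e.
  move=> e0; have e3 : 0 < e / 3 by rewrite divr_gt0.
  pose r := (e / 3 / L) `^ th^-1; have r0 : 0 < r by rewrite powR_gt0// divr_gt0.
  have rL : L * r `^ th = e / 3.
    have e3L : 0 <= e / 3 / L by rewrite ltW// divr_gt0.
    rewrite /r -powRrM mulVf ?gt_eqF// (powRr1 e3L) mulrC divfK//; exact: lt0r_neq0.
  (* The grid has step r, for which L r^th = e / 3. *)
  pose K := Num.truncn (T / r).
  have [n [Nn h]] := grid N (e / 3) 'I_K.+1 (fun i => i%:R * r) e3.
  exists n; split => // t /andP[t0 tT].
  pose j := Num.truncn (t / r).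
  have /andP[j1 j2] : j%:R <= t / r < j.+1%:R.
    by apply: truncn_itv; rewrite divr_ge0// ltW.
  have jK : (j < K.+1)%N.
    rewrite ltnS; apply: le_truncn; by rewrite ler_pM2r ?invr_gt0.
  have st : j%:R * r <= t by rewrite -ler_pdivlMr.
  have s0 : 0 <= j%:R * r by rewrite mulr_ge0// ltW.
  have ts : (t - j%:R * r) `^ th <= r `^ th.
    apply: ge0_ler_powR; rewrite ?nnegrE ?subr_ge0 ?(ltW th0) ?(ltW r0)//.
    move: j2; rewrite ltr_pdivrMr// -natr1 mulrDl mul1r => j2.
    by rewrite lerBlDl ltW.
  have := h (Ordinal jK); rewrite /v /= s0 (le_trans st tT)/= => h1.
  have h2 : `|u n t - u n (j%:R * r)| <= e / 3.
    by rewrite (le_trans (uH _ _ _ s0 st tT))// -rL ler_wpM2l// ltW.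
  have h3 : `|l t - l (j%:R * r)| <= e / 3.
    by rewrite (le_trans (lH _ _ s0 st tT))// -rL ler_wpM2l// ltW.
  rewrite (_ : u n t - l t = (u n t - u n (j%:R * r)) + ((u n (j%:R * r) - l (j%:R * r)) - (l t - l (j%:R * r)))); last ring.
  rewrite (_ : e = e / 3 + (e / 3 + e / 3)); last by field.
  rewrite (le_trans (ler_normD _ _))// lerD// (le_trans (ler_normB _ _))//.
  exact: lerD (ltW h1) h3.
have /choice[k Hk] : forall N : nat, exists n, (N <= n)%N /\
    forall t, 0 <= t <= T -> `|u n t - l t| <= N.+1%:R^-1.
  by move=> N; apply: unif; rewrite invr_gt0.
exists k => [n|e e0]; first by have [] := Hk n.
have e2 : 0 < e / 2 by rewrite divr_gt0.
exists (Num.truncn (e / 2)^-1) => m n Nm Nn t tT.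
have small a : (Num.truncn (e / 2)^-1 <= a)%N -> a.+1%:R^-1 <= e / 2.
  move=> ha; rewrite -[leRHS]invrK lef_pV2 ?posrE ?invr_gt0//.
  apply: le_trans (ltW (truncnS_gt _)) _; by rewrite ler_nat ltnS.
rewrite (_ : _ - _ = (u (k m) t - l t) - (u (k n) t - l t)); last ring.
rewrite (le_trans (ler_normB _ _))// [leRHS]splitr; apply: lerD.
  by have [_ h] := Hk m; apply: le_trans (h t tT) (small _ Nm).
by have [_ h] := Hk n; apply: le_trans (h t tT) (small _ Nn).
Qed.

End HoelderCompactness.

(** * Existence of a minimizer of the action *)

Section AlmostEverywhereMonotonicity.
Context {R : realType}.
Notation mu := (@lebesgue_measure R).

Lemma ae_le_Rintegral (D : set R) (f g : R -> R) : measurable D -> Rintegrable D f -> Rintegrable D g ->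
  {ae mu, forall t, D t -> f t <= g t} ->
  \int[mu]_(t in D) f t <= \int[mu]_(t in D) g t.
Proof.
move=> mD fi gi fg; pose m t := Num.max (f t) (g t).
have mi : Rintegrable D m.
  apply: (Rintegrable_le mD _ _ (RintegrableD mD (Rintegrable_norm mD fi) (Rintegrable_norm mD gi))).
    by apply: measurable_maxr; apply: Rintegrable_measurable.
  by move=> t _; rewrite /m; case: (leP (f t) (g t)) => _; rewrite ?lerDr ?lerDl.
rewrite [leRHS](ae_Rintegral (g := m)); last first.
  by apply: ae_impl fg => t h /h fg; rewrite /m; exact/esym/max_idPr.
by apply: le_Rintegral => // t _; rewrite /m le_max lexx.
Qed.

(** The two sides of K m^s = e m agree at m0: below m0 the power is at most
    its value there, above m0 the linear term dominates. *)
Lemma powR_sublinear (K s e : R) : 0 <= K -> 0 < s < 1 -> 0 < e ->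
  exists2 C, 0 <= C & forall m, 0 <= m -> K * m `^ s <= e * m + C.
Proof.
move=> K0 /andP[s0 s1] e0; have s1' : 0 < 1 - s by rewrite subr_gt0.
pose m0 := (K / e) `^ (1 - s)^-1.
have Ke : 0 <= K / e by rewrite divr_ge0// ltW.
exists (K * m0 `^ s) => [|m mge0]; first by rewrite mulr_ge0// powR_ge0.
have [mm0|m0m] := leP m m0.
  apply: (@le_trans _ _ (K * m0 `^ s)); last by rewrite lerDr mulr_ge0// ltW.
  by rewrite ler_wpM2l// ge0_ler_powR ?nnegrE ?powR_ge0 ?(ltW s0).
apply: (@le_trans _ _ (e * m)); last by rewrite lerDl mulr_ge0// powR_ge0.
have m_gt0 : 0 < m by apply: le_lt_trans m0m; exact: powR_ge0.
have : K / e <= m `^ (1 - s).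
  have -> : K / e = m0 `^ (1 - s) by rewrite /m0 -powRrM mulVf ?gt_eqF// powRr1.
  by apply: ge0_ler_powR; rewrite ?nnegrE ?powR_ge0 ?(ltW s1') ?(ltW m_gt0) ?(ltW m0m).
rewrite ler_pdivrMr// => h.
have -> : e * m = (m `^ (1 - s) * e) * m `^ s.
  rewrite mulrAC -powRD ?subrK ?powRr1 ?(ltW m_gt0)//; first by rewrite mulrC.
  by rewrite gt_eqF ?implybT.
by rewrite ler_wpM2r// powR_ge0.
Qed.

End AlmostEverywhereMonotonicity.

Section Minimization.
Context {R : realType}.
Notation mu := (@lebesgue_measure R).
Variables (T p alpha r : R) (G : R -> R -> R) (A : R -> R).
Hypotheses (T0 : 0 < T) (p1 : 1 < p) (ap : p^-1 < alpha) (a1 : alpha <= 1).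
Hypotheses (rp : 0 < r < p) (uG : ucont_slabs T G) (iA : Rintegrable `[0, T] A)
  (A0 : forall t, 0 <= A t)
  (GA : {ae mu, forall t, t \in `[0, T] -> forall x, `|G t x| <= A t * `|x| `^ r}).
Implicit Types (s t e M : R) (u v w : R -> R).

Let p0 : 0 < p. Proof. exact: lt_trans p1. Qed.
Let pV0 : 0 < p^-1. Proof. by rewrite invr_gt0. Qed.
Let mD : measurable `[0, T]%classic. Proof. exact: measurable_itv. Qed.

Definition potential u : R := \int[mu]_(t in `[0, T]) G t (u t).

(** The energy of fracI w as a function of the derivative w. *)
Definition action w : R := p^-1 * pmass T p w - potential (fracI alpha w).

Lemma potential_bound u M : {within `[0, T], continuous u} ->
  (forall t, 0 <= t <= T -> `|u t| <= M) ->
  `|potential u| <= M `^ r * \int[mu]_(t in `[0, T]) A t.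
Proof.
move=> uc uM; have iG := ucont_Rintegrable uG uc.
apply: le_trans (le_normr_Rintegrable mD iG) _; rewrite -(@RintegralZl _ _ _ mu _ _ _ mD iA).
apply: ae_le_Rintegral => //; [exact: Rintegrable_norm|exact: RintegrableZ|].
apply: ae_impl GA => t h tT; have {}h := h tT; apply: le_trans (h _) _.
rewrite mulrC ler_wpM2r//; have {}uM : `|u t| <= M by apply: uM; move: tT; rewrite /= in_itv.
case/andP: rp => r0 _.
by apply: ge0_ler_powR; rewrite ?nnegrE ?(ltW r0) ?(le_trans _ uM).
Qed.

Lemma potential_close M e : 0 < e -> exists2 d, 0 < d & forall u v,
  {within `[0, T], continuous u} -> {within `[0, T], continuous v} ->
  (forall t, 0 <= t <= T -> [/\ `|u t| <= M, `|v t| <= M & `|u t - v t| <= d]) ->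
  `|potential u - potential v| <= e.
Proof.
move=> e0; have eT : 0 < e / T by rewrite divr_gt0.
have [d d0 Hd] := uG M eT; exists (d / 2) => [|u v uc vc uv]; first by rewrite divr_gt0.
have iu := ucont_Rintegrable uG uc; have iv := ucont_Rintegrable uG vc.
rewrite /potential -RintegralB//; have iuv := RintegrableB mD iu iv.
rewrite -[leRHS](divfK (lt0r_neq0 T0)); apply: (Rintegral_itv_bound (ltW T0) iuv) => t tT.
 have [uM vM uvd] : [/\ `|u t| <= M, `|v t| <= M & `|u t - v t| <= d / 2].
  by apply: uv; move: tT; rewrite /= in_itv.
apply: ltW; apply: Hd => //; first by rewrite subrr normr0.
by apply: le_lt_trans uvd _; rewrite ltr_pdivrMr// ltr_pMr// ltr1n.
Qed.

(** The potential is at most of order r < p in the norm of w. *)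
Lemma action_coercive : exists2 C, 0 <= C & forall w, LpT T p w ->
  (2 * p)^-1 * pmass T p w <= action w + C.
Proof.
have [B B0 HB] := fracI_bounded T0 p1 ap a1.
pose I := \int[mu]_(t in `[0, T]) A t.
have I0 : 0 <= I by apply: Rintegral_ge0.
have e0 : 0 < (2 * p)^-1 by rewrite invr_gt0 mulr_gt0.
case/andP: rp => r0 r1.
have s1 : 0 < r / p < 1 by rewrite divr_gt0// ltr_pdivrMr// mul1r.
have K0 : 0 <= B `^ r * I by rewrite mulr_ge0// powR_ge0.
have [C C0 HC] := powR_sublinear K0 s1 e0.
exists C => // w hw.
have := potential_bound (fracI_continuous p1 ap a1 hw) (fun t => HB w t hw).
have {}HC := HC _ (pmass_ge0 T p w).
have -> : (B * pmass T p w `^ p^-1) `^ r * \int[mu]_(t in `[0, T]) A t =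
    B `^ r * I * pmass T p w `^ (r / p).
  by rewrite powRM ?powR_ge0 ?(ltW B0)// -powRrM [p^-1 * r]mulrC mulrAC.
rewrite /action; move: HC; move: (potential _) (pmass T p w) (_ * _ `^ (r / p)) => S m X h1 h2.
have {h2} := le_trans h2 h1; rewrite ler_norml => /andP[_ h].
have -> : p^-1 * m - S + C = (2 * p)^-1 * m + ((2 * p)^-1 * m + C - S).
  by field; rewrite gt_eqF.
by rewrite lerDl subr_ge0.
Qed.

Lemma pmass_root_le m B : 0 <= m -> m <= B -> m `^ p^-1 <= B `^ p^-1.
Proof.
by move=> m0 mB; apply: ge0_ler_powR; rewrite ?nnegrE ?(ltW pV0) ?(le_trans m0).
Qed.

(** A minimizing sequence is bounded, so along a subsequence (z_n) the
    functions fracI z_n converge uniformly, and the potentials of z_i and z_j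
    are close to that of their midpoint. The action of the midpoint is at
    least the infimum; hence the convexity gap of the masses tends to 0, and
    uniform convexity makes (z_n) a Cauchy sequence in L^p. Its limit is a
    minimizer because mass and potential are continuous. *)
Lemma action_minimizer : exists2 w, derivative_space T p alpha w &
  forall v, derivative_space T p alpha v -> action w <= action v.
Proof.
have [C C0 HC] := action_coercive.
pose S := [set x | exists2 w, derivative_space T p alpha w & x = action w].
have lS : lbound S (- C).
  move=> _ [w [hw _] ->]; rewrite -subr_ge0 opprK.
  by apply: le_trans (HC w hw); rewrite mulr_ge0 ?pmass_ge0// invr_ge0 mulr_ge0// ltW.
have iS : has_inf S.
  split; last by exists (- C).
  by exists (action (fun=> 0)); exists (fun=> 0) => //; exact: derivative_space0.
pose m := inf S.
have mle v : derivative_space T p alpha v -> m <= action v.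
  by move=> Wv; apply: ge_inf => //; [exists (- C)|exists v].
have /choice[w Hw] : forall n : nat, exists w, derivative_space T p alpha w /\ action w < m + n.+1%:R^-1.
  move=> n; have n0 : 0 < n.+1%:R^-1 :> R by rewrite invr_gt0.
  by have [_ [w Ww ->] h] := inf_adherent n0 iS; exists w.
have Ww n : derivative_space T p alpha (w n) by have [] := Hw n.
have Lw n : LpT T p (w n) by have [] := Ww n.
pose B := 2 * p * (m + 1 + C).
have wB n : pmass T p (w n) <= B.
  rewrite /B -ler_pdivrMl ?mulr_gt0// (le_trans (HC _ (Lw n)))// lerD2r ltW//.
  have [_ h] := Hw n; apply: lt_le_trans h _; rewrite lerD2l invf_le1//.
  by rewrite ler1n.
have B0 : 0 <= B by apply: le_trans (wB 0%N); exact: pmass_ge0.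
pose N := B `^ p^-1.
have wN n : pmass T p (w n) `^ p^-1 <= N by apply: pmass_root_le; rewrite ?pmass_ge0.
have [c1 c10 Hc1] := fracI_bounded T0 p1 ap a1.
have [c2 c20 Hc2] := fracI_hoelder T p1 ap a1.
have N0 : 0 <= N by exact: powR_ge0.
have th0 : 0 < alpha - p^-1 by rewrite subr_gt0.
have L0 : 0 < c2 * N + 1 by rewrite ltr_wpDl// mulr_ge0// ltW.
have uM n t : 0 <= t <= T -> `|fracI alpha (w n) t| <= c1 * N.
  move=> tT; apply: le_trans (Hc1 _ _ (Lw n) tT) _.
  by rewrite ler_wpM2l ?(ltW c10).
have uH n s t : 0 <= s -> s <= t -> t <= T ->
    `|fracI alpha (w n) t - fracI alpha (w n) s| <= (c2 * N + 1) * (t - s) `^ (alpha - p^-1).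
  move=> s0 st tT; apply: le_trans (Hc2 _ _ _ (Lw n) s0 st tT) _.
  rewrite ler_wpM2r ?powR_ge0//; apply: (@le_trans _ _ (c2 * N)); last by rewrite lerDl.
  by rewrite ler_wpM2l ?(ltW c20).
have [k kn Hk] := hoelder_subsequence th0 L0 uM uH.
pose z n := w (k n).
have Lz n : LpT T p (z n) by exact: Lw.
have zm (n i : nat) : (n <= i)%N -> action (z i) < m + n.+1%:R^-1.
  move=> ni; have [_ h] := Hw (k i); apply: lt_le_trans h _.
  by rewrite lerD2l lef_pV2 ?posrE// ler_nat ltnS (leq_trans ni).
have uc v : LpT T p v -> {within `[0, T], continuous (fracI alpha v)}.
  by move=> hv; exact: (fracI_continuous p1 ap a1 hv).
pose mid i j t := (z i t + z j t) / 2.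
have midE i j : mid i j = (fun t => 2^-1 * z i t + (2^-1 * z j t + 0)).
  by apply/funext => t; rewrite /mid addr0 mulrDl ![_ / 2]mulrC.
have Wmid i j : derivative_space T p alpha (mid i j).
  rewrite midE; apply: (derivative_space_lin p1 ap 2^-1 (Ww _)).
  exact: (derivative_space_lin p1 ap 2^-1 (Ww _) (derivative_space0 T alpha p1)).
have Imid i j t : 0 <= t <= T ->
    fracI alpha (mid i j) t = (fracI alpha (z i) t + fracI alpha (z j) t) / 2.
  move=> /andP[_ tT]; rewrite midE.
  have h0 := LpT0 T (ltW p0).
  rewrite (fracI_lin p1 ap 2^-1 (Lz i) (LpT_lin 2^-1 (ltW p0) (Lz j) h0) tT).
  by rewrite (fracI_lin p1 ap 2^-1 (Lz j) h0 tT) fracI_cst0 addr0 mulrDl ![_ / 2]mulrC.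
have unif e : 0 < e -> exists n, forall i j, (n <= i)%N -> (n <= j)%N ->
    (pmass T p (z i) + pmass T p (z j)) / 2 - pmass T p (mid i j) <= e.
  move=> e0; have e1 : 0 < e / (2 * p) by rewrite divr_gt0// mulr_gt0.
  have [d d0 Hd] := potential_close (c1 * N) e1.
  have [n1 Hn1] := Hk d d0.
  pose n2 := Num.truncn (e / (2 * p))^-1.
  exists (maxn n1 n2) => i j; rewrite !geq_max => /andP[i1 i2] /andP[j1 j2].
  have an l : (n2 <= l)%N -> action (z l) <= m + e / (2 * p).
    move=> ln; apply: (le_trans (ltW (zm n2 l ln))); rewrite lerD2l.
    rewrite -[leRHS]invrK lef_pV2 ?posrE ?invr_gt0//.
    by rewrite ltW// truncnS_gt.
  have sup l l' : (n1 <= l)%N -> (n1 <= l')%N -> forall v, LpT T p v ->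
      (forall t, 0 <= t <= T -> fracI alpha v t = (fracI alpha (z l) t + fracI alpha (z l') t) / 2) ->
      potential (fracI alpha (z l)) - potential (fracI alpha v) <= e / (2 * p).
    move=> l1 l'1 v hv Iv; apply: le_trans (ler_norm _) _.
    apply: Hd; [exact: uc|exact: uc|] => t tT; rewrite Iv//.
    have h1 := uM (k l) t tT; have h2 := uM (k l') t tT; have h3 := Hn1 _ _ l1 l'1 t tT.
    split => //.
      rewrite normrM [`|2^-1|]gtr0_norm ?invr_gt0// ler_pdivrMr// mulr_natr mulr2n.
      by rewrite (le_trans (ler_normD _ _))// lerD.
    have -> : fracI alpha (z l) t - (fracI alpha (z l) t + fracI alpha (z l') t) / 2 =
        (fracI alpha (z l) t - fracI alpha (z l') t) / 2 by field.
    rewrite normrM [`|2^-1|]gtr0_norm ?invr_gt0// ler_pdivrMr//.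
    by rewrite (le_trans h3)// ler_peMr ?(ltW d0)// ler1n.
  have [Lm _] := Wmid i j.
  have s1 := sup i j i1 j1 _ Lm (Imid i j).
  have s2 : potential (fracI alpha (z j)) - potential (fracI alpha (mid i j)) <= e / (2 * p).
    by apply: (sup j i) => // t tT; rewrite Imid// addrC.
  move: (an i i2) (an j j2) (mle _ (Wmid i j)) s1 s2; rewrite /action.
  move: (potential (fracI alpha (z i))) (potential (fracI alpha (z j))) (potential (fracI alpha (mid i j))) => X Y Z.
  move: (pmass T p (z i)) (pmass T p (z j)) (pmass T p (mid i j)) => x y xy h1 h2 h3 h4 h5.
  have E : (x + y) / 2 - xy = p * ((p^-1 * x - X + (p^-1 * y - Y)) / 2 - (p^-1 * xy - Z)
      + ((X - Z) + (Y - Z)) / 2) by field; rewrite gt_eqF.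
  have E2 : e = p * (2 * (e / (2 * p))) by field; rewrite gt_eqF.
  rewrite E [leRHS]E2 ler_pM2l//; move: h1 h2 h3 h4 h5.
  move: (p^-1 * x - X) (p^-1 * y - Y) (p^-1 * xy - Z) (X - Z) (Y - Z) (e / (2 * p)) => *; lra.
have cauchy e : 0 < e -> exists n, forall i j, (n <= i)%N -> (n <= j)%N ->
    pmass T p (z i \- z j) < e.
  move=> e0; have B1 : 0 < 4 * (B + 1) by rewrite mulr_gt0// ltr_wpDl.
  have [D D0 HD] := pmass_uniform_convex T p1 (divr_gt0 e0 B1).
  have e4 : 0 < e / (4 * D) by rewrite divr_gt0// mulr_gt0.
  have [n Hn] := unif _ e4; exists n => i j ni nj.
  apply: le_lt_trans (HD _ _ (Lz i) (Lz j)) _.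
  have := Hn i j ni nj; have := wB (k i); have := wB (k j); rewrite -/(z i) -/(z j) -/(mid i j).
  move: ((_ + _) / 2 - pmass T p (mid i j)) => X; move: (pmass T p (z i)) (pmass T p (z j)) => x y h1 h2 h3.
  have q1 : e / (4 * (B + 1)) * (x + y) <= e / 2.
    rewrite mulrAC ler_pdivrMr// -mulrA ler_wpM2l ?(ltW e0)//.
    by rewrite (_ : 2^-1 * (4 * (B + 1)) = (B + 1) + (B + 1)) ?lerD ?(le_trans h1) ?(le_trans h2) ?lerDl//; field.
  have q2 : D * X <= e / 4.
    rewrite mulrC -ler_pdivlMr//; apply: le_trans h3 _.
    by rewrite invfM mulrA.
  apply: (@le_lt_trans _ _ (e / 2 + e / 4)); first exact: lerD.
  by move: e0; lra.
have [l hl Hl] := LpT_complete T0 p1 Lz cauchy.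
have Wl : derivative_space T p alpha l.
  apply: (derivative_space_closed p1 hl) => e e0.
  have e2 : 0 < e / 2 by rewrite divr_gt0.
  have [n Hn] := Hl _ e2; exists (z n); first exact: Ww.
  by rewrite pmassBC; apply: le_lt_trans (Hn n (leqnn n)) _; move: e0; lra.
exists l; [exact: Wl|move=> v Wv]; apply: le_trans (mle _ Wv).
apply/ler_addgt0Pr => e e0; have e3 : 0 < e / 3 by rewrite divr_gt0.
have [d1 d10 Hd1] := pmass_continuous p1 hl (mulr_gt0 p0 e3).
pose M := c1 * (N + pmass T p l `^ p^-1).
have [d2 d20 Hd2] := potential_close M e3.
pose d := Num.min (d1 / 2) ((d2 / c1) `^ p).
have d0 : 0 < d by rewrite lt_min divr_gt0//= powR_gt0// divr_gt0.
have [n Hn] := Hl _ d0.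
pose i := maxn n (Num.truncn (e / 3)^-1).
have := Hn i (leq_maxl _ _); rewrite le_min => /andP[m1 m2].
have a1' : action (z i) <= m + e / 3.
  apply: (le_trans (ltW (zm _ i (leq_maxr _ _)))); rewrite lerD2l.
  by rewrite -[leRHS]invrK lef_pV2 ?posrE ?invr_gt0// ltW// truncnS_gt.
have {}m1 : pmass T p (z i \- l) < d1.
  by apply: le_lt_trans m1 _; rewrite ltr_pdivrMr// ltr_pMr// ltr1n.
have h1 := Hd1 _ (Lz i) m1.
have h2 : `|potential (fracI alpha (z i)) - potential (fracI alpha l)| <= e / 3.
  apply: Hd2; [exact: uc|exact: uc|] => t tT; split.
  - apply: le_trans (Hc1 _ _ (Lz i) tT) _; rewrite ler_wpM2l ?(ltW c10)//.
    by rewrite (le_trans (wN _))// lerDl powR_ge0.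
  - by apply: le_trans (Hc1 _ _ hl tT) _; rewrite ler_wpM2l ?(ltW c10)// lerDr.
  - have /andP[_ tT'] := tT; rewrite -(fracIB p1 ap (Lz i) hl tT').
    apply: le_trans (Hc1 _ _ (LpTB (ltW p0) (Lz i) hl) tT) _.
    rewrite mulrC -ler_pdivlMr//.
    have -> : d2 / c1 = ((d2 / c1) `^ p) `^ p^-1.
      by rewrite -powRrM mulfV ?gt_eqF// powRr1// divr_ge0// ltW.
    by apply: pmass_root_le; rewrite ?pmass_ge0.
move: h1 h2 a1'; rewrite /action.
move: (potential (fracI alpha (z i))) (potential (fracI alpha l)) (pmass T p (z i)) (pmass T p l) => X Y x y.
rewrite ltr_norml ler_norml => /andP[h1 _] /andP[_ h2] h3.
have h1' : p^-1 * y <= p^-1 * x + e / 3.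
  rewrite -(ler_pM2l p0) mulrDr !mulrA mulfV ?gt_eqF// !mul1r.
  by move: h1; rewrite -mulrA; lra.
by move: h1' h2 h3; lra.
Qed.

End Minimization.

(** * Negativity of the minimum *)

Section NegativeAction.
Context {R : realType}.
Notation mu := (@lebesgue_measure R).
Implicit Types (s t c d : R).

Lemma ae_itv_witness (P : R -> Prop) c d : c < d -> {ae mu, forall t, P t} ->
  exists2 t, c < t < d & P t.
Proof.
move=> cd [N [mN N0 sub]]; apply: contrapT => H.
have sN : `]c, d[%classic `<=` N.
  move=> t /=; rewrite in_itv/= => tcd; apply: sub => Pt; apply: H; by exists t.
have : (mu `]c, d[%classic <= 0)%E.
  by rewrite -N0; exact: (le_measure mu (mem_set (measurable_itv `]c, d[)) (mem_set mN) sN).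
rewrite lebesgue_measure_itv/= lte_fin cd -EFinD lee_fin subr_le0.
by rewrite leNgt cd.
Qed.

Variables (T p alpha : R) (G : R -> R -> R).
Hypotheses (T0 : 0 < T) (p1 : 1 < p) (ap : p^-1 < alpha) (a1 : alpha <= 1).
Hypotheses (uG : ucont_slabs T G) (G0 : forall t, G t 0 = 0).

Let p0 : 0 < p. Proof. exact: lt_trans p1. Qed.

(** Along s phi with s -> 0, where phi is a bump supported in the interval,
    the term of order s^r2 coming from the potential beats the term of order
    s^p coming from the norm. *)
Lemma action_negative c d eta delta r2 : c < d -> 0 <= c -> d <= T ->
  0 < eta -> 0 < delta -> 0 < r2 < p ->
  (forall t x, t \in `]c, d[ -> x \in `[- delta, delta] -> eta * `|x| `^ r2 <= G t x) ->
  exists2 w, derivative_space T p alpha w & action T p alpha G w < 0.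
Proof.
move=> cd c0 dT eta0 delta0 /andP[r0 rp] GH; pose phi := bump c d 0 1.
have phiC : C0inf T phi by exact: bump_C0inf.
have [w0 hw0 phiE] := C0inf_fracI T0 p1 ap a1 phiC.
have W0 : derivative_space T p alpha w0.
  split => // e e0; exists phi, w0; split => //.
  by rewrite (_ : w0 \- w0 = fun=> 0) ?(pmass0 T p0)//; apply/funext => t /=; rewrite subrr.
have phi01 t : 0 <= phi t <= 1.
  have [tcd|tcd] := boolP (c < t < d).
    by have /andP[h ->] := bump_gt0 tcd; rewrite andbT ltW.
  by rewrite /phi bump_out// lexx ler01.
have phic : continuous phi.
  move=> t; apply: differentiable_continuous; apply/derivable1_diffP.
  by have [h _ _] := phiC; have := h 0%N t.
pose Q := \int[mu]_(t in `[0, T]) (`|phi t| `^ r2).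
have pc : continuous (fun t => `|phi t| `^ r2).
  move=> t; apply: (@continuous_comp R R R phi (fun x => `|x| `^ r2) t (phic t)).
  exact: continuous_norm_powR.
have ipr : Rintegrable `[0, T] (fun t => `|phi t| `^ r2).
  apply: continuous_compact_integrable; first exact: segment_compact.
  apply: continuous_subspaceT; exact: pc.
have Q0 : 0 < Q.
  rewrite lt0r Rintegral_ge0 ?andbT; last by move=> t _; exact: powR_ge0.
  apply/eqP => Qz.
  have hphi : LpT T r2 (phi \_ `[0, T]).
    apply: (@LpT_bounded _ _ _ _ 1) => //; last exact: ltW.
    - apply/(measurable_restrictT _ _).1 => //.
      by apply: measurable_funTS; exact: continuous_measurable_fun.
    - by move=> t /negP tT; rewrite patchE memNset.
    - move=> t tT; rewrite patchE mem_set//; have /andP[h1 h2] := phi01 t.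
      by rewrite ger0_norm.
  have aphi := aeq_sym (aeq_patch T phi).
  have := pmass_eq0 hphi; rewrite (pmass_ae r2 aphi) => /(_ Qz) h.
  have {}h := aeq_trans (aeq_sym aphi) h.
  have [t tcd ht] := ae_itv_witness cd h.
  have tT : t \in `[0, T].
    by case/andP: tcd => h1 h2; rewrite in_itv/= (le_trans c0 (ltW h1)) (le_trans (ltW h2) dT).
  by have := bump_gt0 tcd; rewrite -/(phi t) (ht tT) ltxx.
have [P P0 PE] : exists2 P, 0 < P & P = Q by exists Q.
have pr0 : 0 < p - r2 by rewrite subr_gt0.
pose m := p^-1 * pmass T p w0.
have m0 : 0 <= m by rewrite mulr_ge0 ?pmass_ge0// invr_ge0 ltW.
(* For small s the action is at most s^p m - eta s^r2 P; the choice of s makes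
   s^(p - r2) m smaller than eta P. *)
pose K := eta * P / (m + 1).
have K0 : 0 < K by rewrite divr_gt0 ?mulr_gt0// ltr_wpDl.
pose s := Num.min delta ((K / 2) `^ (p - r2)^-1).
have s0 : 0 < s by rewrite lt_min delta0 powR_gt0// divr_gt0.
have sK : s `^ (p - r2) < K.
  apply: (@le_lt_trans _ _ (K / 2)); last by rewrite ltr_pdivrMr// ltr_pMr// ltr1n.
  have -> : K / 2 = ((K / 2) `^ (p - r2)^-1) `^ (p - r2).
    by rewrite -powRrM mulVf ?gt_eqF// powRr1// divr_ge0// ltW.
  apply: ge0_ler_powR; rewrite ?nnegrE ?powR_ge0 ?(ltW pr0) ?(ltW s0)//.
  by rewrite ge_min lexx orbT.
pose w t := s * w0 t + (fun=> 0) t.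
have Iw t : 0 <= t <= T -> fracI alpha w t = s * phi t.
  move=> /andP[t0 tT]; rewrite (fracI_lin p1 ap s hw0 (LpT0 T (ltW p0)) tT).
  by rewrite fracI_cst0 addr0 phiE// in_itv/= t0 tT.
exists w; first exact: (derivative_space_lin p1 ap s W0 (derivative_space0 T alpha p1)).
have [hw _] := derivative_space_lin p1 ap s W0 (derivative_space0 T alpha p1).
have mw : pmass T p w = s `^ p * pmass T p w0.
  have := pmassZ s hw0; rewrite (gtr0_norm s0) => <-; congr (pmass T p _).
  by apply/funext => t; exact: addr0.
have Sw : eta * s `^ r2 * P <= potential T G (fracI alpha w).
  have mD := measurable_itv `[0, T] : measurable `[0, T]%classic.
  rewrite PE /Q -(@RintegralZl _ _ _ mu _ _ _ mD ipr); apply: le_Rintegral => //.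
  - exact: (RintegrableZ _ mD ipr).
  - exact: ucont_Rintegrable uG (fracI_continuous p1 ap a1 hw).
  move=> t tT; have tT' : 0 <= t <= T by move: tT; rewrite /= in_itv.
  rewrite Iw//; have [tcd|tcd] := boolP (c < t < d); last first.
    by rewrite /phi bump_out// mulr0 G0 normr0 powR0 ?gt_eqF// mulr0.
  have /andP[h1 h2] := phi01 t.
  apply: le_trans (GH t (s * phi t) _ _); last 2 first.
  - by rewrite in_itv.
  - rewrite in_itv/= -ler_norml ger0_norm ?mulr_ge0 ?(ltW s0)//.
    apply: (@le_trans _ _ s); first by rewrite ler_piMr// ltW.
    by rewrite ge_min lexx.
  by rewrite normrM powRM// (gtr0_norm s0) mulrA.
rewrite /action mw subr_lt0; apply: lt_le_trans Sw.
have -> : p^-1 * (s `^ p * pmass T p w0) = s `^ r2 * (s `^ (p - r2) * m).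
  have -> : s `^ p = s `^ r2 * s `^ (p - r2).
    by rewrite -powRD ?(gt_eqF s0) ?implybT// addrC subrK.
  by rewrite /m; move: (pmass T p w0) (s `^ r2) (s `^ (p - r2)) p^-1 => x y z pv; ring.
have -> : eta * s `^ r2 * P = s `^ r2 * (K * (m + 1)).
  have -> : K * (m + 1) = eta * P by rewrite /K divfK// gt_eqF// ltr_wpDl.
  by rewrite [RHS]mulrCA mulrA.
rewrite ltr_pM2l ?powR_gt0//; apply: (@le_lt_trans _ _ (K * m)).
  by rewrite ler_wpM2r// ltW.
by rewrite ltr_pM2l// ltrDl.
Qed.

End NegativeAction.

(** * Differentiability of the action *)

Section ActionDerivative.
Context {R : realType}.
Notation mu := (@lebesgue_measure R).
Variables (T p alpha : R) (f : R -> R -> R).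
Hypotheses (T0 : 0 < T) (p1 : 1 < p) (ap : p^-1 < alpha) (a1 : alpha <= 1).
Hypotheses (uf : ucont_slabs T f) (uF : ucont_slabs T (primitive f)).
Implicit Types (s t e M k : R) (u v w h z : R -> R).

Let p0 : 0 < p. Proof. exact: lt_trans p1. Qed.
Let mD : measurable `[0, T]%classic. Proof. exact: measurable_itv. Qed.

Definition action_derivative w z : R :=
  \int[mu]_(t in `[0, T]) (phi_p p (w t) * z t) -
  \int[mu]_(t in `[0, T]) (f t (fracI alpha w t) * fracI alpha z t).

Lemma Rintegrable_mul_continuous u v : {within `[0, T], continuous u} ->
  {within `[0, T], continuous v} -> Rintegrable `[0, T] (fun t => f t (u t) * v t).
Proof.
move=> uc vc; apply: continuous_compact_integrable; first exact: segment_compact.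
by move=> t; apply: cvgM; [exact: (ucont_comp uf uc)|exact: vc].
Qed.

Lemma action_derivative_lin w k z z' : LpT T p w -> LpT T p z -> LpT T p z' ->
  action_derivative w (fun t => k * z t + z' t) =
  k * action_derivative w z + action_derivative w z'.
Proof.
move=> hw hz hz'; have [K _ HK] := phi_p_integral p1 hw.
have [i1 _] := HK z hz; have [i2 _] := HK z' hz'.
have c v : LpT T p v -> {within `[0, T], continuous (fracI alpha v)}.
  by move=> hv; exact: (fracI_continuous p1 ap a1 hv).
have j1 := Rintegrable_mul_continuous (c _ hw) (c _ hz).
have j2 := Rintegrable_mul_continuous (c _ hw) (c _ hz').
have E1 : \int[mu]_(t in `[0, T]) (phi_p p (w t) * (k * z t + z' t)) =
    k * \int[mu]_(t in `[0, T]) (phi_p p (w t) * z t) + \int[mu]_(t in `[0, T]) (phi_p p (w t) * z' t).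
  rewrite -(@RintegralZl _ _ _ mu _ _ k mD i1) -RintegralD//; last exact: RintegrableZ.
  by apply: eq_Rintegral => t _; rewrite mulrDr mulrCA.
have E2 : \int[mu]_(t in `[0, T]) (f t (fracI alpha w t) * fracI alpha (fun t => k * z t + z' t) t) =
    k * \int[mu]_(t in `[0, T]) (f t (fracI alpha w t) * fracI alpha z t) +
    \int[mu]_(t in `[0, T]) (f t (fracI alpha w t) * fracI alpha z' t).
  rewrite -(@RintegralZl _ _ _ mu _ _ k mD j1) -RintegralD//; last exact: RintegrableZ.
  apply: eq_Rintegral => t; rewrite inE /= in_itv/= => /andP[_ tT].
  by rewrite (fracI_lin p1 ap k hz hz' tT) mulrDr mulrCA.
have E (a b a' b' : R) : k * a + b - (k * a' + b') = k * (a - a') + (b - b') by ring.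
by rewrite /action_derivative E1 E2; exact: E.
Qed.

Lemma action_derivative_bounded w : LpT T p w -> exists K, forall z, LpT T p z ->
  `|action_derivative w z| <= K * pmass T p z `^ p^-1.
Proof.
move=> hw; have [K K0 HK] := phi_p_integral p1 hw.
have [C C0 HC] := fracI_bounded T0 p1 ap a1.
have wc := fracI_continuous p1 ap a1 hw.
have [M M0 HM] := within_continuous_bounded (@segment_compact _ 0 T) (ucont_comp uf wc).
exists (K + M * C * T) => z hz; have [_ H1] := HK z hz.
have ij := Rintegrable_mul_continuous wc (fracI_continuous p1 ap a1 hz).
have H2 : `|\int[mu]_(t in `[0, T]) (f t (fracI alpha w t) * fracI alpha z t)| <=
    M * (C * pmass T p z `^ p^-1) * T.
  apply: (Rintegral_itv_bound (ltW T0) ij) => t tT; rewrite normrM ler_pM ?HM//.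
  by apply: HC => //; move: tT; rewrite in_itv.
apply: le_trans (ler_normB _ _) _; rewrite mulrDl lerD//.
by apply: le_trans H2 _; rewrite (_ : M * C * T * _ = M * (C * pmass T p z `^ p^-1) * T)//;
  move: (_ `^ _) => y; ring.
Qed.

Lemma potential_frechet u e : {within `[0, T], continuous u} -> 0 < e ->
  exists2 d, 0 < d & forall h m, {within `[0, T], continuous h} -> m < d ->
    (forall t, t \in `[0, T] -> `|h t| <= m) ->
    `|potential T (primitive f) (fun t => u t + h t) - potential T (primitive f) u -
      \int[mu]_(t in `[0, T]) (f t (u t) * h t)| <= e * m * T.
Proof.
move=> uc e0; have [M M0 HM] := within_continuous_bounded (@segment_compact _ 0 T) uc.
have [d d0 Hd] := primitive_first_order uf M e0; exists d => // h m hc md hm.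
have uhc : {within `[0, T], continuous (fun t => u t + h t)}.
  by move=> t; apply: cvgD; [exact: uc|exact: hc].
have i1 := ucont_Rintegrable uF uc; have i2 := ucont_Rintegrable uF uhc; have i3 := Rintegrable_mul_continuous uc hc.
have i4 := RintegrableB mD i2 i1.
rewrite /potential -RintegralB// -RintegralB//.
apply: Rintegral_itv_bound; [exact: ltW|exact: RintegrableB|].
move=> t tT; apply: le_trans (Hd t (u t) (h t) tT (HM t tT) _) _.
  exact: le_lt_trans (hm t tT) md.
by rewrite ler_wpM2l ?hm// ltW.
Qed.

Lemma action_frechet w e : LpT T p w -> 0 < e -> exists2 d, 0 < d & forall z, LpT T p z ->
  pmass T p z `^ p^-1 < d ->
  `|action T p alpha (primitive f) (w \+ z) - action T p alpha (primitive f) w -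
    action_derivative w z| <= e * pmass T p z `^ p^-1.
Proof.
move=> hw e0; have e2 : 0 < e / 2 by rewrite divr_gt0.
have [C C0 HC] := fracI_bounded T0 p1 ap a1.
have [d1 d10 Hd1] := pmass_frechet p1 hw e2.
have wc := fracI_continuous p1 ap a1 hw.
have CT : 0 < C * T by rewrite mulr_gt0.
have [d2 d20 Hd2] := potential_frechet wc (divr_gt0 e2 CT).
exists (Num.min d1 (d2 / C)) => [|z hz]; first by rewrite lt_min d10 divr_gt0.
rewrite lt_min => /andP[zd1 zd2]; have H1 := Hd1 z hz zd1.
have zc := fracI_continuous p1 ap a1 hz.
have := Hd2 _ (C * pmass T p z `^ p^-1) zc.
have -> : potential T (primitive f) (fun t => fracI alpha w t + fracI alpha z t) =
    potential T (primitive f) (fracI alpha (w \+ z)).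
  apply: eq_Rintegral => t; rewrite inE /= in_itv/= => /andP[_ tT]; congr primitive.
  rewrite (_ : w \+ z = (fun t => 1 * w t + z t)).
    by rewrite (fracI_lin p1 ap 1 hw hz tT) mul1r.
  by apply/funext => s /=; rewrite mul1r.
have zb t : t \in `[0, T] -> `|fracI alpha z t| <= pmass T p z `^ p^-1 * C.
  by move=> tT; rewrite mulrC; apply: HC => //; move: tT; rewrite in_itv.
rewrite mulrC -ltr_pdivlMr// => /(_ zd2 zb); move: H1.
rewrite /action /action_derivative.
move: (potential T (primitive f) (fracI alpha (w \+ z))) (potential T (primitive f) (fracI alpha w)) => X Y.
move: (\int[mu]_(t in `[0, T]) (phi_p p (w t) * z t)) (pmass T p (w \+ z)) (pmass T p w) => I x y.
move: (\int[mu]_(t in `[0, T]) _) (pmass T p z `^ p^-1) => J N.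
rewrite (_ : e / 2 / (C * T) * (N * C) * T = e / 2 * N); last by field; rewrite !gt_eqF.
move=> h1 h2.
rewrite (_ : p^-1 * x - X - (p^-1 * y - Y) - (I - J) = (p^-1 * x - p^-1 * y - I) - (X - Y - J)); last ring.
apply: le_trans (ler_normB _ _) _.
by rewrite (_ : e * N = e / 2 * N + e / 2 * N) ?lerD//; field.
Qed.

(** Moving from w by s z with s of either sign and |s| small, minimality
    bounds - s times the derivative by |s| e. *)
Lemma minimizer_critical w z : derivative_space T p alpha w ->
  (forall v, derivative_space T p alpha v ->
    action T p alpha (primitive f) w <= action T p alpha (primitive f) v) ->
  derivative_space T p alpha z -> action_derivative w z = 0.
Proof.
move=> Ww wmin Wz; have [hw _] := Ww; have [hz _] := Wz.
apply/eqP; rewrite -normr_le0; apply/ler_addgt0Pr => e e0; rewrite add0r.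
pose N := pmass T p z `^ p^-1; have N0 : 0 <= N by exact: powR_ge0.
have N1 : 0 < N + 1 by rewrite ltr_wpDl.
have [d d0 Hd] := action_frechet hw (divr_gt0 e0 N1).
have h0 := LpT0 T (ltW p0).
have D0 : action_derivative w (fun=> 0) = 0.
  have := action_derivative_lin 1 hw h0 h0.
  rewrite (_ : (fun t => _) = fun=> 0); last by apply/funext => t; rewrite mulr0 addr0.
  by move=> /eqP; rewrite mul1r -subr_eq0 opprD addNKr oppr_eq0 => /eqP.
have key s : `|s| = d / (2 * (N + 1)) -> - s * action_derivative w z <= `|s| * e.
  move=> sE; pose y t := s * z t + (fun=> 0) t.
  have hy : LpT T p y by exact: LpT_lin (ltW p0) hz h0.
  have Ny : pmass T p y `^ p^-1 = `|s| * N.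
    have -> : pmass T p y = `|s| `^ p * pmass T p z.
      have := pmassZ s hz => <-; congr (pmass T p _).
      by apply/funext => t; exact: addr0.
    by rewrite powRM ?powR_ge0 ?pmass_ge0// -powRrM mulfV ?gt_eqF// powRr1.
  have small : pmass T p y `^ p^-1 < d.
    rewrite Ny sE mulrAC ltr_pdivrMr ?mulr_gt0// ltr_pM2l//.
    by rewrite (@lt_le_trans _ _ (N + 1)) ?ltrDl// ler_peMl ?ler1n// ltW.
  have := Hd y hy small; rewrite Ny ler_norml => /andP[_].
  have -> : action_derivative w y = s * action_derivative w z.
    by rewrite (action_derivative_lin s hw hz h0) D0 addr0.
  have Wy : derivative_space T p alpha (w \+ y).
    have := derivative_space_lin p1 ap s Wz Ww; congr derivative_space.
    by apply/funext => t; rewrite /y /= addr0 addrC.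
  have := wmin _ Wy; move: (action _ _ _ _ w) (action _ _ _ _ (w \+ y)) (action_derivative w z) => a b D ab h.
  have h2 : - s * D <= e / (N + 1) * (`|s| * N).
    by apply: le_trans h; rewrite mulNr lerBrDr addrC subrr subr_ge0.
  apply: le_trans h2 _; rewrite mulrC -mulrA ler_wpM2l//.
  rewrite mulrC mulrAC ler_pdivrMr// ler_wpM2l ?(ltW e0)//.
  by rewrite lerDl.
have c0 : 0 < d / (2 * (N + 1)) by rewrite divr_gt0// mulr_gt0.
have k1 := key _ (gtr0_norm c0); have := key (- (d / (2 * (N + 1)))).
rewrite normrN (gtr0_norm c0) => /(_ erefl) k2.
rewrite (gtr0_norm c0) in k1; move: k1 k2; rewrite opprK mulNr -mulrN !ler_pM2l// => k1 k2.
by rewrite ler_norml k2 andbT lerNl.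
Qed.

End ActionDerivative.

(** * Existence of a nontrivial weak solution *)

Section WeakSolution.
Context {R : realType}.
Notation mu := (@lebesgue_measure R).
Variables (T p alpha : R) (f : R -> R -> R).
Hypotheses (T0 : 0 < T) (p1 : 1 < p) (ap : p^-1 < alpha) (a1 : alpha <= 1).
Hypotheses (uf : ucont_slabs T f) (uF : ucont_slabs T (primitive f)).
Implicit Types (s t e M k : R) (u v w h z : R -> R).

Let p0 : 0 < p. Proof. exact: lt_trans p1. Qed.
Let mD : measurable `[0, T]%classic. Proof. exact: measurable_itv. Qed.

Lemma energyE u w : LpT T p w -> aeq T (fracD alpha u) w -> aeq T u (fracI alpha w) ->
  energy T p alpha f u = action T p alpha (primitive f) w.
Proof.
move=> hw Du uI; have [_ _ iw] := hw.
have iF := ucont_Rintegrable uF (fracI_continuous p1 ap a1 hw).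
have iw' := RintegrableZ p^-1 mD iw.
rewrite /action; have -> : p^-1 * pmass T p w = \int[mu]_(t in `[0, T]) (p^-1 * `|w t| `^ p).
  exact: esym (@RintegralZl _ _ _ mu _ _ _ mD iw).
transitivity (\int[mu]_(t in `[0, T])
  (p^-1 * `|w t| `^ p - primitive f t (fracI alpha w t))); last exact: RintegralB.
apply: aeq_Rintegral; apply: ae_impl2 Du uI => t h1 h2 tT.
by rewrite h1// h2.
Qed.

Lemma denergyE u w v z : aeq T (fracD alpha u) w -> aeq T u (fracI alpha w) ->
  aeq T (fracD alpha v) z -> aeq T v (fracI alpha z) ->
  denergy T p alpha f u v = action_derivative T p alpha f w z.
Proof.
move=> Du uI Dv vI; congr (_ - _); apply: aeq_Rintegral.
  by apply: ae_impl2 Du Dv => t h1 h2 tT; rewrite h1// h2.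
by apply: ae_impl2 uI vI => t h1 h2 tT; rewrite h1// h2.
Qed.

Lemma EnormE v z : LpT T p z -> aeq T (fracD alpha v) z ->
  Enorm T p alpha v = pmass T p z `^ p^-1.
Proof. by move=> hz Dv; rewrite /Enorm (LpnormE_pmass p0 hz Dv). Qed.

Lemma energy_frechet u w : E0 T p alpha u -> derivative_space T p alpha w ->
  aeq T (fracD alpha u) w -> aeq T u (fracI alpha w) ->
  is_frechet_derivative (E0 T p alpha) (Enorm T p alpha)
    (energy T p alpha f) u (denergy T p alpha f u).
Proof.
move=> Eu Ww Du uI; have [hw _] := Ww; split.
- move=> k v v' Ev Ev'; have [z [Wz Dv vI _]] := E0_rep T0 p1 ap a1 Ev.
  have [z' [Wz' Dv' vI' _]] := E0_rep T0 p1 ap a1 Ev'.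
  have [_ D I] := E0_lin T0 p1 ap a1 k Ev Ev' Wz Wz' Dv vI Dv' vI'.
  rewrite (denergyE Du uI D I) (denergyE Du uI Dv vI) (denergyE Du uI Dv' vI').
  have [hz _] := Wz; have [hz' _] := Wz'.
  exact: (action_derivative_lin p1 ap a1 uf k hw hz hz').
- have [K HK] := action_derivative_bounded T0 p1 ap a1 uf hw.
  exists K => v Ev; have [z [[hz _] Dv vI _]] := E0_rep T0 p1 ap a1 Ev.
  by rewrite (denergyE Du uI Dv vI) (EnormE hz Dv); exact: HK.
- move=> e e0; have [d d0 Hd] := action_frechet T0 p1 ap a1 uf uF hw e0.
  exists d => // v Ev; have [z [Wz Dv vI _]] := E0_rep T0 p1 ap a1 Ev.
  have [hz _] := Wz; rewrite (denergyE Du uI Dv vI) (EnormE hz Dv) => zd.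
  have [_ D I] := E0_lin T0 p1 ap a1 1 Ev Eu Wz Ww Dv vI Du uI.
  have hwz := LpTD (ltW p0) hw hz.
  have -> : u \+ v = (fun t => 1 * v t + u t).
    by apply/funext => t /=; rewrite mul1r addrC.
  have wzE : (fun t => 1 * z t + w t) = w \+ z.
    by apply/funext => t /=; rewrite mul1r addrC.
  rewrite wzE in D I.
  rewrite (energyE hwz D I) (energyE hw Du uI).
  exact: Hd.
Qed.

End WeakSolution.

Theorem theorem1p1 (R : realType) (T p alpha : R) (f : R -> R -> R)
  (hT : 0 < T) (hp : 1 < p) (halpha : p^-1 < alpha <= 1)
  (hf : {within `[0, T] `*` [set: R],
          continuous (fun z : R * R => f z.1 z.2)})
  (hi : exists (r1 : R) (a : R -> R),
    [/\ 1 < r1 < p,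
        inLp T 1 a,
        forall t, t \in `[0, T] -> 0 <= a t &
        forall t x, t \in `[0, T] -> `|f t x| <= r1 * a t * `|x| `^ (r1 - 1)])
  (hii : exists c d eta delta r2 : R,
    [/\ c < d /\ `]c, d[ `<=` `[0, T],
        0 < eta, 0 < delta,
        1 < r2 < p &
        forall t x, t \in `]c, d[ -> x \in `[- delta, delta] ->
          eta * `|x| `^ r2 <= primitive f t x]) :
  exists u : R -> R,
    [/\ weak_solution T p alpha f u,
        {within `[0, T], continuous u},
        u 0 = 0 /\ u T = 0 &
        exists2 t, t \in `[0, T] & u t != 0].
Proof.
case/andP: halpha => ap a1; have p0 : 0 < p by exact: lt_trans hp.
have uf := within_ucont hf; have uF := ucont_primitive hf.
case: hi => r1 [a [/andP[r11 r1p] /(inLpP _ _ (lexx 1))[b hb ab] age0 fa]].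
have r10 : 0 < r1 by exact: lt_trans r11.
pose A t := r1 * `|b t|.
have iA : Rintegrable `[0, T] A.
  have [_ _ ib] := hb; apply: (RintegrableZ r1 (measurable_itv _)).
  by apply: (Rintegrable_eq _ _ ib) => // t _; rewrite powRr1.
have A0 t : 0 <= A t by rewrite mulr_ge0// ltW.
have FA : {ae (@lebesgue_measure R), forall t, t \in `[0, T] -> forall x,
    `|primitive f t x| <= A t * `|x| `^ r1}.
  apply: ae_impl ab => t h tT x; rewrite /A -(h tT) (ger0_norm (age0 t tT)).
  apply: primitive_growth => //; first exact: (ucont_slice uf tT).
    by rewrite mulr_ge0 ?age0// ltW.
  by move=> y; exact: fa.
have r1pp : 0 < r1 < p by rewrite r10.
have [w Ww wmin] := action_minimizer hT hp ap a1 r1pp uF iA A0 FA.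
have [hw _] := Ww.
pose u := fracI alpha w.
have [dE Du] : fracD_exists T alpha u /\ aeq T (fracD alpha u) w.
  exact: (fracD_fracI hp ap a1 hw).
have uI : aeq T u (fracI alpha w) by exact: aeq_refl.
have Eu : E0 T p alpha u := E0_intro hT hp ap a1 Ww dE Du uI.
have uc : {within `[0, T], continuous u} := fracI_continuous hp ap a1 hw.
exists u; split => //.
- split => //; first exact: (energy_frechet hT hp ap a1 uf uF Eu Ww Du uI).
  move=> v Ev; have [z [Wz Dv vI _]] := E0_rep hT hp ap a1 Ev.
  rewrite (denergyE p f Du uI Dv vI).
  exact: (minimizer_critical hT hp ap a1 uf uF Ww wmin Wz).
- by split; [exact: fracI_0|exact: (derivative_space_end hT hp ap a1 Ww)].
(* A minimizer with u = 0 would have nonnegative action, against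
   action_negative. *)
- apply: contrapT => H.
  have u0 t : t \in `[0, T] -> u t = 0.
    by move=> tT; apply/eqP/negP => /negP ut; apply: H; exists t.
  case: hii => c [d [eta [delta [r2 [[cd cdT] eta0 delta0 /andP[r21 r2p] FH]]]]].
  have r2pp : 0 < r2 < p by rewrite r2p (lt_trans ltr01).
  have [c0 dT] : 0 <= c /\ d <= T.
    have sub t : c < t < d -> 0 <= t <= T.
      by move=> tcd; have := cdT t; rewrite /= !in_itv/=; exact.
    split; rewrite leNgt; apply/negP => h.
      pose t := (c + Num.min 0 d) / 2.
      have : c < t < d by rewrite /t; case: (leP 0 d) => h'; lra.
      by move=> /sub; rewrite /t; case: (leP 0 d) => h'; lra.
    pose t := (d + Num.max T c) / 2.
    have : c < t < d by rewrite /t; case: (leP T c) => h'; lra.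
    by move=> /sub; rewrite /t; case: (leP T c) => h'; lra.
  have [v Wv neg] := action_negative hT hp ap a1 uF (primitive0 f) cd c0 dT eta0 delta0 r2pp FH.
  have := le_lt_trans (wmin v Wv) neg; rewrite /action.
  have -> : potential T (primitive f) (fracI alpha w) = 0.
    rewrite /potential (_ : \int[_]_(t in _) _ = \int[@lebesgue_measure R]_(t in `[0, T]) 0).
      by rewrite Rintegral_cst// mul0r.
    by apply: eq_Rintegral => t; rewrite inE => tT; rewrite -/u (u0 t tT) primitive0.
  by rewrite subr0 ltNge mulr_ge0 ?pmass_ge0// invr_ge0 ltW.
Qed.
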